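(* Suppose that condition $(C_\mu)$ (stated in the context) is satisfied. Let $\overline{\gamma}(t,s)$, $1\le s\le t$, be the solution of $$\overline{\gamma}(t,s)=K(t,s)-\sum_{l=1}^{s-1}\overline{\gamma}(t,l)\,\overline{\gamma}(s,l)\,\frac{S_l}{1+S_l\overline{\gamma}_l},\qquad S_l=A_l^2-\mu Q_l,\quad\overline{\gamma}_l=\overline{\gamma}(l,l).$$ Let $h=(h_t)_{t\ge1}$ be such that $h_t$ is $\mathcal{Y}_t$-measurable for every $t\ge1$, and let $(Z^h_t)_{t\ge1}$ be the solution of $$Z^h_t=m_t-\sum_{l=1}^{t-1}\overline{\gamma}(t,l)\frac{\mu Q_l}{1+S_l\overline{\gamma}_l}(h_l-Z^h_l)+\sum_{l=1}^{t-1}\overline{\gamma}(t,l)\frac{A_l}{1+S_l\overline{\gamma}_l}(Y_l-A_lZ^h_l).$$ Then for any $T\ge1$ the random variable $$\mathcal{I}_T=\mathbb{E}\left(\exp\left\{\frac{\mu}{2}\sum_{s=1}^T(X_s-h_s)^2Q_s\right\}\Big/\mathcal{Y}_T\right)$$ has the representation $$\mathcal{I}_T=\left(\prod_{t=1}^T\left[\frac{1+S_t\overline{\gamma}_t}{1+A_t^2\overline{\gamma}_t}\right]^{-1/2}\exp\left\{\frac{\mu}{2}\,Q_t\,\frac{1+A_t^2\overline{\gamma}_t}{1+S_t\overline{\gamma}_t}\left[h_t-\frac{Z^h_t+A_t\overline{\gamma}_tY_t}{1+A_t^2\overline{\gamma}_t}\right]^2\right\}\right)\times\mathcal{M}_T,$$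 where $(\mathcal{M}_T)_{T\ge1}$ is a martingale (with respect to $(\mathcal{Y}_T)_{T\ge 1}$) defined by $$\mathcal{M}_T=\prod_{t=1}^T\left[\frac{1+A_t^2\gamma_t}{1+A_t^2\overline{\gamma}_t}\right]^{1/2}\exp\left\{\frac{A_t}{1+A_t^2\overline{\gamma}_t}(Z^h_t-\pi_{t-1}(X_t))\nu_t-\frac12\,\frac{A_t^2}{1+A_t^2\overline{\gamma}_t}(Z^h_t-\pi_{t-1}(X_t))^2-\frac12\,\frac{A_t^2(\gamma_t-\overline{\gamma}_t)\,\nu_t^2}{(1+A_t^2\overline{\gamma}_t)(1+A_t^2\gamma_t)}\right\},$$ with $\pi_{t-1}(X_t)=\mathbb{E}(X_t/\mathcal{Y}_{t-1})$, innovations $\nu_t=Y_t-A_t\pi_{t-1}(X_t)$, and one-step prediction error variances $\gamma_t=\mathbb{E}(X_t-\pi_{t-1}(X_t))^2$.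
   Context: Setting: $X=(X_t)_{t\ge1}$ is an arbitrary real Gaussian sequence with mean $m_t=\mathbb{E}X_t$ and covariance $K(t,s)=\mathbb{E}(X_t-m_t)(X_s-m_s)$. The observations are $Y_t=A_tX_t+\varepsilon_t$, $t\ge 1$, where $(A_t)_{t\ge1}$ is a deterministic real sequence and $(\varepsilon_t)_{t\ge1}$ are i.i.d. $\mathcal{N}(0,1)$, independent of $X$. $\mathcal{Y}_t=\sigma(Y_u,\,1\le u\le t)$, with $\mathcal{Y}_0$ trivial. $\mu$ is a fixed real number and $(Q_t)_{t\ge1}$ a fixed sequence of nonnegative real numbers. $\mathbb{E}(\cdot/\mathcal{G})$ denotes conditional expectation given $\mathcal{G}$. Condition $(C_\mu)$: for every horizon $T\ge 1$, the equation $$\overline{\gamma}(t,s)=K(t,s)-\sum_{l=1}^{s-1}\overline{\gamma}(t,l)\,\overline{\gamma}(s,l)\,\frac{S_l}{1+S_l\overline{\gamma}_l},\qquad S_l=A_l^2-\mu Q_l,\quad\overline{\gamma}_l=\overline{\gamma}(l,l),$$ has a unique and bounded solution on $\{(t,s):1\le s\le t\le T\}$, such that $\overline{\gamma}_l=\overline{\gamma}(l,l)\ge0$ and $1+S_l\overline{\gamma}_l>0$ for all $l\ge1$. *)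

(* Defs.v *)
From HB Require Import structures.
From mathcomp Require Import all_boot all_order all_algebra.
From mathcomp Require Import all_classical all_reals all_analysis.
From mathcomp Require Import measurable_realfun.

Set Implicit Arguments.
Unset Strict Implicit.
Unset Printing Implicit Defensive.

Import Order.TTheory GRing.Theory Num.Theory.
Import numFieldNormedType.Exports.

Local Open Scope classical_set_scope.
Local Open Scope ring_scope.

(* All sequences are indexed by [nat] and only their terms of index >= 1
   matter. *)

Section sigma_algebras.
Context {d : measure_display} {R : realType} {Omega : measurableType d}.

Definition gen_sigma (D : set nat) (f : nat -> Omega -> R) : set_system Omega :=
  <<s \bigcup_(t in D) preimage_set_system setT (f t) measurable >>.

(* For t = 0 the family is empty, so this is the trivial sigma-algebra. *)
Definition natural_filtration (Y : nat -> Omega -> R) (t : nat) :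
    set_system Omega :=
  gen_sigma [set u | (1 <= u <= t)%N] Y.

Definition measurable_wrt d' (T' : measurableType d') (G : set_system Omega)
    (f : Omega -> T') : Prop :=
  preimage_set_system setT f measurable `<=` G.

End sigma_algebras.

Section probability_notions.
Context {d : measure_display} {R : realType} {Omega : measurableType d}.
Variable P : probability Omega R.

(* [normal_prob m 0] is a junk value in the library (a uniform law), whereas a
   Gaussian law with zero variance is a point mass. *)
Definition gaussian_law (m s : R) : set R -> \bar R :=
  if s == 0 then \d_m else normal_prob m s.

Definition has_law (V : Omega -> R) (L : set R -> \bar R) : Prop :=
  forall B : set R, measurable B -> P (V @^-1` B) = L B.

Definition gaussian_sequence (X : nat -> Omega -> R) : Prop :=
  forall (n : nat) (a : nat -> R), exists m s : R,
    has_law (fun w => \sum_(1 <= t < n.+1) a t * X t w) (gaussian_law m s).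

Definition mutually_independent (D : set nat) (f : nat -> Omega -> R) : Prop :=
  forall (J : seq nat) (B : nat -> set R),
    uniq J -> (forall i, i \in J -> D i) -> (forall i, measurable (B i)) ->
    P (\bigcap_(i in [set` J]) f i @^-1` B i) =
    (\prod_(i <- J) P (f i @^-1` B i))%E.

Definition independent_sigma (F G : set_system Omega) : Prop :=
  forall A B, F A -> G B -> P (A `&` B) = (P A * P B)%E.

(* [V] is a version of the conditional expectation of [U] given the
   sub-sigma-algebra [G].  It is meant for [U] integrable (and then [V] is
   integrable, taking [A] to be [V >= 0] and [V < 0]) or for [U] nonnegative,
   possibly of infinite integral (and then [V] is nonnegative almost surely).
   In both cases versions are almost surely unique. *)
Definition is_cond_exp (G : set_system Omega) (U V : Omega -> \bar R) : Prop :=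
  measurable_wrt G V /\
  forall A, G A -> (\int[P]_(w in A) V w = \int[P]_(w in A) U w)%E.

Definition is_martingale (F : nat -> set_system Omega) (M : nat -> Omega -> R) :
    Prop :=
  [/\ forall t, (1 <= t)%N -> measurable_wrt (F t) (M t),
      forall t, (1 <= t)%N -> P.-integrable setT (EFin \o M t) &
      forall s t, (1 <= s <= t)%N ->
        is_cond_exp (F s) (EFin \o M t) (EFin \o M s)].

End probability_notions.

Section riccati_type_equation.
Context {R : realType}.
Variables (mu : R) (A Q : nat -> R) (K : nat -> nat -> R).

Definition S_coef (l : nat) : R := A l ^+ 2 - mu * Q l.

Definition gammabar_eq (g : nat -> nat -> R) (t s : nat) : Prop :=
  g t s = K t s - \sum_(1 <= l < s)
            g t l * g s l * (S_coef l / (1 + S_coef l * g l l)).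

Definition solves_upto (T : nat) (g : nat -> nat -> R) : Prop :=
  forall t s, (1 <= s <= t)%N -> (t <= T)%N -> gammabar_eq g t s.

Definition condition_C : Prop :=
  forall T : nat, (1 <= T)%N -> exists g : nat -> nat -> R,
    [/\ solves_upto T g,
        (forall g' : nat -> nat -> R, solves_upto T g' ->
          forall t s, (1 <= s <= t)%N -> (t <= T)%N -> g' t s = g t s),
        (exists C : R,
          forall t s, (1 <= s <= t)%N -> (t <= T)%N -> `|g t s| <= C) &
        (forall l, (1 <= l <= T)%N -> 0 <= g l l /\ 0 < 1 + S_coef l * g l l)].

End riccati_type_equation.

(* Main.v *)
(* The signal is integrated out by a change of measure.  Let Lambda_T be the product
   over t <= T of exp(- (A_t X_t)^2 / 2 - A_t X_t eps_t).  Under Lambda_T . P the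
   observations Y_1, ..., Y_T are i.i.d. N(0, 1) and independent of X, whose law is
   unchanged, and Lambda_T * exp(sum (A_t Y_t X_t - A_t^2 X_t^2 / 2)) = 1.  Hence,
   with b_t = A_t Y_t - mu Q_t h_t and S_t = A_t^2 - mu Q_t, the conditional expectation
   I_T is exp(mu / 2 sum Q_t h_t^2) times the quotient of
   E_X exp(sum (b_t X_t - S_t X_t^2 / 2)) by the same quantity with mu = 0, where h and Y
   are frozen.  These Gaussian integrals are computed one time step at a time: tilting a
   Gaussian law by exp(b x - S x^2 / 2) gives a Gaussian law whose covariance and mean
   are updated by the Riccati-type equation and by the equation of Z^h.  For mu = 0 this
   is the Kalman filter, which yields pi_{t-1}(X_t) and gamma_t, and the representation
   follows by algebra.  M_T is the likelihood ratio of the successive Gaussian densities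
   N(A_t Z_t, 1 + A_t^2 gammabar_t) and N(A_t pi_t, 1 + A_t^2 gamma_t) at Y_t, hence a
   martingale.

   Since only the laws of linear combinations of X are given, the tilting formula is
   obtained from moment generating functions: two weighted measures with the same finite
   moment generating function have the same even moments, hence give the same integral to
   exp(s x^2). *)

Require Import Defs.
From HB Require Import structures.
From mathcomp Require Import all_boot all_order all_algebra.
From mathcomp Require Import all_classical all_reals all_analysis.
From mathcomp Require Import measurable_realfun.
From mathcomp Require Import ring lra.

Set Implicit Arguments.
Unset Strict Implicit.
Unset Printing Implicit Defensive.

Import Order.TTheory GRing.Theory Num.Theory.
Import numFieldNormedType.Exports.

Local Open Scope classical_set_scope.
Local Open Scope ring_scope.

(** * Comparison of moment generating functions *)

(** The passage from moment generating functions to integrals of [expR (s * x ^+ 2)] must avoid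
    interchanging limits with signed integrands. After symmetrisation,
    [expR (b * x) + expR (- b * x)] expands into nonnegative terms, so monotone convergence is
    enough and infinite values are harmless. The case S > 0 is the harder one: the power series of
    the tilt alternates, so the tilt is written as a difference of two series with nonnegative
    coefficients. This requires the opposite tilt to have a finite integral, which holds only for
    small steps, hence an iteration. Freezing [h] and [Y] is done without regular conditional laws:
    the identity of [Omega], viewed in the sigma-algebra of the signal and in that of the
    observations, is a pair with a product law under the changed measure, and Tonelli applies. No
    quotient of conditional expectations is formed either: for nonnegative functions of the
    observations, [filter_bayes] inserts a factor [mass0 * girsanov] under the integral sign. *)

Section power_series.
Context {R : realType}.
Local Open Scope ereal_scope.

Lemma nneseries_expR (b : R) : (0 <= b)%R ->
  \sum_(0 <= n <oo) (b ^+ n / n`!%:R)%:E = (expR b)%:E.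
Proof.
move=> b0; rewrite /expR -EFin_lim; last exact: is_cvg_series_exp_coeff.
by congr (limn _); apply/funext => n; rewrite /series/= sumEFin.
Qed.

Lemma nneseries_expRDN (b : R) :
  \sum_(0 <= n <oo) ((b ^+ n + (- b) ^+ n) / n`!%:R)%:E =
  (expR b + expR (- b))%:E.
Proof.
rewrite /expR -limD; [|exact: is_cvg_series_exp_coeff..].
rewrite -EFin_lim; last by apply: is_cvgD; exact: is_cvg_series_exp_coeff.
congr (limn _); apply/funext => n; rewrite /series/= sumEFin; congr EFin.
by rewrite fctE -big_split /=; apply: eq_bigr => i _; rewrite mulrDl.
Qed.

Lemma nneseries_expRBN (b : R) :
  \sum_(0 <= n <oo) ((b ^+ n - (- b) ^+ n) / n`!%:R)%:E =
  (expR b - expR (- b))%:E.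
Proof.
rewrite /expR -limB; [|exact: is_cvg_series_exp_coeff..].
rewrite -EFin_lim; last by apply: is_cvgB; exact: is_cvg_series_exp_coeff.
congr (limn _); apply/funext => n; rewrite /series/= sumEFin; congr EFin.
by rewrite fctE -sumrB; apply: eq_bigr => i _; rewrite mulrBl.
Qed.

(** Once the lower coefficients are cancelled, [b ^+ n * c n] is at most
    [b ^+ n * e n + b ^+ n.+1 * D], with [D] the sum of the [e k]. Divide by [b ^+ n] and let [b]
    tend to 0. *)
Lemma le_pseries_coef (c e : nat -> R) (n : nat) :
  (forall k, (0 <= c k)%R) -> (forall k, (0 <= e k)%R) ->
  (forall b : R, (0 < b <= 1)%R ->
    \sum_(0 <= k <oo) (b ^+ k * c k)%:E = \sum_(0 <= k <oo) (b ^+ k * e k)%:E) ->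
  \sum_(0 <= k <oo) (e k)%:E < +oo ->
  (forall k, (k < n)%N -> c k = e k) -> (c n <= e n)%R.
Proof.
move=> c0 e0 ce eoo cen.
have e0' (N k : nat) : (N <= k)%N -> 0%R <= (e k)%:E by move=> _; rewrite lee_fin e0.
have D0 : 0 <= \sum_(0 <= k <oo) (e k)%:E by apply: nneseries_ge0 => k ? _; exact: (e0' 0%N).
move: eoo; set D := \sum_(0 <= k <oo) _ in D0 *; move=> eoo.
have Dfin : D \is a fin_num by rewrite ge0_fin_numE.
have key (b : R) : (0 < b <= 1)%R -> (c n <= e n + b * fine D)%R.
  move=> /andP[b0 b1]; have b0' := ltW b0.
  have bc (f : nat -> R) (f0 : forall k, (0 <= f k)%R) (N k : nat) :
    (N <= k)%N -> 0%R <= (b ^+ k * f k)%:E.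
    by move=> _; rewrite lee_fin mulr_ge0 ?f0 ?exprn_ge0.
  have := ce b; rewrite b0 b1 => /(_ isT).
  rewrite (nneseries_split 0 n) ?add0n; last exact: bc.
  rewrite (@nneseries_split _ (fun k => (b ^+ k * e k)%:E) 0 n) ?add0n; last exact: bc.
  have -> : (\sum_(0 <= k < n) (b ^+ k * c k)%:E =
             \sum_(0 <= k < n) (b ^+ k * e k)%:E)%R.
    by apply: eq_big_nat => k /andP[_ kn]; rewrite cen.
  rewrite sumEFin => /(congr1 (fun x => x - (\sum_(0 <= i < n) b ^+ i * e i)%R%:E)).
  rewrite /= ![(_%:E + _)]addeC !addeK // => ce'.
  have : (b ^+ n * c n)%:E <= \sum_(n <= k <oo) (b ^+ k * c k)%:E.
    rewrite (nneseries_split n 1) ?addn1 ?big_nat1; last exact: bc.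
    by rewrite leeDl //; apply: nneseries_ge0 => k ? _; exact: (bc _ _ 0%N).
  rewrite ce' (nneseries_split n 1) ?addn1 ?big_nat1; last exact: bc.
  have : \sum_(n.+1 <= k <oo) (b ^+ k * e k)%:E <= (b ^+ n.+1)%:E * D.
    rewrite /D -nneseriesZl; last by move=> i _; rewrite lee_fin e0.
    apply: (@le_trans _ _ (\sum_(n.+1 <= k <oo) ((b ^+ n.+1)%:E * (e k)%:E))).
      rewrite -(@nneseries_addn _ (fun k => (b ^+ k * e k)%:E)); last first.
        by move=> i; apply: (bc _ _ 0%N).
      rewrite -(@nneseries_addn _ (fun k => (b ^+ n.+1)%:E * (e k)%:E)).
        apply: lee_nneseries => i _; first by move=> _; apply: (bc _ _ 0%N).
        rewrite -EFinM lee_fin ler_wpM2r ?e0 // exprD ler_piMl ?exprn_ge0 ?exprn_ile1 //.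
      by move=> i; rewrite -EFinM lee_fin mulr_ge0 ?e0 ?exprn_ge0.
    rewrite [leRHS](nneseries_split 0 n.+1) ?add0n; last first.
      by move=> k _; rewrite -EFinM lee_fin mulr_ge0 ?e0 ?exprn_ge0.
    by rewrite leeDr //; apply: sume_ge0 => k _; rewrite -EFinM lee_fin mulr_ge0 ?e0 ?exprn_ge0.
  rewrite -(fineK Dfin) -EFinM => h1 h2.
  have := le_trans h2 (leeD2l _ h1).
  by rewrite -EFinD lee_fin exprSr -mulrA -mulrDr ler_pM2l // exprn_gt0.
rewrite leNgt; apply/negP => lt_ec.
have D0' : (0 <= fine D)%R by apply: fine_ge0.
(* This makes [b * D] at most half of the gap [c n - e n]; the summand 1 keeps the denominator
   positive when [D = 0]. *)
pose b := Num.min 1%R ((c n - e n) / (2 * (fine D + 1)))%R.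
have pos : (0 < (c n - e n) / (2 * (fine D + 1)))%R.
  by rewrite divr_gt0 ?subr_gt0 // mulr_gt0 // ltr_wpDl.
have b01 : (0 < b <= 1)%R by rewrite /b lt_min ltr01 pos ge_min lexx.
have := key _ b01.
have bD : (b * fine D <= (c n - e n) / 2)%R.
  apply: (@le_trans _ _ (b * (fine D + 1))%R).
    by rewrite ler_wpM2l ?lerDl //; case/andP: b01 => /ltW.
  apply: (@le_trans _ _ ((c n - e n) / (2 * (fine D + 1)) * (fine D + 1))%R).
    by rewrite ler_wpM2r ?ge_min ?lexx ?orbT // addr_ge0.
  rewrite le_eqVlt; apply/orP; left; apply/eqP; field; exact: lt0r_neq0 (ltr_wpDl D0' ltr01).
have : (0 < c n - e n)%R by rewrite subr_gt0.
move: bD; set x := (b * fine D)%R; set u := c n; set v := e n; clear; lra.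
Qed.

Lemma pseries_coef_inj (c e : nat -> R) :
  (forall k, (0 <= c k)%R) -> (forall k, (0 <= e k)%R) ->
  (forall b : R, (0 < b <= 1)%R ->
    \sum_(0 <= k <oo) (b ^+ k * c k)%:E = \sum_(0 <= k <oo) (b ^+ k * e k)%:E) ->
  \sum_(0 <= k <oo) (e k)%:E < +oo ->
  forall n, c n = e n.
Proof.
move=> c0 e0 ce eoo; elim/ltn_ind => n IH.
apply/eqP; rewrite eq_le (le_pseries_coef c0 e0 ce eoo IH) /=.
apply: (le_pseries_coef e0 c0) => //.
- by move=> b b01; rewrite ce.
(* At [b = 1] the two sums coincide, so that of [c] is finite too. *)
- have := ce 1%R; rewrite ltr01 lexx => /(_ isT).
  under eq_eseriesr do rewrite expr1n mul1r.
  by under [in X in _ = X -> _]eq_eseriesr do rewrite expr1n mul1r; move=> ->.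
- by move=> k kn; rewrite IH.
Qed.

End power_series.

Lemma exprDN_ge0 (R : realDomainType) (x : R) n : 0 <= x ^+ n + (- x) ^+ n.
Proof.
rewrite exprNn -signr_odd; case: (boolP (odd n)) => on.
  by rewrite expr1 mulN1r subrr.
by rewrite expr0 mul1r addr_ge0 // exprn_even_ge0.
Qed.

Section weighted_mgf.
Context d (T : measurableType d) (R : realType) (mu : {measure set T -> \bar R}).
Implicit Types W x : T -> R.
Local Open Scope ereal_scope.

Definition wmgf W x (a : R) := \int[mu]_w (W w * expR (a * x w))%:E.

(* Twice the [n]-th moment if [n] is even, and [0] otherwise. *)
Definition wmom W x (n : nat) := \int[mu]_w (W w * (x w ^+ n + (- x w) ^+ n))%:E.

Variables (W x : T -> R).
Hypotheses (mW : measurable_fun setT W) (mx : measurable_fun setT x).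
Hypothesis W0 : forall w, (0 <= W w)%R.

Lemma wmom_ge0 n : 0 <= wmom W x n.
Proof. by apply: integral_ge0 => w _; rewrite lee_fin mulr_ge0 ?exprDN_ge0. Qed.

Lemma measurable_wexp a : measurable_fun setT (fun w => (W w * expR (a * x w))%:E).
Proof.
apply/measurable_EFinP/measurable_funM => //.
by apply: measurableT_comp => //; exact: measurable_funM.
Qed.

Lemma measurable_wpow n :
  measurable_fun setT (fun w => (W w * (x w ^+ n + (- x w) ^+ n))%:E).
Proof.
apply/measurable_EFinP/measurable_funM => //; apply: measurable_funD.
  exact: measurable_funX.
by apply: measurable_funX; exact: measurableT_comp.
Qed.

(** After symmetrisation every term of the exponential series is nonnegative, so integrating term by
    term is monotone convergence. *)
Lemma wmgfDN (b : R) : (0 <= b)%R ->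
  wmgf W x b + wmgf W x (- b) = \sum_(0 <= n <oo) (b ^+ n / n`!%:R)%:E * wmom W x n.
Proof.
move=> b0; rewrite /wmgf -ge0_integralD//; last 4 first.
- by move=> w _; rewrite lee_fin mulr_ge0 ?expR_ge0.
- exact: measurable_wexp.
- by move=> w _; rewrite lee_fin mulr_ge0 ?expR_ge0.
- exact: measurable_wexp.
have bn0 n : (0 <= b ^+ n / n`!%:R)%R by rewrite divr_ge0 ?exprn_ge0.
transitivity (\int[mu]_w \sum_(0 <= n <oo)
    (b ^+ n / n`!%:R)%:E * (W w * (x w ^+ n + (- x w) ^+ n))%:E).
  apply: eq_integral => w _; rewrite -EFinD -mulrDr mulNr EFinM -nneseries_expRDN.
  rewrite -nneseriesZl; last first.
    by move=> n _; rewrite lee_fin divr_ge0 ?exprDN_ge0.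
  apply: eq_eseriesr => n _; rewrite -!EFinM; congr EFin.
  by rewrite -mulrN !exprMn -mulrDr; ring.
rewrite integral_nneseries//; last 2 first.
- by move=> n; apply: measurable_funeM; exact: measurable_wpow.
- move=> n w _; rewrite -EFinM lee_fin; apply: mulr_ge0; first exact: bn0.
  by rewrite mulr_ge0 ?exprDN_ge0.
apply: eq_eseriesr => n _; rewrite ge0_integralZl_EFin //.
- by move=> w _; rewrite lee_fin mulr_ge0 ?exprDN_ge0.
- exact: measurable_wpow.
Qed.

Hypothesis fin : forall a, wmgf W x a < +oo.

(** One infinite moment would make the whole series of [wmgfDN] infinite at [b = 1]. *)
Lemma wmom_fin n : wmom W x n \is a fin_num.
Proof.
rewrite ge0_fin_numE ?wmom_ge0 //.
have := lte_add_pinfty (fin 1) (fin (- 1)%R); rewrite wmgfDN // => h.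
rewrite ltey; apply/eqP => moo; move: h; rewrite (@nneseries_pinfty _ _ _ n) //.
  by move=> k _; rewrite mule_ge0 ?wmom_ge0 // lee_fin divr_ge0.
by rewrite moo gt0_muley // lte_fin divr_gt0 ?exprn_gt0 ?ltr0n ?fact_gt0.
Qed.

(** Nonnegative coefficients and even powers again allow termwise integration; the division by 2
    undoes the doubling in [wmom]. *)
Lemma integral_pseries (p : nat -> R) (phi : T -> R) :
  (forall n, (0 <= p n)%R) ->
  (forall w, (phi w)%:E = \sum_(0 <= n <oo) (p n * x w ^+ n.*2)%:E) ->
  \int[mu]_w (W w * phi w)%:E = \sum_(0 <= n <oo) (p n / 2)%:E * wmom W x n.*2.
Proof.
move=> p0 phiE.
transitivity (\int[mu]_w \sum_(0 <= n <oo)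
    (p n / 2)%:E * (W w * (x w ^+ n.*2 + (- x w) ^+ n.*2))%:E).
  apply: eq_integral => w _; rewrite EFinM phiE -nneseriesZl; last first.
    by move=> n _; rewrite lee_fin mulr_ge0 // exprn_even_ge0 ?odd_double.
  apply: eq_eseriesr => n _; rewrite -!EFinM; congr EFin.
  by rewrite exprNn -signr_odd odd_double; field.
rewrite integral_nneseries//; last 2 first.
- by move=> n; apply: measurable_funeM; exact: measurable_wpow.
- move=> n w _; rewrite -EFinM lee_fin; apply: mulr_ge0; first by rewrite divr_ge0 ?p0.
  by rewrite mulr_ge0 ?exprDN_ge0.
apply: eq_eseriesr => n _; rewrite ge0_integralZl_EFin //.
- by move=> w _; rewrite lee_fin mulr_ge0 ?exprDN_ge0.
- exact: measurable_wpow.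
- by rewrite divr_ge0.
Qed.

End weighted_mgf.

Section mgf_comparison.
Context d1 (T1 : measurableType d1) d2 (T2 : measurableType d2) (R : realType).
Variables (mu1 : {measure set T1 -> \bar R}) (mu2 : {measure set T2 -> \bar R}).
Local Open Scope ereal_scope.

Variables (W1 x1 : T1 -> R) (W2 x2 : T2 -> R).
Hypotheses (mW1 : measurable_fun setT W1) (mx1 : measurable_fun setT x1)
  (mW2 : measurable_fun setT W2) (mx2 : measurable_fun setT x2).
Hypotheses (W10 : forall w, (0 <= W1 w)%R) (W20 : forall w, (0 <= W2 w)%R).
Hypothesis fin2 : forall a, wmgf mu2 W2 x2 a < +oo.
Hypothesis mgfE : forall a, wmgf mu1 W1 x1 a = wmgf mu2 W2 x2 a.

Let fin1 a : wmgf mu1 W1 x1 a < +oo. Proof. by rewrite mgfE. Qed.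

(** Divided by factorials, the moments are the coefficients of the symmetrised generating function,
    a power series with nonnegative terms on (0, 1], where [pseries_coef_inj] applies. *)
Lemma eq_wmom n : wmom mu1 W1 x1 n = wmom mu2 W2 x2 n.
Proof.
have key d (T : measurableType d) (mu : {measure set T -> \bar R}) (W x : T -> R) :
  measurable_fun setT W -> measurable_fun setT x -> (forall w, 0 <= W w)%R ->
  (forall a, wmgf mu W x a < +oo) -> forall b : R, (0 <= b)%R ->
  wmgf mu W x b + wmgf mu W x (- b)%R =
    \sum_(0 <= k <oo) (b ^+ k * (fine (wmom mu W x k) / k`!%:R))%:E.
  move=> mW mx W0 fin b b0; rewrite wmgfDN //; apply: eq_eseriesr => k _.
  by rewrite -[in LHS](fineK (wmom_fin mW mx W0 fin k)) -EFinM; congr EFin; ring.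
have c0 d (T : measurableType d) (mu : {measure set T -> \bar R}) (W x : T -> R) k :
    (forall w, 0 <= W w)%R -> (0 <= fine (wmom mu W x k) / k`!%:R)%R.
  by move=> W0; rewrite divr_ge0 // fine_ge0 // wmom_ge0.
have := @pseries_coef_inj _ (fun k => fine (wmom mu1 W1 x1 k) / k`!%:R)%R
  (fun k => fine (wmom mu2 W2 x2 k) / k`!%:R)%R.
move=> /(_ (fun k => c0 _ _ _ _ _ k W10) (fun k => c0 _ _ _ _ _ k W20)).
have E b : (0 < b <= 1)%R ->
  \sum_(0 <= k <oo) (b ^+ k * (fine (wmom mu1 W1 x1 k) / k`!%:R))%:E =
  \sum_(0 <= k <oo) (b ^+ k * (fine (wmom mu2 W2 x2 k) / k`!%:R))%:E.
  by move=> /andP[/ltW b0 _]; rewrite -!key // !mgfE.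
move=> /(_ E).
have foo : \sum_(0 <= k <oo) (fine (wmom mu2 W2 x2 k) / k`!%:R)%:E < +oo.
  have := lte_add_pinfty (fin2 1) (fin2 (- 1)%R); rewrite key //.
  by under eq_eseriesr do rewrite expr1n mul1r.
move=> /(_ foo n) /(congr1 (fun y => (y * n`!%:R)%:E)).
rewrite !divfK ?fineK ?wmom_fin // pnatr_eq0 -lt0n; exact: fact_gt0.
Qed.

Lemma eq_wint_pseries (p : nat -> R) (f : R -> R) :
  (forall n, (0 <= p n)%R) ->
  (forall y, (f y)%:E = \sum_(0 <= n <oo) (p n * y ^+ n.*2)%:E) ->
  \int[mu1]_w (W1 w * f (x1 w))%:E = \int[mu2]_w (W2 w * f (x2 w))%:E.
Proof.
move=> p0 fE; rewrite (integral_pseries _ mW1 mx1 W10 p0 (fun w => fE _)).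
rewrite (integral_pseries _ mW2 mx2 W20 p0 (fun w => fE _)).
by apply: eq_eseriesr => n _; rewrite eq_wmom.
Qed.

(** For [s >= 0] the function [expR (s * y ^+ 2)] is a series in [y ^+ 2] with nonnegative
    coefficients. The common value may be infinite. *)
Lemma eq_wint_expR_sqr (s : R) : (0 <= s)%R ->
  \int[mu1]_w (W1 w * expR (s * x1 w ^+ 2))%:E =
  \int[mu2]_w (W2 w * expR (s * x2 w ^+ 2))%:E.
Proof.
move=> s0; apply: (@eq_wint_pseries (fun n => s ^+ n / n`!%:R)%R
  (fun y => expR (s * y ^+ 2))).
  by move=> n; rewrite divr_ge0 // exprn_ge0.
move=> y; rewrite -nneseries_expR; last by apply: mulr_ge0 => //; exact: sqr_ge0.
apply: eq_eseriesr => n _; congr EFin.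
by rewrite exprMn -exprM mul2n; ring.
Qed.

(* [2 exp (- u) + (exp u - exp (- u)) = exp u + exp (- u)], where the last two
   brackets are power series with nonnegative coefficients. *)
Lemma eq_wint_expRN_sqr (s : R) : (0 <= s)%R ->
  \int[mu2]_w (W2 w * expR (s * x2 w ^+ 2))%:E < +oo ->
  \int[mu1]_w (W1 w * expR (- s * x1 w ^+ 2))%:E =
  \int[mu2]_w (W2 w * expR (- s * x2 w ^+ 2))%:E.
Proof.
move=> s0 soo.
pose ch (y : R) : R := (expR (s * y ^+ 2) + expR (- (s * y ^+ 2)))%R.
pose sh (y : R) : R := (expR (s * y ^+ 2) - expR (- (s * y ^+ 2)))%R.
have chE : \int[mu1]_w (W1 w * ch (x1 w))%:E = \int[mu2]_w (W2 w * ch (x2 w))%:E.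
  apply: (@eq_wint_pseries (fun n => (s ^+ n + (- s) ^+ n) / n`!%:R)%R).
    by move=> n; rewrite divr_ge0 // exprDN_ge0.
  move=> y; rewrite -nneseries_expRDN; apply: eq_eseriesr => n _; congr EFin.
  by rewrite -mulNr !exprMn -addnn exprD; ring.
have shE : \int[mu1]_w (W1 w * sh (x1 w))%:E = \int[mu2]_w (W2 w * sh (x2 w))%:E.
  apply: (@eq_wint_pseries (fun n => (s ^+ n - (- s) ^+ n) / n`!%:R)%R).
    move=> n; rewrite divr_ge0 // exprNn -signr_odd.
    by case: (odd n); rewrite ?expr0 ?expr1 ?mulN1r ?opprK ?mul1r ?subrr // addr_ge0 ?exprn_ge0.
  move=> y; rewrite -nneseries_expRBN; apply: eq_eseriesr => n _; congr EFin.
  by rewrite -mulNr !exprMn -addnn exprD; ring.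
have sh0 y : (0 <= sh y)%R.
  rewrite /sh subr_ge0 ler_expR; apply: (@le_trans _ _ 0%R).
    by rewrite oppr_le0 mulr_ge0 // sqr_ge0.
  by rewrite mulr_ge0 // sqr_ge0.
have key d (T : measurableType d) (mu : {measure set T -> \bar R}) (W x : T -> R) :
  measurable_fun setT W -> measurable_fun setT x -> (forall w, 0 <= W w)%R ->
  \int[mu]_w (W w * expR (s * x w ^+ 2))%:E < +oo ->
  2%:E * \int[mu]_w (W w * expR (- s * x w ^+ 2))%:E =
    \int[mu]_w (W w * ch (x w))%:E - \int[mu]_w (W w * sh (x w))%:E.
  move=> mW mx W0 foo.
  have mx2' : measurable_fun setT (fun w => s * x w ^+ 2)%R.
    by apply: measurable_funM => //; exact: measurable_funX.
  have msh : measurable_fun setT (fun w => (W w * sh (x w))%:E).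
    apply/measurable_EFinP/measurable_funM => //; apply: measurable_funB.
      exact: measurableT_comp.
    by apply: measurableT_comp => //; exact: measurableT_comp.
  have mexpN : measurable_fun setT (fun w => (W w * expR (- s * x w ^+ 2))%:E).
    apply/measurable_EFinP/measurable_funM => //; apply: measurableT_comp => //.
    by apply: measurable_funM => //; exact: measurable_funX.
  (* The subtraction requires this integral to be finite, which follows from
     [sh y <= expR (s * y ^+ 2)]. *)
  have shfin : \int[mu]_w (W w * sh (x w))%:E \is a fin_num.
    rewrite ge0_fin_numE; last first.
      by apply: integral_ge0 => w _; rewrite lee_fin mulr_ge0.
    apply: le_lt_trans foo; apply: ge0_le_integral => //.
    - by move=> w _; rewrite lee_fin mulr_ge0.
    - apply/measurable_EFinP/measurable_funM => //; exact: measurableT_comp.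
    - by move=> w _; rewrite lee_fin ler_wpM2l // /sh gerBl expR_ge0.
  rewrite -ge0_integralZl_EFin //; last first.
    by move=> w _; rewrite lee_fin mulr_ge0 ?expR_ge0.
  rewrite -[LHS](addeK _ shfin) -ge0_integralD //; last 3 first.
  - by move=> w _; rewrite -EFinM lee_fin !mulr_ge0 ?expR_ge0.
  - exact: measurable_funeM.
  - by move=> w _; rewrite lee_fin mulr_ge0.
  congr (_ - _); apply: eq_integral => w _; rewrite -EFinM -EFinD; congr EFin.
  by rewrite /ch /sh -mulNr; ring.
have := key _ _ mu1 W1 x1 mW1 mx1 W10; rewrite eq_wint_expR_sqr // chE shE.
move=> /(_ soo); rewrite -key //.
move=> /(congr1 (fun y => (2^-1)%:E * y)).
by rewrite !muleA -EFinM mulVf // !mul1e.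
Qed.

End mgf_comparison.

(** * Integration against a density and Gaussian integrals on the line *)

Section density.
Import HBNNSimple.
Context d (T : measurableType d) (R : realType).
Variables (mu nu : {measure set T -> \bar R}) (L : T -> R).
Hypotheses (mL : measurable_fun setT L) (L0 : forall x, 0 <= L x).
Local Open Scope ereal_scope.
Hypothesis nuE : forall A, measurable A -> nu A = \int[mu]_(x in A) (L x)%:E.

(** Both sides are limits along the same increasing simple functions, for which the claim is [nuE]
    on level sets. *)
Lemma ge0_integral_density (f : T -> \bar R) :
  measurable_fun setT f -> (forall x, 0 <= f x) ->
  \int[nu]_x f x = \int[mu]_x (f x * (L x)%:E).
Proof.
move=> mf f0; pose f_ := nnsfun_approx measurableT mf.
have f_E x : f x = limn (EFin \o f_ ^~ x).
  by apply/esym/cvg_lim => //; apply: cvg_nnsfun_approx.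
transitivity (limn (fun n => \int[nu]_x (f_ n x)%:E)).
  rewrite -monotone_convergence//.
  - by apply: eq_integral => x _; rewrite f_E.
  - by move=> n; exact/measurable_EFinP.
  - by move=> n x _; rewrite lee_fin.
  - by move=> x _ m n mn; rewrite lee_fin; exact/lefP/nd_nnsfun_approx.
transitivity (limn (fun n => \int[mu]_x ((f_ n x)%:E * (L x)%:E))); last first.
  rewrite -monotone_convergence//.
  - apply: eq_integral => x _; rewrite f_E limeMr //.
      apply: ereal_nondecreasing_is_cvgn => m n mn; rewrite lee_fin.
      exact/lefP/nd_nnsfun_approx.
  - by move=> n; apply: emeasurable_funM; exact/measurable_EFinP.
  - by move=> n x _; rewrite -EFinM lee_fin mulr_ge0.
  - move=> x _ m n mn; rewrite -!EFinM lee_fin ler_wpM2r//; exact/lefP/nd_nnsfun_approx.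
congr (limn _); apply/funext => n.
rewrite integralT_nnsfun sintegralE.
under [RHS]eq_integral.
  move=> x _; rewrite fimfunE -fsumEFin // ge0_mule_fsuml; last first.
    by move=> r; rewrite EFinM nnfun_muleindic_ge0.
  over.
rewrite ge0_integral_fsum //; last 2 first.
- move=> r; apply: emeasurable_funM; last exact/measurable_EFinP.
  by apply/measurable_EFinP/measurable_funM.
- by move=> r x _; apply: mule_ge0; [rewrite EFinM nnfun_muleindic_ge0|rewrite lee_fin].
apply: eq_fsbigr => r _.
(* A level set at a negative value is empty, as the simple functions are nonnegative. *)
have [r0|r0] := leP 0%R r; last first.
  rewrite preimage_nnfun0 // measure0 mule0 integral0_eq // => x _.
  by rewrite indic0 mulr0 mul0e.
under eq_integral do rewrite EFinM -muleA.
rewrite ge0_integralZl_EFin //; last 2 first.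
- by move=> x _; rewrite -EFinM lee_fin mulr_ge0.
- by apply/emeasurable_funM => //; exact/measurable_EFinP.
congr (_ * _); rewrite nuE // integral_mkcond /=; apply: eq_integral => x _.
by rewrite patchE indicE; case: ifP => _; rewrite ?mul1e ?mul0e.
Qed.

End density.

Section gaussian_reference.
Context {R : realType}.
Local Open Scope ereal_scope.

Lemma ge0_integral_normal_prob (m s : R) (f : R -> \bar R) :
  measurable_fun setT f -> (forall x, 0 <= f x) ->
  \int[normal_prob m s]_x f x = \int[lebesgue_measure]_x (f x * (normal_pdf m s x)%:E).
Proof.
apply: (@ge0_integral_density _ _ R lebesgue_measure (normal_prob m s)
    (normal_pdf m s)) => //.
  exact: measurable_normal_pdf.
exact: normal_pdf_ge0.
Qed.

Lemma normal01_density (c m s : R) (f : R -> R) : (0 < s)%R ->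
  measurable_fun setT f -> (forall x, 0 <= f x)%R ->
  (forall x, (f x * normal_pdf 0 1 x = c * normal_pdf m s x)%R) ->
  \int[normal_prob 0 1]_x (f x)%:E = c%:E.
Proof.
move=> s0 mf f0 fE.
rewrite ge0_integral_normal_prob //; last exact/measurable_EFinP.
under eq_integral do rewrite -EFinM fE EFinM.
rewrite integralZl //; last exact: integrable_normal_pdf.
by rewrite integral_normal_pdf mule1.
Qed.

Lemma normal01_expR_sqr (a b : R) : (b < 1)%R ->
  \int[normal_prob 0 1]_x (expR (a * x + b / 2 * x ^+ 2))%:E =
  ((Num.sqrt (1 - b))^-1 * expR (a ^+ 2 / (2 * (1 - b))))%:E.
Proof.
move=> b1; have b0 : (0 < 1 - b)%R by rewrite subr_gt0.
(* Completing the square: the tilted law is normal with mean [a / (1 - b)] and standard deviation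
   [s]. *)
pose s : R := ((Num.sqrt (1 - b))^-1)%R.
have s0 : (0 < s)%R by rewrite invr_gt0 sqrtr_gt0.
have s2 : (s ^+ 2 = (1 - b)^-1)%R by rewrite exprVn sqr_sqrtr // ltW.
apply: (@normal01_density _ (a / (1 - b)) s) => //.
  apply: measurableT_comp => //; apply: measurable_funD; first exact: measurable_funM.
  by apply: measurable_funM => //; exact: measurable_funX.
move=> x; rewrite !normal_pdfE ?oner_neq0 ?gt_eqF //.
rewrite /normal_peak /normal_fun.
have -> : (Num.sqrt (s ^+ 2 * pi *+ 2) = s * Num.sqrt (1 ^+ 2 * pi *+ 2))%R.
  rewrite -mulrnAr sqrtrM ?sqr_ge0 // sqrtr_sqr (gtr0_norm s0).
  by rewrite expr1n mul1r.
rewrite -/s [((s * _)^-1)%R]invfM.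
have -> : (s * expR (a ^+ 2 / (2 * (1 - b))) *
   (s^-1 / Num.sqrt (1 ^+ 2 * pi *+ 2) *
    expR (- (x - a / (1 - b)) ^+ 2 / (s ^+ 2 *+ 2))) =
  (Num.sqrt (1 ^+ 2 * pi *+ 2))^-1 *
   (expR (a ^+ 2 / (2 * (1 - b))) * expR (- (x - a / (1 - b)) ^+ 2 / (s ^+ 2 *+ 2))))%R.
  field; rewrite (gt_eqF s0) andbT gt_eqF // sqrtr_gt0 pmulrn_lgt0 //.
  by rewrite expr1n mul1r pi_gt0.
rewrite mulrCA -expRD -expRD; congr (_ * expR _)%R.
rewrite s2; field; exact: lt0r_neq0.
Qed.

(** One-dimensional Cameron-Martin formula: the exponential factor turns the normal density at [x]
    into the density at [a + x], and Lebesgue measure is invariant under translation. *)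
Lemma normal01_shift (a : R) (f : R -> \bar R) :
  measurable_fun setT f -> (forall x, 0 <= f x) ->
  \int[normal_prob 0 1]_x (f (a + x)%R * (expR (- (a ^+ 2 / 2) - a * x))%:E) =
  \int[normal_prob 0 1]_x f x.
Proof.
move=> mf f0.
have mexp : measurable_fun setT (fun x : R => expR (- (a ^+ 2 / 2) - a * x)).
  by apply: measurableT_comp => //; exact: measurable_funB.
have madd : measurable_fun setT (fun x : R => (a + x)%R) by exact: measurable_funD.
rewrite !ge0_integral_normal_prob //; last 2 first.
- apply: emeasurable_funM; last exact/measurable_EFinP.
  exact: measurableT_comp.
- by move=> x; rewrite mule_ge0 ?f0 // lee_fin expR_ge0.
pose g (y : R) : \bar R := f y * (normal_pdf 0 1 y)%:E.
transitivity (\int[lebesgue_measure]_x g (a + x)%R).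
  apply: eq_integral => x _; rewrite /g -muleA -EFinM; congr (_ * _%:E).
  rewrite !normal_pdfE ?oner_neq0 // /normal_fun mulrCA -expRD.
  by congr (_ * expR _)%R; field.
(* Translation invariance, by uniqueness of the Lebesgue measure on half-open intervals. *)
transitivity (\int[pushforward lebesgue_measure
    (fun x : measurableTypeR R => (a + x)%R : measurableTypeR R)]_x g x); last first.
  apply: eq_measure_integral => A mA _; apply/esym.
  apply: lebesgue_measure_unique => //= _ [[u v]] _ <-.
  rewrite /pushforward.
  have -> : (fun x => (a + x)%R) @^-1` [set` `]u, v]] = [set` `](u - a)%R, (v - a)%R]].
    by apply/seteqP; split=> x /=; rewrite !in_itv /= => /andP[? ?]; apply/andP; split; lra.
  rewrite !lebesgue_measure_itv /= !lte_fin ltrD2r; case: ifP => // _.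
  by congr EFin; ring.
rewrite ge0_integral_pushforward //=.
- by apply: emeasurable_funM => //; apply/measurable_EFinP; exact: measurable_normal_pdf.
- by move=> y _; rewrite mule_ge0 ?f0 // lee_fin normal_pdf_ge0.
Qed.

End gaussian_reference.

(** Lets [s] tend to 0 in an inequality with a first-order error term: [s] is taken so small that
    [s * k] is below any given [t]. *)
Lemma le_perturb (R : realType) (u v k e : R) : 0 < e ->
  (forall s, 0 < s <= e -> u <= v + s * k) -> u <= v.
Proof.
move=> e0 H; apply/ler_addgt0Pr => t t0.
have k0 : 0 < `|k| + 1 by rewrite ltr_wpDl.
pose s := Num.min e (t / (`|k| + 1)).
have s0 : 0 < s by rewrite lt_min e0 divr_gt0.
have := H s; rewrite s0 ge_min lexx => /(_ isT) /le_trans; apply.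
rewrite lerD2l; apply: (@le_trans _ _ (s * (`|k| + 1))).
  by rewrite ler_pM2l // (le_trans (ler_norm k)) // lerDl.
by rewrite -ler_pdivlMr // ge_min lexx orbT.
Qed.

(** * Iterated Gaussian tilts *)

Section mgf_iterate.
Context d1 (T1 : measurableType d1) d2 (T2 : measurableType d2) (R : realType).
Variables (mu1 : {measure set T1 -> \bar R}) (mu2 : {measure set T2 -> \bar R}).
Local Open Scope ereal_scope.
Variables (W1 x1 : T1 -> R) (W2 x2 : T2 -> R).
Hypotheses (mW1 : measurable_fun setT W1) (mx1 : measurable_fun setT x1)
  (mW2 : measurable_fun setT W2) (mx2 : measurable_fun setT x2).
Hypotheses (W10 : forall w, (0 <= W1 w)%R) (W20 : forall w, (0 <= W2 w)%R).
Hypothesis mgfE : forall a, wmgf mu1 W1 x1 a = wmgf mu2 W2 x2 a.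

(** An exponential tilt translates the argument, so it preserves equality of generating
    functions. *)
Lemma wmgf_shift d (T : measurableType d) (mu : {measure set T -> \bar R})
    (W x : T -> R) (a b : R) :
  wmgf mu (fun w => W w * expR (a * x w))%R x b = wmgf mu W x (a + b).
Proof. by apply: eq_integral => w _; rewrite -mulrA -expRD mulrDl. Qed.

Let mtilt d (T : measurableType d) (W x : T -> R) (s : R) :
  measurable_fun setT W -> measurable_fun setT x ->
  measurable_fun setT (fun w => W w * expR (s * x w ^+ 2))%R.
Proof.
move=> mW mx; apply: measurable_funM => //; apply: measurableT_comp => //.
by apply: measurable_funM => //; exact: measurable_funX.
Qed.

Let mexp d (T : measurableType d) (W x : T -> R) (s : R) :
  measurable_fun setT W -> measurable_fun setT x ->
  measurable_fun setT (fun w => W w * expR (s * x w))%R.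
Proof.
move=> mW mx; apply: measurable_funM => //; apply: measurableT_comp => //.
exact: measurable_funM.
Qed.

(* One step of size [s] requires [expR (s * x2 ^+ 2)] to be integrable, hence a
   large Gaussian tilt is reached by iterating small ones. *)
Lemma eq_wmgf_tilt (s : R) : (0 <= s)%R ->
  (forall a, wmgf mu2 (fun w => W2 w * expR (s * x2 w ^+ 2))%R x2 a < +oo) ->
  forall (n : nat) a,
    wmgf mu1 (fun w => W1 w * expR (- (n%:R * s) * x1 w ^+ 2))%R x1 a =
    wmgf mu2 (fun w => W2 w * expR (- (n%:R * s) * x2 w ^+ 2))%R x2 a.
Proof.
move=> s0 soo; elim=> [|n IH] a.
  rewrite mul0r oppr0.
  transitivity (wmgf mu1 W1 x1 a).
    by apply: eq_integral => w _; rewrite mul0r expR0 mulr1.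
  by rewrite mgfE; apply: eq_integral => w _; rewrite mul0r expR0 mulr1.
(* [V] collects the [n] steps already made and the factor [expR (a * x)]. Its generating function at
   [b] is that of the induction hypothesis at [a + b], and the next step integrates
   [expR (- s * x ^+ 2)] against [V]. *)
pose V d (T : measurableType d) (W x : T -> R) : T -> R := fun w =>
  (W w * expR (- (n%:R * s) * x w ^+ 2) * expR (a * x w))%R.
have VE d (T : measurableType d) (mu : {measure set T -> \bar R}) (W x : T -> R) :
  wmgf mu (fun w => W w * expR (- (n.+1%:R * s) * x w ^+ 2))%R x a =
  \int[mu]_w (V _ _ W x w * expR (- s * x w ^+ 2))%:E.
  apply: eq_integral => w _; rewrite /V -!mulrA -!expRD; congr (_ * expR _)%:E.
  by rewrite -natr1; ring.
have mV d (T : measurableType d) (W x : T -> R) :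
    measurable_fun setT W -> measurable_fun setT x -> measurable_fun setT (V _ _ W x).
  by move=> mW mx; apply: mexp => //; exact: mtilt.
rewrite !VE; apply: eq_wint_expRN_sqr => //.
- exact: mV.
- exact: mV.
- by move=> w; rewrite /V !mulr_ge0 ?expR_ge0.
- by move=> w; rewrite /V !mulr_ge0 ?expR_ge0.
- move=> b; rewrite wmgf_shift; apply: le_lt_trans (soo (a + b)%R).
  apply: ge0_le_integral => //.
  + by move=> w _; rewrite lee_fin !mulr_ge0 ?expR_ge0.
  + by apply/measurable_EFinP; apply: mexp => //; exact: mtilt.
  + by apply/measurable_EFinP; apply: mexp => //; exact: mtilt.
  + move=> w _; rewrite lee_fin ler_wpM2r ?expR_ge0 // ler_wpM2l // ler_expR.
    by rewrite ler_wpM2r ?sqr_ge0 // (@le_trans _ _ 0%R) // oppr_le0 mulr_ge0.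
- by move=> b; rewrite !wmgf_shift IH.
- apply: le_lt_trans (soo a); apply: ge0_le_integral => //.
  + by move=> w _; rewrite lee_fin !mulr_ge0 ?expR_ge0.
  + by apply/measurable_EFinP; apply: mtilt => //; exact: mV.
  + by apply/measurable_EFinP; apply: mexp => //; exact: mtilt.
  + move=> w _; rewrite lee_fin /V -!mulrA ler_wpM2l // -!expRD ler_expR.
    rewrite !mulNr -mulrA; have su0 : (0 <= s * x2 w ^+ 2)%R by rewrite mulr_ge0 // sqr_ge0.
    have : (0 <= n%:R * (s * x2 w ^+ 2))%R by rewrite mulr_ge0.
    move: su0; move: (s * x2 w ^+ 2)%R (a * x2 w)%R => u v; move: (n%:R * u)%R => t; lra.
Qed.

End mgf_iterate.

(** * Gaussian moment generating functions *)

Section gaussian_mgf.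
Context d (T : measurableType d) (R : realType) (mu : {measure set T -> \bar R}).
Variables (W x : T -> R) (C z g : R).
Hypotheses (mW : measurable_fun setT W) (mx : measurable_fun setT x)
  (W0 : forall w, 0 <= W w) (C0 : 0 < C).
Local Open Scope ereal_scope.
Hypothesis mgfE : forall a, wmgf mu W x a = (C * expR (a * z + a ^+ 2 / 2 * g))%:E.

(** Integrating [2 <= expR (x - z) + expR (z - x)] against [W] gives
    [2 * C <= 2 * C * expR (g / 2)]. *)
Lemma gaussian_mgf_var_ge0 : (0 <= g)%R.
Proof.
have key : \int[mu]_w (W w * 2)%:E <=
    (expR (- z))%:E * wmgf mu W x 1 + (expR z)%:E * wmgf mu W x (-1)%R.
  have me a : measurable_fun setT (fun w => (W w * expR (a * x w))%:E).
    exact: measurable_wexp.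
  rewrite -!ge0_integralZl_EFin ?expR_ge0 //; last 2 first.
  - by move=> w _; rewrite lee_fin mulr_ge0 ?expR_ge0.
  - by move=> w _; rewrite lee_fin mulr_ge0 ?expR_ge0.
  rewrite -ge0_integralD //; last 4 first.
  - by move=> w _; rewrite -EFinM lee_fin !mulr_ge0 ?expR_ge0.
  - exact: measurable_funeM.
  - by move=> w _; rewrite -EFinM lee_fin !mulr_ge0 ?expR_ge0.
  - exact: measurable_funeM.
  apply: ge0_le_integral => //.
  - by move=> w _; rewrite lee_fin mulr_ge0.
  - exact/measurable_EFinP/measurable_funM.
  - by apply: emeasurable_funD; exact: measurable_funeM.
  - move=> w _; rewrite -!EFinM -EFinD lee_fin.
    have E (u v : R) : (expR u * (W w * expR v) = W w * expR (u + v))%R by rewrite expRD; ring.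
    rewrite !E -mulrDr ler_wpM2l //.
    have -> : (z + -1 * x w = - (- z + 1 * x w))%R by ring.
    move: (- z + 1 * x w)%R => u.
    have := expR_ge1Dx u; have := expR_ge1Dx (- u)%R; move: (expR u) (expR (- u)%R) => p q; lra.
move: key; rewrite (_ : \int[mu]_w (W w * 2)%:E = (C * 2)%:E); last first.
  have := mgfE 0%R; rewrite mul0r add0r expr0n /= mul0r mul0r expR0 mulr1 => E.
  transitivity (2%:E * wmgf mu W x 0).
    rewrite -ge0_integralZl_EFin //; last 2 first.
    - by move=> w _; rewrite lee_fin mulr_ge0 ?expR_ge0.
    - exact: measurable_wexp.
    by apply: eq_integral => w _; rewrite mul0r expR0 mulr1 mulrC EFinM.
  by rewrite E -EFinM mulrC.
have E (u v : R) : (expR u * (C * expR v) = C * expR (u + v))%R by rewrite expRD; ring.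
rewrite !mgfE -!EFinM -EFinD lee_fin !E -mulrDr.
rewrite ler_pM2l //.
have -> : (- z + (1 * z + 1 ^+ 2 / 2 * g) = g / 2)%R by ring.
have -> : (z + (-1 * z + (-1) ^+ 2 / 2 * g) = g / 2)%R by ring.
move=> h; rewrite leNgt; apply/negP => g0.
have : (expR (g / 2) < 1)%R by rewrite expR_lt1; lra.
lra.
Qed.

(** [x] under [W] is compared with the model [z + Num.sqrt g * xi], where [xi] is standard normal
    and the weight is the constant [C]: the generating function is the same, and the tilted integral
    of the model is explicit. *)
Lemma gaussian_tilt (S a : R) : (0 < 1 + S * g)%R ->
  \int[mu]_w (W w * expR (a * x w - S / 2 * x w ^+ 2))%:E =
  (C * (Num.sqrt (1 + S * g))^-1 *
    expR ((a * z + a ^+ 2 / 2 * g - S / 2 * z ^+ 2) / (1 + S * g)))%:E.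
Proof.
move=> Sg; have g0 := gaussian_mgf_var_ge0.
pose N := @normal_prob R 0 1; pose W2 := fun _ : R => C.
pose x2 := fun xi : R => (z + Num.sqrt g * xi)%R.
have sg2 : (Num.sqrt g ^+ 2 = g)%R by rewrite sqr_sqrtr.
have mx2 : measurable_fun setT x2 by apply: measurable_funD => //; exact: measurable_funM.
have ME (p u v : R) : (p * expR u * expR v = p * expR (u + v))%R by rewrite expRD mulrA.
have NE (s b : R) : (0 < 1 + s * g)%R ->
  \int[N]_xi (W2 xi * expR (b * x2 xi - s / 2 * x2 xi ^+ 2))%:E =
  (C * (Num.sqrt (1 + s * g))^-1 *
    expR ((b * z + b ^+ 2 / 2 * g - s / 2 * z ^+ 2) / (1 + s * g)))%:E.
  move=> sg.
  transitivity (\int[N]_xi ((C * expR (b * z - s / 2 * z ^+ 2))%:E *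
     (expR ((b - s * z) * Num.sqrt g * xi + (- (s * g)) / 2 * xi ^+ 2))%:E)).
    apply: eq_integral => xi _; rewrite -EFinM ME /W2 /x2.
    have -> : (- (s * g) = - (s * Num.sqrt g ^+ 2))%R by rewrite sg2.
    by congr (_ * expR _)%:E; field.
  rewrite ge0_integralZl_EFin //; last 2 first.
  - apply/measurable_EFinP; apply: measurableT_comp => //.
    apply: measurable_funD; first exact: measurable_funM.
    by apply: measurable_funM => //; exact: measurable_funX.
  - by rewrite mulr_ge0 ?expR_ge0 // ltW.
  rewrite normal01_expR_sqr; last by lra.
  rewrite -EFinM opprK; congr EFin.
  have E (p r u v : R) : (p * expR u * (r * expR v) = p * r * expR (u + v))%R.
    by rewrite expRD; ring.
  rewrite E; congr (_ * expR _)%R.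
  by rewrite exprMn sg2; field; exact: lt0r_neq0.
rewrite -NE //.
have gE a' : wmgf mu W x a' = wmgf N W2 x2 a'.
  rewrite mgfE; have := NE 0%R a'; rewrite mul0r addr0 => /(_ ltr01).
  rewrite sqrtr1 invr1 !mulr1 mul0r mul0r subr0 => <-.
  by apply: eq_integral => xi _; rewrite mul0r subr0.
(* For [S < 0] the coefficient of [x ^+ 2] is positive and one comparison is enough. *)
have [S0|S0] := leP 0%R S; last first.
  have e d' (T' : measurableType d') (m : {measure set T' -> \bar R}) (W' x' : T' -> R) :
    \int[m]_w (W' w * expR (a * x' w - S / 2 * x' w ^+ 2))%:E =
    \int[m]_w ((W' w * expR (a * x' w)) * expR (- (S / 2) * x' w ^+ 2))%:E.
    by apply: eq_integral => w _; rewrite ME mulNr.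
  have mexp d' (T' : measurableType d') (W' x' : T' -> R) :
      measurable_fun setT W' -> measurable_fun setT x' ->
      measurable_fun setT (fun w => W' w * expR (a * x' w))%R.
    move=> mW' mx'; apply: measurable_funM => //; apply: measurableT_comp => //.
    exact: measurable_funM.
  rewrite (e _ _ mu W x) (e _ _ N W2 x2); apply: eq_wint_expR_sqr.
  - exact: mexp.
  - exact: mx.
  - by apply: mexp => //; exact: measurable_cst.
  - exact: mx2.
  - by move=> w; rewrite mulr_ge0 ?expR_ge0.
  - by move=> w; rewrite mulr_ge0 ?expR_ge0 // ltW.
  - by move=> b; rewrite wmgf_shift -gE mgfE ltry.
  - by move=> b; rewrite !wmgf_shift gE.
  - lra.
(* [S / 2] is split into [n] steps [s]; [n > S * g] gives [2 * s * g < 1], which makes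
   [expR (s * x2 ^+ 2)] integrable. *)
pose n := (Num.truncn (S * g)).+1.
pose s := (S / (2 * n%:R))%R.
have n0 : (0 < n%:R :> R)%R by rewrite ltr0n.
have s0 : (0 <= s)%R by rewrite divr_ge0 // mulr_ge0 // ltW.
have nS : (S * g < n%:R)%R by exact: truncnS_gt.
have sg1 : (s * 2 * g < 1)%R.
  rewrite /s (_ : (S / (2 * n%:R) * 2 * g = S * g / n%:R)%R); last by field; exact: lt0r_neq0.
  by rewrite ltr_pdivrMr // mul1r.
have := @eq_wmgf_tilt _ _ _ _ _ mu N W x W2 x2 mW mx (measurable_cst _) mx2 W0
  (fun _ => ltW C0) gE s s0.
have soo b : wmgf N (fun w => W2 w * expR (s * x2 w ^+ 2))%R x2 b < +oo.
  rewrite /wmgf.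
  have -> : \int[N]_w (W2 w * expR (s * x2 w ^+ 2) * expR (b * x2 w))%:E =
    \int[N]_xi (W2 xi * expR (b * x2 xi - (- (s * 2)) / 2 * x2 xi ^+ 2))%:E.
    by apply: eq_integral => w _; rewrite ME; congr (_ * expR _)%:E; field.
  by rewrite NE ?ltry //; lra.
move=> /(_ soo n a) E.
have e d' (T' : measurableType d') (m : {measure set T' -> \bar R}) (W' x' : T' -> R) :
    \int[m]_w (W' w * expR (a * x' w - S / 2 * x' w ^+ 2))%:E =
    wmgf m (fun w => W' w * expR (- (n%:R * s) * x' w ^+ 2))%R x' a.
  apply: eq_integral => w _; rewrite ME; congr (_ * expR _)%:E.
  by rewrite /s; field; exact: lt0r_neq0.
by rewrite (e _ _ mu W x) (e _ _ N W2 x2).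
Qed.

End gaussian_mgf.

(** * Mean and variance from the generating function *)

Section gaussian_moments.
Context d (T : measurableType d) (R : realType) (mu : {measure set T -> \bar R}).
Variables (W x : T -> R) (C z g : R).
Hypotheses (mW : measurable_fun setT W) (mx : measurable_fun setT x)
  (W0 : forall w, 0 <= W w) (C0 : 0 < C).
Local Open Scope ereal_scope.
Hypothesis mgfE : forall a, wmgf mu W x a = (C * expR (a * z + a ^+ 2 / 2 * g))%:E.

Let y w := (x w - z)%R.

Let my : measurable_fun setT y. Proof. exact: measurable_funB. Qed.

Let mgfyE a : wmgf mu W y a = (C * expR (a * 0 + a ^+ 2 / 2 * g))%:E.
Proof.
transitivity ((expR (- (a * z)))%:E * wmgf mu W x a).
  rewrite -ge0_integralZl_EFin ?expR_ge0 //; last 2 first.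
  - by move=> w _; rewrite lee_fin mulr_ge0 ?expR_ge0.
  - exact: measurable_wexp.
  apply: eq_integral => w _; rewrite -EFinM mulrCA -expRD /y.
  by congr (_ * expR _)%:E; ring.
by rewrite mgfE -EFinM mulrCA -expRD; congr (_ * expR _)%:E; ring.
Qed.

Let intW : \int[mu]_w (W w)%:E = C%:E.
Proof.
have := mgfyE 0; rewrite mulr0 add0r expr0n /= !mul0r expR0 mulr1 => <-.
by apply: eq_integral => w _; rewrite mul0r expR0 mulr1.
Qed.

Let mWy2 : measurable_fun setT (fun w => (W w * y w ^+ 2)%:E).
Proof. by apply/measurable_EFinP/measurable_funM => //; exact: measurable_funX. Qed.

Let Wy2_ge0 w : (0 <= W w * y w ^+ 2)%R. Proof. by rewrite mulr_ge0 // sqr_ge0. Qed.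

Let sWy2_ge0 (s : R) w : (0 < s)%R -> (0 <= s / 2 * (W w * y w ^+ 2))%R.
Proof. by move=> s0; apply: mulr_ge0 => //; rewrite divr_ge0 // ltW. Qed.

Let mWeS S : measurable_fun setT (fun w => (W w * expR (0 * y w - S / 2 * y w ^+ 2))%:E).
Proof.
apply/measurable_EFinP/measurable_funM => //; apply: measurableT_comp => //.
apply: measurable_funB; first exact: measurable_funM.
by apply: measurable_funM => //; exact: measurable_funX.
Qed.

(** The bound [t <= (1 + t ^+ 2) / 2] replaces the inverse square root of [gaussian_tilt] by a
    rational function of [S] with the same first-order term. *)
Let tilt_le S : (0 < 1 + S * g)%R ->
  \int[mu]_w (W w * expR (0 * y w - S / 2 * y w ^+ 2))%:E <=
  (C * ((1 + (1 + S * g)^-1) / 2))%:E.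
Proof.
move=> Sg; rewrite (gaussian_tilt mW my W0 C0 mgfyE) // lee_fin -mulrA.
have -> : ((0 * 0 + 0 ^+ 2 / 2 * g - S / 2 * 0 ^+ 2) / (1 + S * g) = 0)%R.
  by rewrite !expr0n /= !(mul0r, mulr0, addr0, subr0).
rewrite ler_pM2l // expR0 mulr1 -{2}(sqr_sqrtr (ltW Sg)) -exprVn.
move: (_^-1)%R => t; have := sqr_ge0 (t - 1)%R; rewrite sqrrB expr1n; lra.
Qed.

(** For [0 < s <= e] the tilt [- s] satisfies [0 < 1 - s * g]; the summand 1 covers [g = 0]. *)
Let e : R := ((2 * (g + 1))^-1)%R.

Let g0 : (0 <= g)%R. Proof. exact: (gaussian_mgf_var_ge0 mW mx W0 C0 mgfE). Qed.

Let e0 : (0 < e)%R. Proof. by rewrite invr_gt0 mulr_gt0 // ltr_wpDl. Qed.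

Let se (s : R) : (0 < s <= e)%R -> (s * g < 1)%R.
Proof.
move=> /andP[s0 se]; apply: (@le_lt_trans _ _ (e * g)%R); first by rewrite ler_wpM2r.
rewrite mulrC /e ltr_pdivrMr ?mul1r ?mulr_gt0 // ?ltr_wpDl //; move: g0; lra.
Qed.

Let m2 := \int[mu]_w (W w * y w ^+ 2)%:E.

Let m2_ge0 : 0 <= m2.
Proof. by apply: integral_ge0 => w _; rewrite lee_fin mulr_ge0 // sqr_ge0. Qed.

(** Integrates [1 + s / 2 * y ^+ 2 <= expR (s / 2 * y ^+ 2)]. The second moment [m2] might still be
    infinite here; its finiteness is deduced from this bound. *)
Let upper (s : R) : (0 < s <= e)%R ->
  C%:E + (s / 2)%:E * m2 <= (C * ((1 + (1 - s * g)^-1) / 2))%:E.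
Proof.
move=> se0; have /andP[s0 _] := se0; have sg := se se0.
have h : (0 < 1 + (- s) * g)%R by lra.
have := tilt_le h; rewrite [(- s * g)%R]mulNr; apply: le_trans.
rewrite -intW -ge0_integralZl_EFin //; last 2 first.
- by move=> w _; rewrite lee_fin Wy2_ge0.
- by rewrite divr_ge0 // ltW.
rewrite -ge0_integralD //; last 4 first.
- by move=> w _; rewrite lee_fin.
- exact/measurable_EFinP.
- by move=> w _; rewrite -EFinM lee_fin sWy2_ge0.
- exact: measurable_funeM.
apply: ge0_le_integral => //.
- by move=> w _; rewrite -EFinM -EFinD lee_fin addr_ge0 // sWy2_ge0.
- by apply: emeasurable_funD; [exact/measurable_EFinP|exact: measurable_funeM].
- move=> w _; rewrite -EFinM -EFinD lee_fin.
  have -> : (W w + s / 2 * (W w * y w ^+ 2) = W w * (1 + s / 2 * y w ^+ 2))%R by ring.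
  rewrite ler_wpM2l // mul0r sub0r !mulNr opprK; exact: expR_ge1Dx.
Qed.

Let m2_fin : m2 \is a fin_num.
Proof.
rewrite ge0_fin_numE // ltey; apply/eqP => moo.
have := upper (s := e); rewrite e0 lexx => /(_ isT); rewrite moo.
by rewrite gt0_muley ?lte_fin ?divr_gt0.
Qed.

(* Limit at [S = 0], from both sides, of [gaussian_tilt] applied to [y]. *)
Lemma gaussian_variance : \int[mu]_w (W w * (x w - z) ^+ 2)%:E = (C * g)%:E.
Proof.
rewrite -/m2 -(fineK m2_fin); congr EFin; apply/eqP; rewrite eq_le; apply/andP; split.
  (* With [M] for the second moment, clearing the denominator in [upper] leaves
     [M <= C * g + s * (g * M)]. *)
  apply: (@le_perturb _ _ _ (g * fine m2)%R _ e0) => s se0.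
  have := upper se0; have /andP[s0 _] := se0; have sg := se se0.
  rewrite -(fineK m2_fin) -EFinM -EFinD lee_fin /=.
  move: (fine m2) => M h.
  have q0 : (0 < 1 - s * g)%R by lra.
  have : (s * (M * (1 - s * g)) <= s * (C * g))%R.
    move: h; rewrite -(ler_pM2r q0).
    have -> : (C * ((1 + (1 - s * g)^-1) / 2) * (1 - s * g) = C * (2 - s * g) / 2)%R.
      by field; exact: lt0r_neq0.
    nra.
  by rewrite ler_pM2l //; nra.
(* The reverse bound comes from [1 - u <= expR (- u)], with the tilt [s]. *)
apply: (@le_perturb _ _ _ (g * fine m2)%R _ e0) => s se0.
have /andP[s0 _] := se0; have sg := se se0.
have q0 : (0 < 1 + s * g)%R by rewrite ltr_pwDl // mulr_ge0 // ltW.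
have : C%:E <= (C * ((1 + (1 + s * g)^-1) / 2))%:E + (s / 2)%:E * m2.
  apply: le_trans (leeD2r _ (tilt_le q0)).
  rewrite -intW -ge0_integralZl_EFin //; last 2 first.
  - by move=> w _; rewrite lee_fin Wy2_ge0.
  - by rewrite divr_ge0 // ltW.
  rewrite -ge0_integralD //; last 3 first.
  - by move=> w _; rewrite lee_fin mulr_ge0 ?expR_ge0.
  - by move=> w _; rewrite -EFinM lee_fin sWy2_ge0.
  - exact: measurable_funeM.
  apply: ge0_le_integral => //.
  - by move=> w _; rewrite lee_fin.
  - exact/measurable_EFinP.
  - by apply: emeasurable_funD => //; exact: measurable_funeM.
  - move=> w _; rewrite -EFinM -EFinD lee_fin.
    rewrite [X in (_ + X)%R]mulrCA -mulrDr -[leLHS]mulr1 ler_wpM2l // mul0r sub0r.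
    have := expR_ge1Dx (- (s / 2 * y w ^+ 2))%R.
    by move: (s / 2 * y w ^+ 2)%R => q; move: (expR (- q)) => p; lra.
rewrite -(fineK m2_fin) -EFinM -EFinD lee_fin /=.
move: (fine m2) => M h.
have : (s * (C * g) <= s * (M * (1 + s * g)))%R.
  move: h; rewrite -(ler_pM2r q0) mulrDl.
  have -> : (C * ((1 + (1 + s * g)^-1) / 2) * (1 + s * g) = C * (2 + s * g) / 2)%R.
    by field; exact: lt0r_neq0.
  nra.
by rewrite ler_pM2l //; nra.
Qed.

Let iW : mu.-integrable setT (fun w => (W w)%:E).
Proof.
apply/integrableP; split; first exact/measurable_EFinP.
under eq_integral do rewrite /= ger0_norm //.
by rewrite intW ltry.
Qed.

Let iWy : mu.-integrable setT (fun w => (W w * y w)%:E).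
Proof.
apply/integrableP; split; first exact/measurable_EFinP/measurable_funM.
apply: (@le_lt_trans _ _ (\int[mu]_w ((W w)%:E + (W w * y w ^+ 2)%:E))); last first.
  rewrite ge0_integralD //; last 3 first.
  - by move=> w _; rewrite lee_fin.
  - exact/measurable_EFinP.
  - by move=> w _; rewrite lee_fin Wy2_ge0.
  by rewrite intW gaussian_variance -EFinD ltry.
apply: ge0_le_integral => //.
- by apply: measurableT_comp => //; exact/measurable_EFinP/measurable_funM.
- by apply: emeasurable_funD => //; exact/measurable_EFinP.
- move=> w _; rewrite -EFinD abse_EFin lee_fin normrM ger0_norm //.
  rewrite -[X in (X + _)%R]mulr1 -mulrDr ler_wpM2l // -(real_normK (num_real (y w))).
  by move: `|y w|%R => t; have := sqr_ge0 (t - 2^-1)%R; rewrite sqrrB; lra.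
Qed.

(** By [1 + a * y <= expR (a * y)], the mean multiplied by [a] is at most a constant times [a ^+ 2].
    Taking [a = s] and [a = - s] and letting [s] tend to 0 squeezes the mean to 0. *)
Let mean0 : \int[mu]_w (W w * y w)%:E = 0.
Proof.
have mfin : \int[mu]_w (W w * y w)%:E \is a fin_num by exact: integrable_fin_num.
have key (a : R) : (`|a| <= 1)%R -> (a * fine (\int[mu]_w (W w * y w)%:E)
    <= a ^+ 2 * (C * (g / 2 * expR (g / 2))))%R.
  move=> a1.
  have : C%:E + a%:E * \int[mu]_w (W w * y w)%:E <= wmgf mu W y a.
    rewrite -intW -integralZl // -integralD //; last exact: integrableZl.
    apply: le_integral => //.
    - by apply: integrableD => //; exact: integrableZl.
    - apply/integrableP; split; first exact: measurable_wexp.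
      under eq_integral do rewrite /= ger0_norm ?mulr_ge0 ?expR_ge0 //.
      by have := mgfyE a; rewrite /wmgf => ->; rewrite ltry.
    - move=> w _; rewrite -EFinM -EFinD lee_fin.
      have -> : (W w + a * (W w * y w) = W w * (1 + a * y w))%R by ring.
      by rewrite ler_wpM2l // expR_ge1Dx.
  rewrite mgfyE -(fineK mfin) -EFinM -EFinD lee_fin mulr0 add0r /=.
  move: (fine _) => M h.
  have a2 : (0 <= a ^+ 2 <= 1)%R.
    by rewrite sqr_ge0 /= -(real_normK (num_real a)) exprn_ile1 ?normr_ge0.
  have u0 : (a ^+ 2 / 2 * g <= g / 2)%R by case/andP: a2 => ? ?; move: g0; nra.
  (* This rests on [expR u <= 1 + u * expR u], which is [1 - u <= expR (- u)] multiplied by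
     [expR u]. *)
  have h1 : (expR (a ^+ 2 / 2 * g) <= 1 + a ^+ 2 / 2 * g * expR (g / 2))%R.
    set u := (a ^+ 2 / 2 * g)%R in u0 *.
    have u00 : (0 <= u)%R by case/andP: a2 => ? ?; apply: mulr_ge0 => //; exact: divr_ge0.
    apply: (@le_trans _ _ (1 + u * expR u)%R); last by rewrite lerD2l ler_wpM2l // ler_expR.
    have := expR_ge1Dx (- u)%R; rewrite -(ler_pM2r (expR_gt0 u)) -expRD addNr expR0; lra.
  have : (C * expR (a ^+ 2 / 2 * g) <= C * (1 + a ^+ 2 / 2 * g * expR (g / 2)))%R.
    by rewrite ler_pM2l.
  move: h; move: (expR (g / 2)) (expR (a ^+ 2 / 2 * g))%R => p q; nra.
rewrite -(fineK mfin); congr EFin; apply/eqP; rewrite eq_le; apply/andP; split.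
  apply: (@le_perturb _ _ _ (C * (g / 2 * expR (g / 2)))%R 1%R) => // s /andP[s0 s1].
  have := key s; rewrite gtr0_norm // => /(_ s1).
  by rewrite expr2 -mulrA ler_pM2l // add0r.
apply: (@le_perturb _ _ _ (C * (g / 2 * expR (g / 2)))%R 1%R) => // s /andP[s0 s1].
have := key (- s)%R; rewrite normrN gtr0_norm // => /(_ s1).
move: (fine _) (C * _)%R => M k h.
have : (s * (- M) <= s * (s * k))%R by lra.
by rewrite ler_pM2l //; lra.
Qed.

Lemma gaussian_integrable : mu.-integrable setT (fun w => (W w * x w)%:E).
Proof.
have -> : (fun w => (W w * x w)%:E) = (fun w => (W w * y w)%:E + z%:E * (W w)%:E).
  by apply/funext => w; rewrite -EFinM -EFinD /y; congr EFin; ring.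
by apply: integrableD => //; exact: integrableZl.
Qed.

Lemma gaussian_mean : \int[mu]_w (W w * x w)%:E = (C * z)%:E.
Proof.
have -> : (fun w => (W w * x w)%:E) = (fun w => (W w * y w)%:E + z%:E * (W w)%:E).
  by apply/funext => w; rewrite -EFinM -EFinD /y; congr EFin; ring.
rewrite integralD //; last exact: integrableZl.
by rewrite mean0 add0e integralZl // intW -EFinM mulrC.
Qed.

End gaussian_moments.

(** * Generating functions of Gaussian laws and sequences *)

Section gaussian_law_mgf.
Context d (T : measurableType d) (R : realType) (P : probability T R).
Local Open Scope ereal_scope.

Lemma has_law_integral (U : {RV P >-> R})
    (nu : {measure set (measurableTypeR R) -> \bar R}) (f : R -> \bar R) :
  has_law P U nu -> measurable_fun setT f -> (forall x, 0 <= f x) ->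
  \int[P]_w f (U w) = \int[nu]_x f x.
Proof.
move=> lawU mf f0.
have mU : measurable_fun setT (U : T -> measurableTypeR R).
  exact: (@measurable_funPT _ _ T R U).
transitivity (\int[pushforward P (U : T -> measurableTypeR R)]_x f x).
  by rewrite ge0_integral_pushforward.
by apply: eq_measure_integral => A mA _; exact: lawU.
Qed.

Lemma has_law_mgf (U : {RV P >-> R}) (m s : R) : has_law P U (gaussian_law m s) ->
  forall a, wmgf P (fun=> 1%R) U a = (1 * expR (a * m + a ^+ 2 / 2 * s ^+ 2))%:E.
Proof.
move=> + a; have mexp : measurable_fun setT (fun x : R => (expR (a * x))%:E).
  by apply/measurable_EFinP; apply: measurableT_comp => //; exact: measurable_funM.
have -> : wmgf P (fun=> 1%R) U a = \int[P]_w (expR (a * U w))%:E.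
  by apply: eq_integral => w _; rewrite mul1r.
(* For [s = 0] the law is a point mass, which satisfies the same formula. *)
rewrite /gaussian_law mul1r; case: eqVneq => [->|s0] law.
  rewrite (@has_law_integral U (dirac (m : measurableTypeR R)) (fun x => (expR (a * x))%:E)) //.
  by rewrite integral_dirac //= diracT mul1e expr0n /= mulr0 addr0.
rewrite (@has_law_integral U (normal_prob m s) (fun x => (expR (a * x))%:E)) //.
rewrite ge0_integral_normal_prob //.
(* Completing the square: tilting by [expR (a * x)] moves the mean to [m + a * s ^+ 2]. *)
transitivity (\int[lebesgue_measure]_x ((expR (a * m + a ^+ 2 / 2 * s ^+ 2))%:E *
    (normal_pdf (m + a * s ^+ 2) s x)%:E)).
  apply: eq_integral => x _; rewrite -!EFinM !normal_pdfE // /normal_fun.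
  rewrite mulrCA [in RHS]mulrCA -!expRD; congr (_ * expR _)%:E.
  by field; exact: s0.
rewrite integralZl //; last exact: integrable_normal_pdf.
by rewrite integral_normal_pdf mule1.
Qed.

End gaussian_law_mgf.

Section gaussian_sequence_mgf.
Context d (T : measurableType d) (R : realType) (P : probability T R).
Variables (X : nat -> {RV P >-> R}) (m : nat -> R) (K : nat -> nat -> R).
Hypothesis X_gaussian : gaussian_sequence P (fun t => X t : T -> R).
Local Open Scope ereal_scope.
Hypotheses (X_mean : forall t, (1 <= t)%N -> 'E_P[X t] = (m t)%:E)
  (X_cov : forall t s, (1 <= t)%N -> (1 <= s)%N -> covariance P (X t) (X s) = (K t s)%:E).

Let lin (n : nat) (a : nat -> R) (w : T) := (\sum_(1 <= t < n.+1) a t * X t w)%R.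

Let mlin n a : measurable_fun setT (lin n a).
Proof. by apply: measurable_sum => t; exact: measurable_funM. Qed.

Let linRV n a : {RV P >-> R} := HB.pack (lin n a) (isMeasurableFun.Build _ _ _ _ _ (mlin n a)).

Let lin_mgf n a : exists m' s' : R, forall c,
  wmgf P (fun=> 1%R) (lin n a) c = (1 * expR (c * m' + c ^+ 2 / 2 * s'))%:E.
Proof.
have [m' [s' law]] := X_gaussian n a.
by exists m', (s' ^+ 2)%R; apply: (@has_law_mgf _ _ _ P (linRV n a)).
Qed.

Let X_mgf t : (1 <= t)%N -> exists m' s' : R, forall c,
  wmgf P (fun=> 1%R) (X t) c = (1 * expR (c * m' + c ^+ 2 / 2 * s'))%:E.
Proof.
move=> t1; have [m' [s' H]] := lin_mgf t (fun u => (u == t)%:R%R).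
exists m', s' => c; rewrite -H; apply: eq_integral => w _; rewrite /lin.
rewrite big_nat_recr //= eqxx (_ : true%:R = 1%R) // !mul1r big_nat_cond big1 ?add0r // => u.
by rewrite andbT => /andP[_ ut]; rewrite ltn_eqF // mul0r.
Qed.

Lemma gaussian_sequence_integrable t : (1 <= t)%N -> P.-integrable setT (fun w => (X t w)%:E).
Proof.
move=> t1; have [m' [s' H]] := X_mgf t1.
have := @gaussian_integrable _ _ _ P (fun=> 1%R) (X t) 1 m' s' (measurable_cst _)
  (measurable_funP _) (fun=> ler01) ltr01 H.
by apply: eq_integrable => // w _; rewrite mul1r.
Qed.

Let iX2 t : (1 <= t)%N -> \int[P]_w ((X t w - m t) ^+ 2)%:E < +oo.
Proof.
move=> t1; have [m' [s' H]] := X_mgf t1.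
have H1 := @gaussian_mean _ _ _ P (fun=> 1%R) (X t) 1 m' s' (measurable_cst _)
  (measurable_funP _) (fun=> ler01) ltr01 H.
have H2 := @gaussian_variance _ _ _ P (fun=> 1%R) (X t) 1 m' s' (measurable_cst _)
  (measurable_funP _) (fun=> ler01) ltr01 H.
have <- : m' = m t.
  apply: EFin_inj; rewrite -X_mean // expectation_def -[m']mul1r -H1.
  by apply: eq_integral => w _; rewrite mul1r.
by under eq_integral do rewrite -[X in X%:E]mul1r; rewrite H2 ltry.
Qed.

Let iXX t s : (1 <= t)%N -> (1 <= s)%N ->
  P.-integrable setT (fun w => ((X t w - m t) * (X s w - m s))%:E).
Proof.
move=> t1 s1.
have mc u : measurable_fun setT (fun w => X u w - m u)%R by exact: measurable_funB.
have mc2 u : measurable_fun setT (fun w => ((X u w - m u) ^+ 2)%:E).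
  by apply/measurable_EFinP; exact: measurable_funX.
apply/integrableP; split; first by apply/measurable_EFinP; exact: measurable_funM.
apply: (@le_lt_trans _ _ (\int[P]_w (((X t w - m t) ^+ 2)%:E + ((X s w - m s) ^+ 2)%:E))).
  apply: ge0_le_integral => //.
  - apply: measurableT_comp => //.
    by apply/measurable_EFinP; exact: measurable_funM.
  - exact: emeasurable_funD.
  - move=> w _; rewrite abse_EFin lee_fin normrM.
    rewrite -(real_normK (num_real (X t w - m t))) -(real_normK (num_real (X s w - m s))).
    move: `|X t w - m t|%R `|X s w - m s|%R => p q.
    by have := sqr_ge0 (p - q)%R; have := sqr_ge0 (p + q)%R; rewrite sqrrB sqrrD; lra.
rewrite ge0_integralD //; first by rewrite lte_add_pinfty // iX2.
- by move=> w _; rewrite lee_fin sqr_ge0.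
- by move=> w _; rewrite lee_fin sqr_ge0.
Qed.

Let intXX t s : (1 <= t)%N -> (1 <= s)%N ->
  \int[P]_w ((X t w - m t) * (X s w - m s))%:E = (K t s)%:E.
Proof.
move=> t1 s1; rewrite -X_cov // [in RHS]unlock /= !X_mean //= unlock.
by apply: eq_integral => w _.
Qed.

Lemma gaussian_cov_sym t s : (1 <= t)%N -> (1 <= s)%N -> K t s = K s t.
Proof.
by move=> t1 s1; apply: EFin_inj; rewrite -!X_cov // covarianceC.
Qed.

(** A linear combination is Gaussian with unspecified parameters [m'] and [s']; [gaussian_mean] and
    [gaussian_variance] identify them with its first two moments, which expand by linearity. The
    claim is its generating function at 1. *)
Lemma gaussian_sequence_mgf (n : nat) (a : nat -> R) :
  \int[P]_w (expR (\sum_(1 <= t < n.+1) a t * X t w))%:E =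
  (expR (\sum_(1 <= t < n.+1) a t * m t +
     (\sum_(1 <= t < n.+1) \sum_(1 <= s < n.+1) a t * a s * K t s) / 2))%:E.
Proof.
have [m' [s' H]] := lin_mgf n a.
have H1 := @gaussian_mean _ _ _ P (fun=> 1%R) (lin n a) 1 m' s' (measurable_cst _)
  (mlin n a) (fun=> ler01) ltr01 H.
have H2 := @gaussian_variance _ _ _ P (fun=> 1%R) (lin n a) 1 m' s' (measurable_cst _)
  (mlin n a) (fun=> ler01) ltr01 H.
have iaX t : (1 <= t)%N -> P.-integrable setT (fun w => (a t * X t w)%:E).
  move=> t1; apply: (eq_integrable _ (fun w => (a t)%:E * (X t w)%:E)) => //.
  by apply: integrableZl => //; exact: gaussian_sequence_integrable.
have m'E : m' = (\sum_(1 <= t < n.+1) a t * m t)%R.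
  apply: EFin_inj; rewrite -[m']mul1r -H1.
  (* The moment hypotheses start at index 1: sums are reindexed from 0 so that every term is
     integrable. *)
  under eq_integral do rewrite mul1r /lin -sumEFin big_add1.
  rewrite integral_sum //; last by move=> t; exact: iaX.
  rewrite -sumEFin [RHS]big_add1; apply: eq_bigr => t _.
  under eq_integral do rewrite EFinM.
  rewrite integralZl //; last exact: gaussian_sequence_integrable.
  by rewrite -expectation_def X_mean // EFinM.
have s'E : s' = (\sum_(1 <= t < n.+1) \sum_(1 <= s < n.+1) a t * a s * K t s)%R.
  apply: EFin_inj; rewrite -[s']mul1r -H2.
  have -> : (fun w => (1 * (lin n a w - m') ^+ 2)%:E) = (fun w =>
    \sum_(0 <= t < n) \sum_(0 <= s < n)
       (a t.+1 * a s.+1)%:E * ((X t.+1 w - m t.+1) * (X s.+1 w - m s.+1))%:E).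
    apply/funext => w; rewrite mul1r m'E /lin -sumrB big_add1 /=.
    rewrite expr2 mulr_suml -sumEFin; apply: eq_bigr => t _.
    rewrite mulr_sumr -sumEFin; apply: eq_bigr => s _.
    by rewrite -EFinM; congr EFin; ring.
  have it t s : P.-integrable setT (fun w =>
      (a t.+1 * a s.+1)%:E * ((X t.+1 w - m t.+1) * (X s.+1 w - m s.+1))%:E).
    by apply: integrableZl => //; exact: iXX.
  rewrite integral_sum //; last by move=> t; apply: integrable_sum => // s _; exact: it.
  rewrite -sumEFin big_add1; apply: eq_bigr => t _.
  rewrite integral_sum // -sumEFin big_add1; apply: eq_bigr => s _.
  by rewrite integralZl ?intXX // ?EFinM //; exact: iXX.
have := H 1%R; rewrite -m'E -s'E.
have -> : (1 * expR (1 * m' + 1 ^+ 2 / 2 * s') = expR (m' + s' / 2))%R.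
  by rewrite mul1r; congr expR; field.
move=> <-; by apply: eq_integral => w _; rewrite !mul1r.
Qed.

End gaussian_sequence_mgf.

(** * Successive tilts of a Gaussian sequence *)

Section gaussian_conditioning.
Context {R : realType}.
Variables (S : nat -> R) (K : nat -> nat -> R) (m b : nat -> R).

(* Covariance and mean of a Gaussian sequence of covariance [K] and mean [m]
   after tilting its law by [expR (\sum_(l <= n) b l * X l - S l / 2 * X l ^+ 2)]. *)
Fixpoint ckern (n t s : nat) : R :=
  if n is n'.+1 then
    ckern n' t s - ckern n' t n * ckern n' s n * (S n / (1 + S n * ckern n' n n))
  else K t s.

Fixpoint cmean (n t : nat) : R :=
  if n is n'.+1 then
    cmean n' t + ckern n' t n * ((b n - S n * cmean n' n) / (1 + S n * ckern n' n n))
  else m t.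

(** Each factor is the mass that [gaussian_tilt] gives for a variable of mean [cmean l.-1 l] and
    variance [ckern l.-1 l l]; the product normalises the tilted law. *)
Definition cmass (n : nat) : R := \prod_(1 <= l < n.+1)
  ((Num.sqrt (1 + S l * ckern l.-1 l l))^-1 *
   expR ((cmean l.-1 l * b l + b l ^+ 2 / 2 * ckern l.-1 l l
          - S l / 2 * cmean l.-1 l ^+ 2) / (1 + S l * ckern l.-1 l l))).

Hypothesis K_sym : forall t s, (1 <= t)%N -> (1 <= s)%N -> K t s = K s t.

Lemma ckern_sym n t s : (1 <= t)%N -> (1 <= s)%N -> ckern n t s = ckern n s t.
Proof.
move=> t1 s1; elim: n => [|n IH] /=; first exact: K_sym.
by rewrite IH; congr (_ - _ * _); rewrite mulrC.
Qed.

Lemma cmass_gt0 n : (forall l, (1 <= l <= n)%N -> 0 < 1 + S l * ckern l.-1 l l) ->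
  0 < cmass n.
Proof.
move=> pos; rewrite /cmass big_nat_cond prodr_gt0 // => l.
by rewrite andbT ltnS => /pos ?; rewrite mulr_gt0 ?expR_gt0 // invr_gt0 sqrtr_gt0.
Qed.

Context d (T : measurableType d) (P : {measure set T -> \bar R}).
Variable X : nat -> T -> R.
Hypotheses (mX : forall t, measurable_fun setT (X t))
  (X_mgf : forall (n : nat) (a : nat -> R),
  (\int[P]_w (expR (\sum_(1 <= t < n.+1) a t * X t w))%:E =
  (expR (\sum_(1 <= t < n.+1) a t * m t +
     (\sum_(1 <= t < n.+1) \sum_(1 <= s < n.+1) a t * a s * K t s) / 2))%:E)%E).

Definition tiltw (n : nat) (w : T) : R :=
  \sum_(1 <= s < n.+1) (b s * X s w - S s / 2 * X s w ^+ 2).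

Lemma measurable_tiltw n : measurable_fun setT (tiltw n).
Proof.
apply: measurable_sum => s; apply: measurable_funB; first exact: measurable_funM.
by apply: measurable_funM => //; exact: measurable_funX.
Qed.

(** Tilting by one coordinate changes the law of all later ones, so the induction carries the joint
    generating function up to a horizon [N]. The exponential of the later terms is absorbed in a
    weight [W], under which [X n.+1] is Gaussian; [gaussian_tilt] integrates it out, and the
    resulting exponent is again quadratic in [a]. *)
Lemma tilted_mgf_sum (N n : nat) : (n <= N)%N ->
  (forall l, (1 <= l <= n)%N -> 0 < 1 + S l * ckern l.-1 l l) ->
  forall a : nat -> R,
  (\int[P]_w (expR (tiltw n w + \sum_(n.+1 <= t < N.+1) a t * X t w))%:E =
   (cmass n * expR (\sum_(n.+1 <= t < N.+1) a t * cmean n t +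
     (\sum_(n.+1 <= t < N.+1) \sum_(n.+1 <= s < N.+1) a t * a s * ckern n t s) / 2))%:E)%E.
Proof.
elim: n => [|n IH] nN pos a.
  rewrite /cmass big_geq // mul1r -X_mgf; apply: eq_integral => w _.
  by rewrite /tiltw big_geq // add0r.
have {}IH : forall a : nat -> R,
  (\int[P]_w (expR (tiltw n w + \sum_(n.+1 <= t < N.+1) a t * X t w))%:E =
   (cmass n * expR (\sum_(n.+1 <= t < N.+1) a t * cmean n t +
     (\sum_(n.+1 <= t < N.+1) \sum_(n.+1 <= s < N.+1) a t * a s * ckern n t s) / 2))%:E)%E.
  by apply: (IH (ltnW nN)) => l /andP[l1 ln]; apply: pos; rewrite l1 leqW.
pose rest w := \sum_(n.+2 <= t < N.+1) a t * X t w.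
(* Covariance of [X n.+1] with the linear form [rest]: weighting by the exponential of [rest] moves
   the mean of [X n.+1] by [kap]. *)
pose kap := \sum_(n.+2 <= t < N.+1) a t * ckern n t n.+1.
pose q := \sum_(n.+2 <= t < N.+1) \sum_(n.+2 <= s < N.+1) a t * a s * ckern n t s.
pose mm := \sum_(n.+2 <= t < N.+1) a t * cmean n t.
pose g := ckern n n.+1 n.+1.
pose z := cmean n n.+1 + kap.
pose C := cmass n * expR (mm + q / 2).
pose W w := expR (tiltw n w + rest w).
have g0 : 0 < 1 + S n.+1 * g by apply: (pos n.+1); rewrite leqnn.
have cm0 : 0 < cmass n.
  by apply: cmass_gt0 => l /andP[l1 ln]; apply: pos; rewrite l1 leqW.
have C0 : 0 < C by rewrite mulr_gt0 ?expR_gt0.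
have mW : measurable_fun setT W.
  apply: measurableT_comp => //; apply: measurable_funD; first exact: measurable_tiltw.
  by apply: measurable_sum => t; exact: measurable_funM.
have ME (p u v : R) : p * expR u * expR v = p * expR (u + v) by rewrite expRD mulrA.
have mgfE c : (wmgf P W (X n.+1) c = (C * expR (c * z + c ^+ 2 / 2 * g))%:E)%E.
  (* Replacing the coefficient of [X n.+1] by [c] makes the generating function under [W] an
     instance of the induction hypothesis. *)
  pose a' t := if t == n.+1 then c else a t.
  have a'E t : (n.+2 <= t < N.+1)%N -> a' t = a t.
    by move=> /andP[nt _]; rewrite /a' gtn_eqF.
  have aa : a' n.+1 = c by rewrite /a' eqxx.
  have := IH a'; rewrite (@big_ltn _ _ _ n.+1) //.
  rewrite (_ : \sum_(n.+2 <= t < N.+1) a' t * cmean n t = mm); last first.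
    by apply: eq_big_nat => t /a'E ->.
  rewrite (@big_ltn _ _ _ n.+1) //.
  rewrite (@big_ltn _ _ _ n.+1 N.+1 (fun s => a' n.+1 * a' s * ckern n n.+1 s)) //.
  rewrite aa.
  rewrite (_ : \sum_(n.+2 <= i < N.+1) c * a' i * ckern n n.+1 i = c * kap); last first.
    rewrite /kap mulr_sumr; apply: eq_big_nat => t /[dup] /a'E -> /andP[nt _].
    by rewrite (@ckern_sym _ n.+1) // ?mulrA // (leq_trans _ nt).
  rewrite (_ : \sum_(n.+2 <= i < N.+1) _ = c * kap + q); last first.
    rewrite /kap mulr_sumr /q -big_split /=; apply: eq_big_nat => t ht.
    rewrite (@big_ltn _ _ _ n.+1) // aa (a'E _ ht); congr (_ + _); first by ring.
    by apply: eq_big_nat => s /a'E ->.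
  move=> E; transitivity (cmass n * expR (c * cmean n n.+1 + mm +
      (c * c * g + c * kap + (c * kap + q)) / 2))%:E; last first.
    by rewrite /C ME; congr (_ * expR _)%:E; rewrite /z; field.
  rewrite -E; apply: eq_integral => w _; rewrite /W -expRD; congr (expR _)%:E.
  rewrite (@big_ltn _ _ _ n.+1) // aa -addrA; congr (_ + _).
  rewrite addrC; congr (_ + _).
  by apply: eq_big_nat => t /a'E ->.
transitivity (\int[P]_w (W w * expR (b n.+1 * X n.+1 w - S n.+1 / 2 * X n.+1 w ^+ 2))%:E)%E.
  apply: eq_integral => w _; rewrite /W -expRD /tiltw big_nat_recr //=.
  by congr (expR _)%:E; rewrite -/(rest w); ring.
rewrite (gaussian_tilt mW (mX _) (fun w => expR_ge0 _) C0 mgfE) //.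
congr EFin; rewrite /cmass big_nat_recr //= -/(cmass n) -/g.
rewrite /C; set r := (Num.sqrt _)^-1.
have E (u v p p' : R) : u * expR v * p * expR p' = u * p * expR (v + p').
  by rewrite expRD; ring.
have E' (u v p p' : R) : u * (v * expR p) * expR p' = u * v * expR (p + p').
  by rewrite expRD; ring.
rewrite E E'; congr (_ * expR _).
(* The terms linear and quadratic in [kap] are the updates of [cmean] and [ckern]. *)
have -> : \sum_(n.+2 <= t < N.+1) a t *
    (cmean n t + ckern n t n.+1 * ((b n.+1 - S n.+1 * cmean n n.+1) / (1 + S n.+1 * g))) =
    mm + kap * ((b n.+1 - S n.+1 * cmean n n.+1) / (1 + S n.+1 * g)).
  rewrite /mm /kap mulr_suml -big_split /=; apply: eq_bigr => t _; ring.
have -> : \sum_(n.+2 <= t < N.+1) \sum_(n.+2 <= s < N.+1)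
    a t * a s * (ckern n t s - ckern n t n.+1 * ckern n s n.+1 * (S n.+1 / (1 + S n.+1 * g))) =
    q - kap ^+ 2 * (S n.+1 / (1 + S n.+1 * g)).
  rewrite /q /kap expr2 !mulr_suml -sumrB; apply: eq_bigr => t _.
  by rewrite mulr_sumr mulr_suml -sumrB; apply: eq_bigr => s _; ring.
rewrite /z; field; exact: lt0r_neq0.
Qed.

Lemma tilted_mass n : (forall l, (1 <= l <= n)%N -> 0 < 1 + S l * ckern l.-1 l l) ->
  (\int[P]_w (expR (tiltw n w))%:E = (cmass n)%:E)%E.
Proof.
move=> pos; have := tilted_mgf_sum (leqnn n) pos (fun=> 0).
rewrite !big_geq // mul0r addr0 expR0 mulr1 => <-.
by apply: eq_integral => w _; rewrite big_geq // addr0.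
Qed.

Lemma tilted_mgf n : (forall l, (1 <= l <= n)%N -> 0 < 1 + S l * ckern l.-1 l l) ->
  forall c, wmgf P (fun w => expR (tiltw n w)) (X n.+1) c =
  (cmass n * expR (c * cmean n n.+1 + c ^+ 2 / 2 * ckern n n.+1 n.+1))%:E.
Proof.
move=> pos c; have := tilted_mgf_sum (leqnSn n) pos (fun=> c).
rewrite !big_nat1.
have -> : c * c * ckern n n.+1 n.+1 / 2 = c ^+ 2 / 2 * ckern n n.+1 n.+1 by field.
by move=> <-; apply: eq_integral => w _; rewrite big_nat1 expRD.
Qed.

(** It is the variance of [X n.+1] under the weight [expR (tiltw n)]. *)
Lemma ckern_ge0 n : (forall l, (1 <= l <= n)%N -> 0 < 1 + S l * ckern l.-1 l l) ->
  0 <= ckern n n.+1 n.+1.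
Proof.
move=> pos; apply: (@gaussian_mgf_var_ge0 _ _ _ P (fun w => expR (tiltw n w)) (X n.+1)
  (cmass n) (cmean n n.+1)) => //.
- by apply: measurableT_comp => //; exact: measurable_tiltw.
- exact: cmass_gt0.
- exact: tilted_mgf.
Qed.

End gaussian_conditioning.

(** * Densities, product laws and sub-sigma-algebras *)

Section density_probability.
Context d (T : measurableType d) (R : realType) (P : {measure set T -> \bar R}).
Variable L : T -> R.
Hypotheses (mL : measurable_fun setT L) (L0 : forall w, 0 <= L w)
  (L1 : (\int[P]_w (L w)%:E = 1)%E).
Local Open Scope ereal_scope.

(** The proofs are arguments so that the measure and probability instances below can be attached to
    this term. *)
Definition density_measure of measurable_fun setT L & (forall w, (0 <= L w)%R) &
    \int[P]_w (L w)%:E = 1 :=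
  fun A : set T => \int[P]_(w in A) (L w)%:E.

Local Notation density := (density_measure mL L0 L1).

Let density0 : density set0 = 0. Proof. exact: integral_set0. Qed.

Let density_ge0 A : 0 <= density A.
Proof. by apply: integral_ge0 => w _; rewrite lee_fin. Qed.

Let density_sigma_additive : semi_sigma_additive density.
Proof.
move=> /= F mF tF mUF; rewrite /density_measure ge0_integral_bigcup //; last 2 first.
- by apply/measurable_EFinP; exact: measurable_funTS.
- by move=> w _; rewrite lee_fin.
by apply: is_cvg_ereal_nneg_natsum_cond => n _ _; exact: density_ge0.
Qed.

HB.instance Definition _ := isMeasure.Build _ _ _ density
  density0 density_ge0 density_sigma_additive.

Let density_setT : density setT = 1. Proof. exact: L1. Qed.

HB.instance Definition _ := @Measure_isProbability.Build _ _ R density density_setT.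

Lemma ge0_integral_density_prob (f : T -> \bar R) :
  measurable_fun setT f -> (forall w, 0 <= f w) ->
  \int[density]_w f w = \int[P]_w (f w * (L w)%:E).
Proof. by move=> mf f0; rewrite (@ge0_integral_density _ _ R P density L). Qed.

End density_probability.

(** * Pairs with a product law *)

Section product_law.
Context d (T : measurableType d) d1 (T1 : measurableType d1)
  d2 (T2 : measurableType d2) (R : realType).
Variables (M P1 P2 : probability T R) (f1 : T -> T1) (f2 : T -> T2).
Hypotheses (mf1 : measurable_fun setT f1) (mf2 : measurable_fun setT f2).
Local Open Scope ereal_scope.
Hypothesis rect : forall A B, measurable A -> measurable B ->
  M (f1 @^-1` A `&` f2 @^-1` B) = P1 (f1 @^-1` A) * P2 (f2 @^-1` B).
Variable Psi : T1 * T2 -> \bar R.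
Hypotheses (mPsi : measurable_fun setT Psi) (Psi0 : forall z, 0 <= Psi z).

Let F1 : {mfun T >-> T1} := HB.pack f1 (isMeasurableFun.Build _ _ _ _ _ mf1).
Let F2 : {mfun T >-> T2} := HB.pack f2 (isMeasurableFun.Build _ _ _ _ _ mf2).
Let Q1 := distribution P1 F1.
Let Q2 := distribution P2 F2.

Let mf12 : measurable_fun setT (fun w => (f1 w, f2 w)).
Proof. exact: measurable_fun_pair. Qed.

Let integral_law : \int[M]_w Psi (f1 w, f2 w) = \int[Q1 \x Q2]_z Psi z.
Proof.
transitivity (\int[pushforward M (fun w => (f1 w, f2 w))]_z Psi z).
  by rewrite ge0_integral_pushforward.
apply: eq_measure_integral => A mA _; apply/esym.
apply: product_measure_unique => //= B C mB mC.
Qed.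

(** [rect] determines the law of the pair, and Tonelli integrates it. The marginals are taken under
    [P1] and [P2], which may differ from [M]: after the change of measure the signal still has its
    law under the original probability. *)
Lemma integral_product_law1 :
  \int[M]_w Psi (f1 w, f2 w) = \int[P1]_w1 \int[P2]_w2 Psi (f1 w1, f2 w2).
Proof.
rewrite integral_law fubini_tonelli1 //.
rewrite (@ge0_integral_distribution _ _ _ _ _ P1 F1) //; last 2 first.
- exact: measurable_fun_fubini_tonelli_F.
- by move=> x; apply: integral_ge0.
apply: eq_integral => w1 _; rewrite /= /fubini_F.
rewrite (@ge0_integral_distribution _ _ _ _ _ P2 F2 (fun y => Psi (f1 w1, y))) //.
exact: measurableT_comp.
Qed.

Lemma integral_product_law2 :
  \int[M]_w Psi (f1 w, f2 w) = \int[P2]_w2 \int[P1]_w1 Psi (f1 w1, f2 w2).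
Proof.
rewrite integral_law fubini_tonelli2 //.
rewrite (@ge0_integral_distribution _ _ _ _ _ P2 F2) //; last 2 first.
- exact: measurable_fun_fubini_tonelli_G.
- by move=> x; apply: integral_ge0.
apply: eq_integral => w2 _; rewrite /= /fubini_G.
rewrite (@ge0_integral_distribution _ _ _ _ _ P1 F1 (fun x => Psi (x, f2 w2))) //.
exact: measurableT_comp.
Qed.

End product_law.

(** * Sub-sigma-algebras and cylinders *)

Section sub_sigma_algebra.
Context d (T : measurableType d) (R : realType).

Lemma sub_sigma_measurable (G : set_system T) : G `<=` measurable -> <<s G >> `<=` measurable.
Proof. by move=> GT; apply: smallest_sub => //; exact: sigma_algebra_measurable. Qed.

Lemma measurable_sub_id (G : set_system T) : G `<=` measurable ->
  measurable_fun setT (idfun : T -> g_sigma_algebraType G).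
Proof. by move=> GT _ A mA; rewrite setTI; exact: (sub_sigma_measurable GT). Qed.

Lemma measurable_from_sub d' (T' : measurableType d') (G : set_system T) (f : T -> T') :
  G `<=` measurable ->
  measurable_fun setT (f : g_sigma_algebraType G -> T') -> measurable_fun setT f.
Proof.
move=> GT mf _ B mB; have := mf measurableT B mB.
by rewrite !setTI; exact: (sub_sigma_measurable GT).
Qed.

Lemma measurable_wrtP d' (T' : measurableType d') (G : set_system T) (f : T -> T') :
  measurable_wrt <<s G >> f <-> measurable_fun setT (f : g_sigma_algebraType G -> T').
Proof.
split=> [mf _ B mB|mf A [B mB <-]]; first by apply: mf; exists B.
exact: mf.
Qed.

Lemma gen_sigma_sub (D : set nat) (f : nat -> T -> R) :
  (forall t, D t -> measurable_fun setT (f t)) ->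
  \bigcup_(t in D) preimage_set_system setT (f t) measurable `<=` measurable.
Proof. by move=> mf A [t Dt [B mB <-]]; exact: (mf t Dt measurableT B mB). Qed.

Lemma gen_sigma_measurable (D : set nat) (f : nat -> T -> R) t : D t ->
  measurable_fun setT (f t : g_sigma_algebraType
    (\bigcup_(t in D) preimage_set_system setT (f t) measurable) -> R).
Proof. by move=> Dt _ B mB; apply: sub_sigma_algebra; exists t => //; exists B. Qed.

Lemma natural_filtration_mono (Y : nat -> T -> R) s t : (s <= t)%N ->
  natural_filtration Y s `<=` natural_filtration Y t.
Proof.
move=> st; apply: smallest_sub; first exact: smallest_sigma_algebra.
apply: subset_trans; last exact: sub_sigma_algebra.
by apply: bigcup_subset => u /= /andP[u1 us]; rewrite u1 (leq_trans us).
Qed.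

(** The intersection runs over a duplicate-free list of indices, the shape in which
    [mutually_independent] is stated. *)
Definition cylinder (f : nat -> T -> R) (n : nat) (B : nat -> set R) : set T :=
  \bigcap_(i in [set` index_iota 1 n.+1]) f i @^-1` B i.

Lemma cylinderS f n B : cylinder f n.+1 B = cylinder f n B `&` f n.+1 @^-1` B n.+1.
Proof.
apply/seteqP; split=> w.
  move=> H; split; last by apply: (H n.+1); rewrite /= mem_index_iota ltnSn.
  move=> i /=; rewrite mem_index_iota => /andP[i1 iN]; apply: H.
  by rewrite /= mem_index_iota i1 ltnW.
move=> [H1 H2] i /=; rewrite mem_index_iota => /andP[i1].
rewrite ltnS leq_eqVlt => /predU1P[->//|iN]; apply: H1.
by rewrite /= mem_index_iota i1.
Qed.

Lemma cylinderI f n B B' :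
  cylinder f n (fun i => B i `&` B' i) = cylinder f n B `&` cylinder f n B'.
Proof. by rewrite /cylinder -bigcapI; apply: eq_bigcapr => i _. Qed.

Lemma cylinderT f n : cylinder f n (fun=> setT) = setT.
Proof. by apply/seteqP; split=> w // _ i _. Qed.

Lemma eq_cylinder f n B B' : (forall i, (1 <= i <= n)%N -> B i = B' i) ->
  cylinder f n B = cylinder f n B'.
Proof.
by move=> H; apply: eq_bigcapr => i; rewrite /= mem_index_iota ltnS => /H ->.
Qed.

Lemma cylinder1 f n k B : (1 <= k <= n)%N ->
  cylinder f n (fun i => if i == k then B else setT) = f k @^-1` B.
Proof.
move=> kn; apply/seteqP; split=> w.
  by move=> /(_ k); rewrite /= mem_index_iota ltnS eqxx => /(_ kn).
by move=> Bw i _ /=; case: eqP => [->|].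
Qed.

Lemma cylinder_gen_sigma f (D : set nat) n B :
  (forall i, (1 <= i <= n)%N -> D i) -> (forall i, measurable (B i)) ->
  gen_sigma D f (cylinder f n B).
Proof.
move=> nD mB; set G := \bigcup_(t in D) preimage_set_system setT (f t) measurable.
apply: (@fin_bigcap_measurable _ (g_sigma_algebraType G)); first exact: finite_seq.
move=> i /=; rewrite mem_index_iota ltnS => /nD Di; rewrite -[X in measurable X]setTI.
exact: gen_sigma_measurable.
Qed.

Lemma finite_measure_unique (C : set_system T) (m1 m2 : {measure set T -> \bar R}) :
  C `<=` measurable -> setI_closed C -> C setT -> (m1 setT < +oo)%E ->
  (forall A, C A -> m1 A = m2 A) -> forall A, <<s C >> A -> m1 A = m2 A.
Proof.
move=> Cm CI CT foo H A sA.
apply: (g_sigma_algebra_measure_unique C Cm (fun=> setT)) => //.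
by rewrite bigcup_const //; exists 0%N.
Qed.

End sub_sigma_algebra.

(** * Change of measure *)

Section girsanov.
Context d (Omega : measurableType d) (R : realType) (P : probability Omega R).
Variables (X eps : nat -> {RV P >-> R}) (A : nat -> R) (Y : nat -> Omega -> R).
Hypotheses
  (eps_law : forall t, (1 <= t)%N -> has_law P (eps t) (normal_prob 0 1))
  (eps_indep : mutually_independent P [set t | (1 <= t)%N]
     (fun t => eps t : Omega -> R))
  (X_eps_indep : independent_sigma P
     (gen_sigma [set t | (1 <= t)%N] (fun t => X t : Omega -> R))
     (gen_sigma [set t | (1 <= t)%N] (fun t => eps t : Omega -> R)))
  (Y_def : forall t w, (1 <= t)%N -> Y t w = A t * X t w + eps t w).
Local Open Scope ereal_scope.

Definition signal_gen : set_system Omega :=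
  \bigcup_(t in [set t | (1 <= t)%N]) preimage_set_system setT (X t : Omega -> R) measurable.

(** The whole signal, future included, belongs to the past: [Y n.+1] is then the fresh noise
    [eps n.+1] shifted by a past-measurable amount. *)
Definition past_gen (n : nat) : set_system Omega := signal_gen `|`
  \bigcup_(t in [set u | (1 <= u <= n)%N])
    preimage_set_system setT (eps t : Omega -> R) measurable.

Definition obs_gen (n : nat) : set_system Omega :=
  \bigcup_(t in [set u | (1 <= u <= n)%N]) preimage_set_system setT (Y t) measurable.

Definition shift_density (t : nat) (w : Omega) : R :=
  expR (- ((A t * X t w) ^+ 2 / 2) - A t * X t w * eps t w).

(* Under the density [girsanov n], [Y 1, ..., Y n] are independent standard normal
   variables, independent of [X], whose law is unchanged. *)
Definition girsanov (n : nat) (w : Omega) : R := (\prod_(1 <= t < n.+1) shift_density t w)%R.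

Lemma signal_gen_sub : signal_gen `<=` measurable.
Proof. by apply: gen_sigma_sub => t _. Qed.

Lemma past_gen_sub n : past_gen n `<=` measurable.
Proof. by rewrite subUset; split; [exact: signal_gen_sub|apply: gen_sigma_sub => t _]. Qed.

Lemma measurable_obs t : (1 <= t)%N -> measurable_fun setT (Y t).
Proof.
move=> t1; rewrite (_ : Y t = fun w => (A t * X t w + eps t w)%R); last first.
  by apply/funext => w; exact: Y_def.
by apply: measurable_funD => //; exact: measurable_funM.
Qed.

Lemma obs_gen_sub n : obs_gen n `<=` measurable.
Proof. by apply: gen_sigma_sub => t /= /andP[t1 _]; exact: measurable_obs. Qed.

Lemma past_X n t : (1 <= t)%N ->
  measurable_fun setT (X t : g_sigma_algebraType (past_gen n) -> R).
Proof.
move=> t1 _ B mB; apply: sub_sigma_algebra; left; exists t => //.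
by exists B.
Qed.

Lemma past_eps n t : (1 <= t <= n)%N ->
  measurable_fun setT (eps t : g_sigma_algebraType (past_gen n) -> R).
Proof.
by move=> tn _ B mB; apply: sub_sigma_algebra; right; exists t => //; exists B.
Qed.

Lemma past_Y n t : (1 <= t <= n)%N ->
  measurable_fun setT (Y t : g_sigma_algebraType (past_gen n) -> R).
Proof.
move=> tn; have /andP[t1 _] := tn.
rewrite (_ : Y t = fun w => (A t * X t w + eps t w)%R); last first.
  by apply/funext => w; exact: Y_def.
apply: measurable_funD; last exact: past_eps.
by apply: measurable_funM => //; exact: past_X.
Qed.

Lemma past_shift n t : (1 <= t <= n)%N ->
  measurable_fun setT (shift_density t : g_sigma_algebraType (past_gen n) -> R).
Proof.
move=> tn; have /andP[t1 _] := tn.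
have mAX : measurable_fun setT
    ((fun w => (A t * X t w)%R) : g_sigma_algebraType (past_gen n) -> R).
  by apply: measurable_funM => //; exact: past_X.
apply: measurableT_comp => //; apply: measurable_funB.
  by apply: measurableT_comp => //; apply: measurable_funM => //; exact: measurable_funX.
by apply: measurable_funM => //; exact: past_eps.
Qed.

Lemma girsanovS n w : (girsanov n.+1 w = girsanov n w * shift_density n.+1 w)%R.
Proof. by rewrite /girsanov big_nat_recr. Qed.

Lemma past_girsanov n k : (k <= n)%N ->
  measurable_fun setT (girsanov k : g_sigma_algebraType (past_gen n) -> R).
Proof.
elim: k => [|k IH] kn.
  rewrite (_ : girsanov 0 = cst 1%R) //.
  by apply/funext => w; rewrite /girsanov big_geq.
rewrite (_ : girsanov k.+1 = fun w => girsanov k w * shift_density k.+1 w)%R; last first.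
  by apply/funext => w; exact: girsanovS.
by apply: measurable_funM; [apply: IH; exact: ltnW|exact: past_shift].
Qed.

Lemma girsanov_ge0 n w : (0 <= girsanov n w)%R.
Proof. by apply: prodr_ge0 => t _; exact: expR_ge0. Qed.

Lemma obs_past n : <<s obs_gen n >> `<=` <<s past_gen n >>.
Proof.
apply: smallest_sub; first exact: smallest_sigma_algebra.
by move=> B [t tn [C mC <-]]; exact: past_Y.
Qed.

Lemma signal_past n : <<s signal_gen >> `<=` <<s past_gen n >>.
Proof.
apply: smallest_sub; first exact: smallest_sigma_algebra.
by move=> B SB; apply: sub_sigma_algebra; left.
Qed.

(** Both sides are finite measures in [C], so it suffices to compare them on intersections of a
    signal event with a noise cylinder. This class is stable under intersection, and the two
    independence hypotheses factor its probabilities. *)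
Lemma past_noise_indep n C B : <<s past_gen n >> C -> measurable B ->
  P (C `&` eps n.+1 @^-1` B) = P C * P (eps n.+1 @^-1` B).
Proof.
move=> sC mB.
have mE (t : nat) (D : set R) : measurable D -> measurable ((eps t : Omega -> R) @^-1` D).
  by move=> mD; rewrite -[X in measurable X]setTI; exact: measurable_funPT.
have mEB := mE n.+1 _ mB.
pose e := fun t => eps t : Omega -> R.
pose CC : set_system Omega := [set D | exists D1 E, [/\ <<s signal_gen >> D1,
  (forall i, measurable (E i)) & D = D1 `&` cylinder e n E]].
have mcyl E : (forall i, measurable (E i)) -> gen_sigma [set t | (1 <= t)%N] e (cylinder e n E).
  by move=> mE'; apply: cylinder_gen_sigma => // i /andP[].
have e_sub : \bigcup_(t in [set t | (1 <= t)%N]) preimage_set_system setT (e t) measurable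
    `<=` measurable by apply: gen_sigma_sub => t _.
have CCm : CC `<=` measurable.
  move=> _ [D1 [E [sD1 mE' ->]]]; apply: measurableI.
    exact: (sub_sigma_measurable signal_gen_sub).
  by apply: (sub_sigma_measurable e_sub); exact: mcyl.
have pfin : P (eps n.+1 @^-1` B) \is a fin_num by exact: fin_num_measure.
have p0 : (0 <= fine (P (eps n.+1 @^-1` B)))%R by apply: fine_ge0.
have pastCC : <<s past_gen n >> `<=` <<s CC >>.
  apply: smallest_sub; first exact: smallest_sigma_algebra.
  move=> D [SD|[t tn [F mF <-]]]; apply: sub_sigma_algebra.
    exists D, (fun=> setT); split => //; first exact: sub_sigma_algebra.
    by rewrite cylinderT setIT.
  exists setT, (fun i => if i == t then F else setT); split => //.
  - by apply: (@measurableT _ (g_sigma_algebraType signal_gen)).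
  - by move=> i; case: ifP.
  - by rewrite cylinder1.
(* The right-hand side as a measure: [P] scaled by the probability of the noise event. *)
have mscaleE D : mscale (NngNum p0) P D = P (eps n.+1 @^-1` B) * P D.
  by rewrite -[in RHS](fineK pfin).
have CCI : setI_closed CC.
  move=> _ _ [D1 [E [sD1 mE1 ->]]] [D2 [E' [sD2 mE2 ->]]].
  exists (D1 `&` D2), (fun i => E i `&` E' i); split.
  - exact: (@measurableI _ (g_sigma_algebraType signal_gen)).
  - by move=> i; exact: measurableI.
  - by rewrite cylinderI setIACA.
have CCT : CC setT.
  exists setT, (fun=> setT); split => //.
  - by apply: (@measurableT _ (g_sigma_algebraType signal_gen)).
  - by rewrite cylinderT setIT.
have CCoo : mrestr P mEB setT < +oo.
  by rewrite /mrestr setTI (le_lt_trans (probability_le1 P mEB)) // ltry.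
rewrite [RHS]muleC -mscaleE -[LHS]/(mrestr P mEB C).
apply: (finite_measure_unique CCm CCI CCT CCoo) (pastCC _ sC) => D.
move=> [D1 [E [sD1 mE1 ->]]]; apply: etrans (esym (mscaleE _)); rewrite /= /mrestr.
(* With [B] as coordinate [n.+1], the noise event completes a cylinder of length [n.+1]. *)
pose E' := fun i => if i == n.+1 then B else E i.
have mE' i : measurable (E' i) by rewrite /E'; case: ifP.
have cylE : cylinder e n E `&` eps n.+1 @^-1` B = cylinder e n.+1 E'.
  rewrite cylinderS /E' eqxx; congr (_ `&` _).
  by apply: eq_cylinder => i /andP[_ iN]; rewrite ltn_eqF.
have cyl1 : gen_sigma [set t | (1 <= t)%N] e (cylinder e n.+1 E').
  by apply: cylinder_gen_sigma => // i /andP[].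
rewrite -setIA cylE !X_eps_indep //; last exact: mcyl.
rewrite muleCA; congr (_ * _).
rewrite /cylinder !eps_indep ?iota_uniq //; last 2 first.
- by move=> i; rewrite mem_index_iota => /andP[].
- by move=> i; rewrite mem_index_iota => /andP[].
rewrite big_nat_recr //= /E' eqxx muleC; congr (_ * _).
by apply: eq_big_nat => i /andP[_ iN]; rewrite ltn_eqF.
Qed.

(** With the past frozen, [Y n.+1] is a standard normal variable shifted by [A n.+1 * X n.+1], and
    [shift_density] is the factor in [normal01_shift] that undoes this shift. *)
Lemma girsanov_step n (Psi : g_sigma_algebraType (past_gen n) * measurableTypeR R -> \bar R) :
  measurable_fun setT Psi -> (forall z, 0 <= Psi z) ->
  \int[P]_w (Psi (w, Y n.+1 w) * (shift_density n.+1 w)%:E) =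
  \int[P]_w \int[normal_prob 0 1]_x Psi (w, x).
Proof.
move=> mPsi Psi0.
pose H := g_sigma_algebraType (past_gen n).
pose a (w : H) := (A n.+1 * X n.+1 w)%R.
have ma : measurable_fun setT a by apply: measurable_funM => //; exact: past_X.
pose Phi (z : H * measurableTypeR R) := Psi (z.1, (a z.1 + z.2)%R) *
  (expR (- (a z.1 ^+ 2 / 2) - a z.1 * z.2))%:E.
have ma1 : measurable_fun setT (fun z : H * measurableTypeR R => a z.1).
  exact: measurableT_comp ma measurable_fst.
have mz2 : measurable_fun setT (fun z : H * measurableTypeR R => z.2 : R).
  exact: measurable_snd.
have mPhi : measurable_fun setT Phi.
  apply: emeasurable_funM.
    apply: (measurableT_comp mPsi); apply: measurable_fun_pair; first exact: measurable_fst.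
    exact: (@measurable_funD _ _ R).
  apply/measurable_EFinP; apply: measurableT_comp => //; apply: measurable_funB.
    by apply: measurableT_comp => //; apply: measurable_funM => //; exact: measurable_funX.
  exact: measurable_funM.
have Phi0 z : 0 <= Phi z by rewrite mule_ge0 // lee_fin expR_ge0.
have meps : measurable_fun setT (eps n.+1 : Omega -> measurableTypeR R).
  exact: (@measurable_funPT _ _ Omega R (eps n.+1)).
transitivity (\int[P]_w Phi (idfun w : H, eps n.+1 w : measurableTypeR R)).
  apply: eq_integral => w _; rewrite /Phi /= Y_def //.
rewrite (@integral_product_law1 _ _ _ H _ (measurableTypeR R) R P P P) //; last 2 first.
- exact: measurable_sub_id (@past_gen_sub n).
- by move=> C D mC mD; rewrite preimage_id past_noise_indep.
apply: eq_integral => w _; rewrite /=.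
have mPw : measurable_fun setT (fun x => Psi (w, x)).
  apply: (measurableT_comp mPsi); apply: measurable_fun_pair => //; exact: measurable_cst.
rewrite (@has_law_integral _ _ _ _ (eps n.+1) (normal_prob 0 1) (fun x => Phi (w, x))) //.
- rewrite /Phi /= (normal01_shift (a w) mPw) //.
- exact: eps_law.
- apply: (measurableT_comp mPhi); apply: measurable_fun_pair => //; exact: measurable_cst.
Qed.

End girsanov.

(** * The reference probability *)

Section girsanov_probability.
Context d (Omega : measurableType d) (R : realType) (P : probability Omega R).
Variables (X eps : nat -> {RV P >-> R}) (A : nat -> R) (Y : nat -> Omega -> R).
Hypotheses
  (eps_law : forall t, (1 <= t)%N -> has_law P (eps t) (normal_prob 0 1))
  (eps_indep : mutually_independent P [set t | (1 <= t)%N]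
     (fun t => eps t : Omega -> R))
  (X_eps_indep : independent_sigma P
     (gen_sigma [set t | (1 <= t)%N] (fun t => X t : Omega -> R))
     (gen_sigma [set t | (1 <= t)%N] (fun t => eps t : Omega -> R)))
  (Y_def : forall t w, (1 <= t)%N -> Y t w = A t * X t w + eps t w).
Local Open Scope ereal_scope.

Local Notation gir := (girsanov X eps A).
Local Notation SX := (signal_gen X).
Local Notation OY := (obs_gen Y).
Local Notation HP := (past_gen X eps).

Lemma measurable_girsanov n : measurable_fun setT (gir n).
Proof.
by apply: (measurable_from_sub (@past_gen_sub _ _ _ _ X eps n)); exact: past_girsanov.
Qed.

Lemma measurable_sub_indic (G : set_system Omega) (D : set Omega) : <<s G >> D ->
  measurable_fun setT (\1_D : g_sigma_algebraType G -> R).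
Proof. by move=> sD; exact: (@measurable_indic _ (g_sigma_algebraType G)). Qed.

(** Induction on [n]: the signal event and the first [n] observations lie in the past, so
    [girsanov_step] turns the last observation into an independent standard normal variable and
    splits off one factor. *)
Lemma girsanov_rect n C B : <<s SX >> C -> (forall i, measurable (B i)) ->
  \int[P]_w (\1_(C `&` cylinder Y n B) w * gir n w)%:E =
  P C * \prod_(1 <= i < n.+1) normal_prob 0 1 (B i).
Proof.
move=> sC mB; elim: n => [|n IH].
  rewrite big_geq // mule1 (_ : cylinder Y 0 B = setT); last first.
    by apply/seteqP; split=> w // _ i; rewrite /= mem_index_iota ltnS => /andP[]; case: i.
  have mC := sub_sigma_measurable (@signal_gen_sub _ _ _ _ X) sC.
  rewrite setIT -[C in RHS]setIT -integral_indic //.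
  by apply: eq_integral => w _; rewrite /girsanov big_geq // mulr1.
set D := C `&` cylinder Y n B in IH.
have sD : <<s HP n >> D.
  apply: (@measurableI _ (g_sigma_algebraType (HP n))); first exact: signal_past.
  by apply: (obs_past Y_def); apply: cylinder_gen_sigma.
pose H := g_sigma_algebraType (HP n).
have mD : measurable_fun setT (fun w : H => \1_D w * gir n w)%R.
  by apply: measurable_funM; [exact: measurable_sub_indic|exact: past_girsanov].
pose Psi (z : H * measurableTypeR R) := (\1_D z.1 * gir n z.1 * \1_(B n.+1) z.2)%:E.
transitivity (\int[P]_w (Psi (w, Y n.+1 w) * (shift_density X eps A n.+1 w)%:E)).
  apply: eq_integral => w _; rewrite -EFinM; congr EFin; rewrite /= girsanovS.
  rewrite cylinderS setIA indicI /= mulrACA !mulrA.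
  by rewrite (_ : \1_(_ @^-1` _) w = \1_(B n.+1) (Y n.+1 w)).
rewrite (girsanov_step eps_law eps_indep X_eps_indep Y_def); last 2 first.
- apply/measurable_EFinP; apply: measurable_funM.
    exact: (measurableT_comp mD measurable_fst).
  apply: (@measurableT_comp _ _ _ _ _ _ (\1_(B n.+1) : R -> R)); last exact: measurable_snd.
  exact: measurable_indic.
- by move=> z; rewrite lee_fin !mulr_ge0 ?girsanov_ge0.
transitivity (\int[P]_w ((\1_D w * gir n w)%:E * normal_prob 0 1 (B n.+1))).
  apply: eq_integral => w _; rewrite /Psi /=.
  under eq_integral do rewrite EFinM.
  rewrite ge0_integralZl_EFin ?mulr_ge0 ?girsanov_ge0 //; last first.
    by apply/measurable_EFinP; apply: measurable_indic; exact: mB.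
  by rewrite integral_indic ?setIT //; exact: mB.
rewrite ge0_integralZr ?measure_ge0 //; last 2 first.
- apply/measurable_EFinP; exact: (measurable_from_sub (@past_gen_sub _ _ _ _ X eps n)).
- by move=> w _; rewrite lee_fin mulr_ge0 ?girsanov_ge0.
by rewrite IH [in RHS]big_nat_recr //= muleA.
Qed.

Lemma girsanov_mass n : \int[P]_w (gir n w)%:E = 1.
Proof.
have := @girsanov_rect n setT (fun=> setT) _ (fun=> measurableT).
rewrite cylinderT setIT probability_setT mul1e big1 => [<-|i _]; last exact: probability_setT.
  by apply: eq_integral => w _; rewrite indicT mul1r.
exact: (@measurableT _ (g_sigma_algebraType SX)).
Qed.

Definition girsanov_prob n : probability Omega R :=
  density_measure (measurable_girsanov n) (girsanov_ge0 X eps A n) (girsanov_mass n).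

Lemma girsanov_probE n (f : Omega -> \bar R) :
  measurable_fun setT f -> (forall w, 0 <= f w) ->
  \int[girsanov_prob n]_w f w = \int[P]_w (f w * (gir n w)%:E).
Proof. by move=> mf f0; rewrite ge0_integral_density_prob. Qed.

Lemma girsanov_prob_set n D : measurable D ->
  girsanov_prob n D = \int[P]_w (\1_D w * gir n w)%:E.
Proof.
move=> mD; rewrite /= /density_measure integral_mkcond /=; apply: eq_integral => w _.
by rewrite patchE indicE; case: ifP => _; rewrite ?mul1r ?mul0r.
Qed.

(** By [girsanov_rect] the two sides agree when [D] is a cylinder, and both are finite measures in
    [D]. The first factor is taken under [P] because the signal keeps its law. *)
Lemma girsanov_prob_indep n C D : <<s SX >> C -> <<s OY n >> D ->
  girsanov_prob n (C `&` D) = P C * girsanov_prob n D.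
Proof.
move=> sC sD.
have mC : measurable C by exact: (sub_sigma_measurable (@signal_gen_sub _ _ _ _ X)).
pose CC : set_system Omega := [set D | exists E, (forall i, measurable (E i)) /\
  D = cylinder Y n E].
have osub := @obs_gen_sub _ _ _ _ X eps A Y Y_def n.
have CCm : CC `<=` measurable.
  by move=> _ [E [mE ->]]; apply: (sub_sigma_measurable osub); apply: cylinder_gen_sigma.
have CCI : setI_closed CC.
  move=> _ _ [E [mE ->]] [E' [mE' ->]]; exists (fun i => E i `&` E' i).
  by rewrite cylinderI; split => // i; exact: measurableI.
have CCT : CC setT by exists (fun=> setT); rewrite cylinderT.
have obsCC : <<s OY n >> `<=` <<s CC >>.
  apply: smallest_sub; first exact: smallest_sigma_algebra.
  move=> B [t tn [F mF <-]]; apply: sub_sigma_algebra.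
  exists (fun i => if i == t then F else setT); rewrite cylinder1 // setTI.
  by split => // i; case: ifP.
have pfin : P C \is a fin_num by exact: fin_num_measure.
have p0 : (0 <= fine (P C))%R by apply: fine_ge0.
have mscaleE E : mscale (NngNum p0) (girsanov_prob n) E = P C * girsanov_prob n E.
  by rewrite -[in RHS](fineK pfin).
have CCoo : mrestr (girsanov_prob n) mC setT < +oo.
  by rewrite /mrestr setTI (le_lt_trans (probability_le1 (girsanov_prob n) mC)) // ltry.
rewrite setIC -mscaleE -[LHS]/(mrestr (girsanov_prob n) mC D).
apply: (finite_measure_unique CCm CCI CCT CCoo) (obsCC _ sD) => E CE.
transitivity (P C * girsanov_prob n E); last by rewrite -mscaleE.
rewrite -[LHS]/(girsanov_prob n (E `&` C)) [E `&` C]setIC.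
have mE := CCm _ CE.
rewrite !girsanov_prob_set //; last exact: measurableI.
have [B [mB ->]] := CE.
rewrite girsanov_rect //.
have := @girsanov_rect n setT B _ mB; rewrite setTI => ->.
  by rewrite probability_setT mul1e.
exact: (@measurableT _ (g_sigma_algebraType SX)).
Qed.

(** [Psi] stands for a function of the signal and the observations: its arguments are two points of
    [Omega], measured through two sub-sigma-algebras. By independence the observation point [w2] can
    be frozen while the signal is integrated under [P]. *)
Lemma girsanov_bayes n
    (Psi : g_sigma_algebraType SX * g_sigma_algebraType (OY n) -> \bar R)
    (G : Omega -> \bar R) :
  measurable_fun setT Psi -> (forall z, 0 <= Psi z) -> measurable_fun setT G ->
  (forall w2, \int[P]_w1 Psi (w1, w2) = G w2) ->
  \int[P]_w (Psi (w, w) * (gir n w)%:E) = \int[P]_w (G w * (gir n w)%:E).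
Proof.
move=> mPsi Psi0 mG PsiG.
have G0 w : 0 <= G w by rewrite -PsiG; apply: integral_ge0.
have mid1 := measurable_sub_id (@signal_gen_sub _ _ _ _ X).
have mid2 := measurable_sub_id (@obs_gen_sub _ _ _ _ X eps A Y Y_def n).
rewrite -!girsanov_probE //; last first.
  by apply: (measurableT_comp mPsi); exact: measurable_fun_pair mid1 mid2.
rewrite (@integral_product_law2 _ _ _ (g_sigma_algebraType SX) _
  (g_sigma_algebraType (OY n)) R (girsanov_prob n) P (girsanov_prob n) idfun idfun) //.
- by apply: eq_integral => w _; exact: PsiG.
- by move=> C D mC mD; rewrite !preimage_id girsanov_prob_indep.
Qed.

End girsanov_probability.

Section second_moment.
Context d (T : measurableType d) (R : realType) (mu : {measure set T -> \bar R}).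
Variables (W x : T -> R) (C z g : R).
Hypotheses (mW : measurable_fun setT W) (mx : measurable_fun setT x)
  (W0 : forall w, 0 <= W w) (C0 : 0 < C).
Local Open Scope ereal_scope.
Hypothesis mgfE : forall a, wmgf mu W x a = (C * expR (a * z + a ^+ 2 / 2 * g))%:E.

Lemma gaussian_second_moment (c : R) :
  \int[mu]_w (W w * (x w - c) ^+ 2)%:E = (C * (g + (z - c) ^+ 2))%:E.
Proof.
have iWx := gaussian_integrable mW mx W0 C0 mgfE.
have Wx := gaussian_mean mW mx W0 C0 mgfE.
have Wv := gaussian_variance mW mx W0 C0 mgfE.
have W1 : \int[mu]_w (W w)%:E = C%:E.
  have := mgfE 0; rewrite expr0n /= !mul0r addr0 expR0 mulr1 => <-.
  by apply: eq_integral => w _; rewrite mul0r expR0 mulr1.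
have iW : mu.-integrable setT (fun w => (W w)%:E).
  apply/integrableP; split; first exact/measurable_EFinP.
  by under eq_integral do rewrite /= ger0_norm //; rewrite W1 ltry.
have iWv : mu.-integrable setT (fun w => (W w * (x w - z) ^+ 2)%:E).
  apply/integrableP; split.
    apply/measurable_EFinP/measurable_funM => //; apply: measurable_funX.
    exact: measurable_funB.
  have Wv0 w : (0 <= W w * (x w - z) ^+ 2)%R by rewrite mulr_ge0 // sqr_ge0.
  under eq_integral do rewrite /= ger0_norm //.
  by rewrite Wv ltry.
transitivity (\int[mu]_w ((W w * (x w - z) ^+ 2)%:E +
    ((2 * (z - c))%:E * (W w * x w)%:E + ((z - c) * (- z - c))%:E * (W w)%:E))).
  by apply: eq_integral => w _; rewrite -!EFinM -!EFinD; congr EFin; ring.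
rewrite integralD //; last by apply: integrableD => //; exact: integrableZl.
rewrite integralD //; [|exact: integrableZl..].
rewrite !integralZl // Wv Wx W1 -!EFinM -!EFinD; congr EFin; ring.
Qed.

End second_moment.

(** * Solutions of the recursions for covariance and mean *)

Section conditioning_recursion.
Context {R : realType}.
Variables (S : nat -> R) (K : nat -> nat -> R) (m b : nat -> R).

Lemma ckernE n t s : ckern S K n t s = K t s - \sum_(1 <= l < n.+1)
  ckern S K l.-1 t l * ckern S K l.-1 s l * (S l / (1 + S l * ckern S K l.-1 l l)).
Proof.
elim: n => [|n IH]; first by rewrite big_geq // subr0.
by rewrite [LHS]/= IH [in RHS]big_nat_recr //= opprD addrA.
Qed.

Lemma cmeanE n t : cmean S K m b n t = m t + \sum_(1 <= l < n.+1)
  ckern S K l.-1 t l * ((b l - S l * cmean S K m b l.-1 l) / (1 + S l * ckern S K l.-1 l l)).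
Proof.
elim: n => [|n IH]; first by rewrite big_geq // addr0.
by rewrite [LHS]/= IH [in RHS]big_nat_recr //= addrA.
Qed.

(** Strong induction on [s]: [g t s] is the covariance after the first [s.-1] tilts, and the terms
    [l < s] of the equation are the updates summed in [ckernE]. *)
Lemma solution_ckern (T : nat) (g : nat -> nat -> R) :
  (forall t s, (1 <= s <= t)%N -> (t <= T)%N -> g t s = K t s -
    \sum_(1 <= l < s) g t l * g s l * (S l / (1 + S l * g l l))) ->
  forall t s, (1 <= s <= t)%N -> (t <= T)%N -> g t s = ckern S K s.-1 t s.
Proof.
move=> gE t s; elim/ltn_ind: s t => s IH t st tT.
rewrite gE // ckernE; have /andP[s1 st'] := st; congr (_ - _); rewrite prednK //.
apply: eq_big_nat => l /andP[l1 ls].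
rewrite !IH // ?l1 ?leqnn ?(ltnW ls) //.
- exact: leq_trans (ltnW ls) (leq_trans st' tT).
- exact: leq_trans st' tT.
- exact: leq_trans (ltnW ls) st'.
Qed.

Lemma solution_cmean (z : nat -> R) :
  (forall t, (1 <= t)%N -> z t = m t + \sum_(1 <= l < t)
    ckern S K l.-1 t l * ((b l - S l * z l) / (1 + S l * ckern S K l.-1 l l))) ->
  forall t, (1 <= t)%N -> z t = cmean S K m b t.-1 t.
Proof.
move=> zE; elim/ltn_ind => t IH t1.
rewrite zE // cmeanE prednK //; congr (_ + _).
by apply: eq_big_nat => l /andP[l1 lt]; rewrite IH.
Qed.

End conditioning_recursion.

Section adapted_conditioning.
Context d (T : measurableType d) (R : realType).
Variables (S : nat -> R) (K : nat -> nat -> R) (m : nat -> R) (b : T -> nat -> R).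

Lemma measurable_cmean n t :
  (forall l, (1 <= l <= n)%N -> measurable_fun setT (fun w => b w l)) ->
  measurable_fun setT (fun w => cmean S K m (b w) n t).
Proof.
elim: n t => [|n IH] t mb /=; first exact: measurable_cst.
have mb' l : (1 <= l <= n)%N -> measurable_fun setT (fun w => b w l).
  by move=> /andP[l1 ln]; apply: mb; rewrite l1 leqW.
apply: measurable_funD; first exact: IH.
apply: measurable_funM => //; apply: measurable_funM => //.
apply: measurable_funB; first by apply: mb; rewrite leqnn.
by apply: measurable_funM => //; exact: IH.
Qed.

Lemma cmassS (b' : nat -> R) n : cmass S K m b' n.+1 = cmass S K m b' n *
  ((Num.sqrt (1 + S n.+1 * ckern S K n n.+1 n.+1))^-1 *
   expR ((cmean S K m b' n n.+1 * b' n.+1 + b' n.+1 ^+ 2 / 2 * ckern S K n n.+1 n.+1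
          - S n.+1 / 2 * cmean S K m b' n n.+1 ^+ 2) / (1 + S n.+1 * ckern S K n n.+1 n.+1))).
Proof. by rewrite /cmass big_nat_recr. Qed.

Lemma measurable_cmass n :
  (forall l, (1 <= l <= n)%N -> measurable_fun setT (fun w => b w l)) ->
  measurable_fun setT (fun w => cmass S K m (b w) n).
Proof.
elim: n => [|n IH] mb.
  rewrite (_ : (fun w => _) = cst 1) //.
  by apply/funext => w; rewrite /cmass big_geq.
have mb' l : (1 <= l <= n)%N -> measurable_fun setT (fun w => b w l).
  by move=> /andP[l1 ln]; apply: mb; rewrite l1 leqW.
have mbn : measurable_fun setT (fun w => b w n.+1) by apply: mb; rewrite leqnn.
have mc : measurable_fun setT (fun w => cmean S K m (b w) n n.+1) by exact: measurable_cmean.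
under eq_fun do rewrite cmassS.
apply: measurable_funM; first exact: IH.
apply: measurable_funM => //; apply: measurableT_comp => //.
apply: measurable_funM => //; apply: measurable_funB.
  apply: measurable_funD; first exact: measurable_funM.
  by do 2 apply: measurable_funM => //; exact: measurable_funX.
by apply: measurable_funM => //; exact: measurable_funX.
Qed.

End adapted_conditioning.

(** * Almost sure uniqueness of conditional expectations *)

Section conditional_uniqueness.
Context d (T : measurableType d) (R : realType) (P : probability T R).
Variable G : set_system T.
Hypothesis GT : G `<=` measurable.
Local Open Scope ereal_scope.
Local Notation TG := (g_sigma_algebraType G).

Let mid : measurable_fun setT (idfun : T -> TG). Proof. exact: measurable_sub_id. Qed.

Let idG : {mfun T >-> TG} :=
  HB.pack (idfun : T -> TG) (isMeasurableFun.Build _ _ _ _ _ mid).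

(** Restriction of [P] to the sub-sigma-algebra: equality of integrals on its sets becomes equality
    on all measurable sets. *)
Let P' : probability TG R := distribution P idG.

Let integral_sub (f : TG -> \bar R) (D : set T) : measurable_fun setT f -> <<s G >> D ->
  \int[P']_(w in D) f w = \int[P]_(w in D) f w.
Proof.
move=> mf sD; rewrite [LHS]integralE [RHS]integralE; congr (_ - _).
- rewrite (@ge0_integral_pushforward _ _ T TG R idfun mid P D) //.
  by apply: measurable_funTS; exact: measurable_funepos.
- rewrite (@ge0_integral_pushforward _ _ T TG R idfun mid P D) //.
  by apply: measurable_funTS; exact: measurable_funeneg.
Qed.

(** Neither function is assumed integrable. On the sets [E n], where [g] is bounded by [n],
    [integral_ae_eq] applies, and these sets cover the space. *)
Lemma eq_sub_integral_ae (f : TG -> \bar R) (g : TG -> R) :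
  measurable_fun setT f -> measurable_fun setT g ->
  (forall D, <<s G >> D -> \int[P]_(w in D) f w = \int[P]_(w in D) (g w)%:E) ->
  {ae P, forall w, f w = (g w)%:E}.
Proof.
move=> mf mg fg.
pose E (n : nat) : set TG := [set w | `|g w| <= n%:R]%R.
have mE n : measurable (E n).
  rewrite (_ : E n = setT `&` g @^-1` `[(- n%:R)%R, n%:R%R]%classic).
    by apply: mg => //; exact: measurable_itv.
  by rewrite setTI; apply/seteqP; split=> w; rewrite /E /= in_itv /= ler_norml.
have mgE : measurable_fun setT (EFin \o g) by exact/measurable_EFinP.
have H n : ae_eq P' (E n) (EFin \o g) f.
  apply: integral_ae_eq => //.
  - apply: (@measurable_bounded_integrable _ TG R P' g (E n)) => //.
    + exact: le_lt_trans (probability_le1 P' (mE n)) (ltry _).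
    + exact: measurable_funTS.
    + exists n%:R; split; first exact: num_real.
      by move=> x nx w /= Ew; apply: le_trans (ltW nx).
  - exact: measurable_funTS.
  - by move=> F _ mF; rewrite !integral_sub // fg.
have {}H : {ae P', forall w, forall n : nat, E n w -> (EFin \o g) w = f w}.
  by apply: ae_foralln => n; exact: H.
case: H => N [mN N0 HN]; exists N; split => //; first exact: (sub_sigma_measurable GT).
move=> w /= Hw; apply: HN => /= Hw'; apply: Hw.
by apply/esym; apply: (Hw' (Num.truncn `|g w|).+1); rewrite /E /= ltW // truncnS_gt.
Qed.

End conditional_uniqueness.

(** * The filter *)

Section gain_algebra.
Context {R : realType}.

Lemma powRN12_sqrt (x : R) : 0 < x -> x `^ (- 2^-1) = (Num.sqrt x)^-1.
Proof. by move=> x0; rewrite powRN powR12_sqrt // ltW. Qed.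

(** The last product on the left is the density ratio of N(a p, 1 + a^2 g0) to N(0, 1) at [y], the
    right-hand side that of N(a z, 1 + a^2 gb); a factor of the martingale is thus their
    quotient. *)
Lemma likelihood_term (a y z p gb g0 : R) : 0 <= gb -> 0 <= g0 ->
  ((1 + a ^+ 2 * g0) / (1 + a ^+ 2 * gb)) `^ (2^-1)
   * expR (a / (1 + a ^+ 2 * gb) * (z - p) * (y - a * p)
           - 2^-1 * (a ^+ 2 / (1 + a ^+ 2 * gb)) * (z - p) ^+ 2
           - 2^-1 * (a ^+ 2 * (g0 - gb) * (y - a * p) ^+ 2
             / ((1 + a ^+ 2 * gb) * (1 + a ^+ 2 * g0))))
   * ((Num.sqrt (1 + a ^+ 2 * g0))^-1 *
      expR ((p * (a * y) + (a * y) ^+ 2 / 2 * g0 - a ^+ 2 / 2 * p ^+ 2) / (1 + a ^+ 2 * g0)))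
  = (Num.sqrt (1 + a ^+ 2 * gb))^-1 *
    expR ((z * (a * y) + (a * y) ^+ 2 / 2 * gb - a ^+ 2 / 2 * z ^+ 2) / (1 + a ^+ 2 * gb)).
Proof.
move=> gb0 g00.
have v : 0 < 1 + a ^+ 2 * gb by rewrite ltr_pwDl // mulr_ge0 // sqr_ge0.
have v0 : 0 < 1 + a ^+ 2 * g0 by rewrite ltr_pwDl // mulr_ge0 // sqr_ge0.
rewrite powR12_sqrt; last by rewrite divr_ge0 // ltW.
rewrite sqrtrM ?(ltW v0) // sqrtrV ?(ltW v) //.
set s := Num.sqrt (1 + a ^+ 2 * gb); set s0 := Num.sqrt (1 + a ^+ 2 * g0).
have sn : s0 != 0 by rewrite lt0r_neq0 // sqrtr_gt0.
have E (u u' : R) : s0 / s * expR u * (s0^-1 * expR u') = s^-1 * expR (u + u').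
  by rewrite expRD; field; rewrite sn /= lt0r_neq0 // sqrtr_gt0.
rewrite E; congr (_ * expR _); field.
by rewrite !lt0r_neq0.
Qed.

(** The left-hand side ends with a factor of [likelihood], and the right-hand side contains the
    factor of [cmass] for [S = a ^+ 2 - mu * q] and [b = a * y - mu * q * h]. The representation is
    thereby checked one time at a time. *)
Lemma cost_term (a q y z h gb mu : R) : 0 <= gb -> 0 < 1 + (a ^+ 2 - mu * q) * gb ->
  ((1 + (a ^+ 2 - mu * q) * gb) / (1 + a ^+ 2 * gb)) `^ (- 2^-1)
   * expR (mu / 2 * q * ((1 + a ^+ 2 * gb) / (1 + (a ^+ 2 - mu * q) * gb))
           * (h - (z + a * gb * y) / (1 + a ^+ 2 * gb)) ^+ 2)
   * ((Num.sqrt (1 + a ^+ 2 * gb))^-1 *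
      expR ((z * (a * y) + (a * y) ^+ 2 / 2 * gb - a ^+ 2 / 2 * z ^+ 2) / (1 + a ^+ 2 * gb)))
  = expR (mu / 2 * q * h ^+ 2) * ((Num.sqrt (1 + (a ^+ 2 - mu * q) * gb))^-1 *
    expR ((z * (a * y - mu * q * h) + (a * y - mu * q * h) ^+ 2 / 2 * gb
           - (a ^+ 2 - mu * q) / 2 * z ^+ 2) / (1 + (a ^+ 2 - mu * q) * gb))).
Proof.
move=> gb0 vS.
have v : 0 < 1 + a ^+ 2 * gb by rewrite ltr_pwDl // mulr_ge0 // sqr_ge0.
rewrite powRN12_sqrt ?divr_gt0 //.
rewrite sqrtrM ?(ltW vS) // sqrtrV ?(ltW v) //.
set s := Num.sqrt (1 + a ^+ 2 * gb); set sS := Num.sqrt (1 + (a ^+ 2 - mu * q) * gb).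
have sn : s != 0 by rewrite lt0r_neq0 // sqrtr_gt0.
have sSn : sS != 0 by rewrite lt0r_neq0 // sqrtr_gt0.
have E (u u' : R) : (sS / s)^-1 * expR u * (s^-1 * expR u') = sS^-1 * expR (u + u').
  by rewrite expRD; field; rewrite sn sSn.
have E' (u u' : R) : expR u * (sS^-1 * expR u') = sS^-1 * expR (u + u').
  by rewrite expRD mulrCA.
rewrite E E'; congr (_ * expR _); field.
by rewrite !lt0r_neq0.
Qed.

End gain_algebra.

Lemma measurable_inv_ge0 d (T : measurableType d) (R : realType) (f : T -> R) :
  measurable_fun setT f -> (forall w, 0 <= f w) -> measurable_fun setT (fun w => (f w)^-1).
Proof.
move=> mf f0; rewrite (_ : (fun w => _) = (fun w => f w `^ (-1))).
  exact: (measurableT_comp (measurable_powR _)).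
by apply/funext => w; rewrite powR_inv1.
Qed.

Section linear_filter.
Context d (Omega : measurableType d) (R : realType) (P : probability Omega R).
Variables (X eps : nat -> {RV P >-> R}) (m : nat -> R) (K : nat -> nat -> R)
  (A : nat -> R) (Y : nat -> Omega -> R).
Hypotheses
  (X_gaussian : gaussian_sequence P (fun t => X t : Omega -> R))
  (X_mean : forall t, (1 <= t)%N -> ('E_P[X t] = (m t)%:E)%E)
  (X_cov : forall t s, (1 <= t)%N -> (1 <= s)%N ->
     covariance P (X t) (X s) = (K t s)%:E)
  (eps_law : forall t, (1 <= t)%N -> has_law P (eps t) (normal_prob 0 1))
  (eps_indep : mutually_independent P [set t | (1 <= t)%N]
     (fun t => eps t : Omega -> R))
  (X_eps_indep : independent_sigma P
     (gen_sigma [set t | (1 <= t)%N] (fun t => X t : Omega -> R))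
     (gen_sigma [set t | (1 <= t)%N] (fun t => eps t : Omega -> R)))
  (Y_def : forall t w, (1 <= t)%N -> Y t w = A t * X t w + eps t w).
Local Open Scope ereal_scope.

Local Notation gir := (girsanov X eps A).
Local Notation OY n := (g_sigma_algebraType (obs_gen Y n)).
Local Notation OX := (g_sigma_algebraType (signal_gen X)).
Local Notation S0 := (fun l : nat => (A l ^+ 2)%R).
Local Notation k0 := (ckern S0 K).
Local Notation b0 w := (fun l : nat => (A l * Y l w)%R).
Local Notation mass0 n w := (cmass S0 K m (b0 w) n).
Local Notation predX n w := (cmean S0 K m (b0 w) n n.+1).
Local Notation XX := (fun t => X t : Omega -> R).

Let K_sym := gaussian_cov_sym X_cov.
Let X_mgf := gaussian_sequence_mgf X_gaussian X_mean X_cov.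
Let mX t : measurable_fun setT (X t). Proof. by []. Qed.

Let OY_sub n : obs_gen Y n `<=` measurable.
Proof. exact: (@obs_gen_sub _ _ _ _ X eps A Y Y_def n). Qed.

(** With [mu = 0] positivity is automatic: [ckern_ge0] makes the variance nonnegative as soon as the
    earlier denominators are positive. [ckern] does not involve [b], which is set to 0. *)
Lemma filter_var_pos n l : (1 <= l <= n)%N -> (0 < 1 + S0 l * k0 l.-1 l l)%R.
Proof.
elim/ltn_ind: l n => -[//|l] IH n _ /=.
rewrite ltr_pwDl //; apply: mulr_ge0; first exact: sqr_ge0.
apply: (@ckern_ge0 _ S0 K m (fun=> 0%R) K_sym _ _ P XX mX X_mgf) => j /andP[j1 jl].
by apply: (IH j _ j); rewrite ?j1 ?leqnn.
Qed.

Lemma filter_var_ge0 n : (0 <= k0 n n.+1 n.+1)%R.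
Proof.
by apply: (@ckern_ge0 _ S0 K m (fun=> 0%R) K_sym _ _ P XX mX X_mgf) => j; exact: filter_var_pos.
Qed.

Lemma mass0_gt0 n w : (0 < mass0 n w)%R.
Proof. by apply: cmass_gt0 => l; exact: filter_var_pos. Qed.

Lemma girsanov_tilt n w : (gir n w * expR (tiltw S0 (b0 w) XX n w) = 1)%R.
Proof.
rewrite /girsanov /tiltw; elim: n => [|n IH]; first by rewrite !big_geq // expR0 mulr1.
rewrite (@big_nat_recr _ _ _ n.+1) // (@big_nat_recr _ _ _ n.+1) //=.
rewrite expRD mulrACA IH mul1r /shift_density -expRD Y_def //.
by rewrite -[RHS]expR0; congr expR; field.
Qed.

Lemma adapted_mono (f : Omega -> R) s n : (s <= n)%N ->
  measurable_fun setT (f : OY s -> R) -> measurable_fun setT (f : OY n -> R).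
Proof.
move=> sn /measurable_wrtP mf; apply/measurable_wrtP.
exact: subset_trans mf (natural_filtration_mono sn).
Qed.

Lemma adapted_Y n t : (1 <= t <= n)%N -> measurable_fun setT (Y t : OY n -> R).
Proof. by move=> tn; exact: (@gen_sigma_measurable _ _ _ [set u | (1 <= u <= n)%N]). Qed.

Lemma adapted_b0 n l : (1 <= l <= n)%N -> measurable_fun setT ((fun w => b0 w l) : OY n -> R).
Proof. by move=> ln; apply: measurable_funM => //; exact: adapted_Y. Qed.

Lemma adapted_mass0 n : measurable_fun setT ((fun w => mass0 n w) : OY n -> R).
Proof. exact: (@measurable_cmass _ (OY n) R S0 K m (fun w => b0 w) n (@adapted_b0 n)). Qed.

Lemma adapted_predX n : measurable_fun setT ((fun w => predX n w) : OY n -> R).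
Proof. exact: (@measurable_cmean _ (OY n) R S0 K m (fun w => b0 w) n n.+1 (@adapted_b0 n)). Qed.

Lemma adapted_measurable n (f : Omega -> R) :
  measurable_fun setT (f : OY n -> R) -> measurable_fun setT f.
Proof. exact: measurable_from_sub. Qed.

Let signal_tiltw (S : nat -> R) n (b : Omega -> nat -> R) :
  (forall l, (1 <= l <= n)%N -> measurable_fun setT ((fun w => b w l) : OY n -> R)) ->
  measurable_fun setT ((fun z => tiltw S (b z.2) XX n z.1) : OX * OY n -> R).
Proof.
(* The guard confines [b] to the indices at which it is assumed measurable. *)
move=> mb; rewrite (_ : (fun z => _) = fun z : OX * OY n => \sum_(s <- index_iota 1 n.+1)
    (if (1 <= s <= n)%N then b z.2 s * X s z.1 - S s / 2 * X s z.1 ^+ 2 else 0))%R; last first.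
  by apply/funext => z; apply: eq_big_nat => s; rewrite ltnS => ->.
apply: measurable_sum => s; case sn : (1 <= s <= n)%N; last exact: measurable_cst.
have mXs : measurable_fun setT ((fun z => X s z.1) : OX * OY n -> R).
  apply: (measurableT_comp _ measurable_fst).
  apply: (@gen_sigma_measurable _ _ _ [set t | (1 <= t)%N] XX s) => /=.
  by case/andP: sn.
apply: measurable_funB.
  apply: measurable_funM => //; apply: (measurableT_comp (mb s sn)); exact: measurable_snd.
by apply: measurable_funM => //; exact: measurable_funX.
Qed.

(** For frozen observations the coefficients [b] are constants, and the integral over the signal is
    [tilted_mass]. *)
Lemma tilted_bayes (S : nat -> R) n (b : Omega -> nat -> R) (phi : Omega -> R) :
  (forall l, (1 <= l <= n)%N -> (0 < 1 + S l * ckern S K l.-1 l l)%R) ->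
  (forall l, (1 <= l <= n)%N -> measurable_fun setT ((fun w => b w l) : OY n -> R)) ->
  measurable_fun setT (phi : OY n -> R) -> (forall w, (0 <= phi w)%R) ->
  \int[P]_w (phi w * expR (tiltw S (b w) XX n w) * gir n w)%:E =
  \int[P]_w (phi w * cmass S K m (b w) n * gir n w)%:E.
Proof.
move=> pos mb mphi phi0.
pose Psi (z : OX * OY n) := (phi z.2 * expR (tiltw S (b z.2) XX n z.1))%:E.
pose G w := (phi w * cmass S K m (b w) n)%:E.
have := @girsanov_bayes _ _ _ P X eps A Y eps_law eps_indep X_eps_indep Y_def n Psi G.
move=> H; transitivity (\int[P]_w (Psi (w, w) * (gir n w)%:E)).
  by apply: eq_integral => w _; rewrite -EFinM.
rewrite H; first by apply: eq_integral => w _; rewrite -EFinM.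
- apply/measurable_EFinP; apply: measurable_funM.
    exact: (measurableT_comp mphi measurable_snd).
  by apply: measurableT_comp => //; exact: signal_tiltw.
- by move=> z; rewrite lee_fin mulr_ge0 ?expR_ge0.
- apply/measurable_EFinP; apply: (@adapted_measurable n).
  by apply: measurable_funM => //; exact: (@measurable_cmass _ (OY n) R S K m b n mb).
- move=> w2; rewrite /Psi /G /=; under eq_integral do rewrite EFinM.
  rewrite ge0_integralZl_EFin //; last first.
    apply/measurable_EFinP; apply: measurableT_comp => //; exact: measurable_tiltw.
  by rewrite (tilted_mass (b w2) K_sym mX X_mgf pos) EFinM.
Qed.

(** In other words, the conditional expectation of [gir n] given the observations is the inverse of
    [mass0 n]. This is [tilted_bayes] for [mu = 0], where the tilt cancels [gir n]. *)
Lemma filter_bayes n (psi : Omega -> R) :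
  measurable_fun setT (psi : OY n -> R) -> (forall w, (0 <= psi w)%R) ->
  \int[P]_w (psi w)%:E = \int[P]_w (psi w * mass0 n w * gir n w)%:E.
Proof.
move=> mpsi psi0.
rewrite -(@tilted_bayes S0 n (fun w => b0 w)) //; last 2 first.
- by move=> l; exact: filter_var_pos.
- exact: adapted_b0.
by apply: eq_integral => w _; rewrite -mulrA [(expR _ * _)%R]mulrC girsanov_tilt mulr1.
Qed.

(** Conditional mean and variance of [X n.+1] are both encoded in a nonnegative integrand, so
    integrability is not an issue: [c = predX] gives the variance, and [c = predX - 1] then gives
    the mean. *)
Lemma filter_second_moment n (phi c : Omega -> R) :
  measurable_fun setT (phi : OY n -> R) -> (forall w, (0 <= phi w)%R) ->
  measurable_fun setT (c : OY n -> R) ->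
  \int[P]_w (phi w * (X n.+1 w - c w) ^+ 2)%:E =
  \int[P]_w (phi w * (k0 n n.+1 n.+1 + (predX n w - c w) ^+ 2))%:E.
Proof.
move=> mphi phi0 mc.
pose Psi (z : OX * OY n) := (phi z.2 * (expR (tiltw S0 (b0 z.2) XX n z.1) *
  (X n.+1 z.1 - c z.2) ^+ 2))%:E.
pose g w := (phi w * (k0 n n.+1 n.+1 + (predX n w - c w) ^+ 2))%R.
pose G w := (phi w * (mass0 n w * (k0 n n.+1 n.+1 + (predX n w - c w) ^+ 2)))%:E.
have sq0 (x y : R) : (0 <= x)%R -> (0 <= x * y ^+ 2)%R.
  by move=> x0; rewrite mulr_ge0 // sqr_ge0.
have mg : measurable_fun setT (g : OY n -> R).
  apply: measurable_funM => //; apply: measurable_funD => //; apply: measurable_funX.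
  by apply: measurable_funB => //; exact: adapted_predX.
have g0 w : (0 <= g w)%R by rewrite mulr_ge0 // addr_ge0 ?filter_var_ge0 ?sqr_ge0.
rewrite (filter_bayes mg g0).
transitivity (\int[P]_w (Psi (w, w) * (gir n w)%:E)).
  apply: eq_integral => w _; rewrite -EFinM /=; congr EFin.
  by rewrite -[LHS]mul1r -(girsanov_tilt n w); ring.
transitivity (\int[P]_w (G w * (gir n w)%:E)); last first.
  by apply: eq_integral => w _; rewrite -EFinM /g; congr EFin; ring.
apply: (girsanov_bayes eps_law eps_indep X_eps_indep Y_def).
- apply/measurable_EFinP; apply: measurable_funM.
    exact: (measurableT_comp mphi measurable_snd).
  apply: measurable_funM.
    apply: measurableT_comp => //; apply: (@signal_tiltw S0 n (fun w => b0 w)) => l.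
    exact: adapted_b0.
  apply: measurable_funX; apply: measurable_funB.
    apply: (measurableT_comp _ measurable_fst).
    exact: (@gen_sigma_measurable _ _ _ [set t | (1 <= t)%N] XX n.+1).
  exact: (measurableT_comp mc measurable_snd).
- by move=> z; rewrite lee_fin mulr_ge0 // sq0 // expR_ge0.
- apply/measurable_EFinP; apply: (@adapted_measurable n).
  rewrite (_ : (fun w => _) = (fun w => mass0 n w * g w)%R); last first.
    by apply/funext => w; rewrite /g; ring.
  by apply: measurable_funM => //; exact: adapted_mass0.
- move=> w2; rewrite /Psi /G /=; under eq_integral do rewrite EFinM.
  have mt : measurable_fun setT (fun w => expR (tiltw S0 (b0 w2) XX n w)).
    by apply: measurableT_comp => //; exact: measurable_tiltw.
  have pos l : (1 <= l <= n)%N -> (0 < 1 + S0 l * k0 l.-1 l l)%R by exact: filter_var_pos.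
  rewrite ge0_integralZl_EFin //; last 2 first.
  + by move=> w _; rewrite lee_fin sq0 // expR_ge0.
  + apply/measurable_EFinP; apply: measurable_funM => //; apply: measurable_funX.
    exact: measurable_funB.
  rewrite (gaussian_second_moment mt (mX _) (fun=> expR_ge0 _)
    (mass0_gt0 n w2) (tilted_mgf (b0 w2) K_sym mX X_mgf pos)).
  by rewrite -EFinM.
Qed.

Lemma integral_indicM (D : set Omega) (f : Omega -> R) :
  \int[P]_(w in D) (f w)%:E = \int[P]_w (\1_D w * f w)%:E.
Proof.
rewrite integral_mkcond; apply: eq_integral => w _.
by rewrite patchE indicE; case: ifP => _; rewrite ?mul1r ?mul0r.
Qed.

Lemma adapted_indic n (D : set Omega) : <<s obs_gen Y n >> D ->
  measurable_fun setT (\1_D : OY n -> R).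
Proof. exact: measurable_sub_indic. Qed.

Let err n w := (X n.+1 w - predX n w)%R.

Let merr n : measurable_fun setT (err n).
Proof.
by apply: measurable_funB => //; apply: (@adapted_measurable n); exact: adapted_predX.
Qed.

Lemma filter_error_variance n :
  \int[P]_w ((X n.+1 w - predX n w) ^+ 2)%:E = (k0 n n.+1 n.+1)%:E.
Proof.
have := @filter_second_moment n (cst 1%R) (fun w => predX n w) (measurable_cst _)
  (fun=> ler01) (@adapted_predX n).
under eq_integral do rewrite mul1r.
move=> ->; under eq_integral do rewrite mul1r subrr expr0n /= addr0.
by rewrite integral_cst //= probability_setT mule1.
Qed.

Let ierr2 n : P.-integrable setT (fun w => (err n w ^+ 2)%:E).
Proof.
apply/integrableP; split; first by apply/measurable_EFinP; exact: measurable_funX.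
under eq_integral do rewrite /= ger0_norm ?sqr_ge0 //.
by rewrite filter_error_variance ltry.
Qed.

Let ierr n : P.-integrable setT (fun w => (err n w)%:E).
Proof.
apply: (@le_integrable _ _ _ P setT measurableT _ (fun w => (1 + err n w ^+ 2)%:E)).
- exact/measurable_EFinP.
- move=> w _; rewrite !abse_EFin lee_fin [leRHS]ger0_norm ?addr_ge0 ?sqr_ge0 //.
  rewrite -(real_normK (num_real (err n w))).
  by move: `|err n w|%R => t; have := sqr_ge0 (t - 2^-1)%R; rewrite sqrrB; lra.
- under eq_fun do rewrite EFinD.
  by apply: integrableD => //; exact: finite_measure_integrable_cst.
Qed.

Let iX n : P.-integrable setT (fun w => (X n.+1 w)%:E).
Proof. exact: (gaussian_sequence_integrable X_gaussian). Qed.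

Lemma integrable_predX n : P.-integrable setT (fun w => (predX n w)%:E).
Proof.
apply: (eq_integrable _ (fun w => (X n.+1 w)%:E - (err n w)%:E)) => //.
  by move=> w _; rewrite -EFinB /err; congr EFin; ring.
exact: integrableB.
Qed.

(* Compares the second moments of [X n.+1] about [predX n] and [predX n - 1]. *)
Lemma filter_error_mean0 n D : <<s obs_gen Y n >> D ->
  \int[P]_w (\1_D w * (X n.+1 w - predX n w))%:E = 0.
Proof.
move=> sD; have mD : measurable D by exact: (sub_sigma_measurable (@OY_sub n)).
have D0 w : (0 <= \1_D w :> R)%R by [].
have mDR : measurable_fun setT (\1_D : Omega -> R) by exact: measurable_indic.
have iD (f : Omega -> R) : P.-integrable setT (EFin \o f) ->
    P.-integrable setT (fun w => (\1_D w * f w)%:E).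
  move=> fi; apply: (@le_integrable _ _ _ P setT measurableT _ (EFin \o f)) => //.
    apply/measurable_EFinP/measurable_funM => //; apply/measurable_EFinP.
    exact: (measurable_int P).
  move=> w _; rewrite /= lee_fin normrM ler_piMl //.
  by rewrite indicE; case: (_ \in _); rewrite ?normr1 ?normr0.
have i1 : P.-integrable setT (EFin \o cst 1%R) by exact: finite_measure_integrable_cst.
have iDe := iD _ (ierr n); have iD1 := iD _ i1.
have iDe2 := iD (fun w => err n w ^+ 2)%R (ierr2 n).
have iDk : P.-integrable setT (fun w => (\1_D w * k0 n n.+1 n.+1)%:E).
  by apply: (iD (cst (k0 n n.+1 n.+1))); exact: finite_measure_integrable_cst.
have E0 := @filter_second_moment n (\1_D) (fun w => predX n w)
  (adapted_indic sD) D0 (@adapted_predX n).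
have m1 : measurable_fun setT ((fun w => predX n w - 1)%R : OY n -> R).
  by apply: measurable_funB => //; exact: adapted_predX.
have E1 := @filter_second_moment n (\1_D) _ (adapted_indic sD) D0 m1.
move: E1.
have -> : \int[P]_w (\1_D w * (X n.+1 w - (predX n w - 1)) ^+ 2)%:E =
  \int[P]_w (\1_D w * err n w ^+ 2)%:E + (2%:E * \int[P]_w (\1_D w * err n w)%:E +
     \int[P]_w (\1_D w * cst 1%R w)%:E).
  rewrite -integralZl //.
  rewrite -integralD //; last exact: integrableZl.
  rewrite -integralD //; last by apply: integrableD => //; exact: integrableZl.
  by apply: eq_integral => w _; rewrite -EFinM -!EFinD /err /cst; congr EFin; ring.
rewrite [X in X + _ = _](_ : _ = \int[P]_w (\1_D w * (k0 n n.+1 n.+1))%:E); last first.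
  by rewrite E0; apply: eq_integral => w _; rewrite subrr expr0n /= addr0.
have -> : \int[P]_w (\1_D w * (k0 n n.+1 n.+1 + (predX n w - (predX n w - 1)) ^+ 2))%:E =
   \int[P]_w (\1_D w * (k0 n n.+1 n.+1))%:E + \int[P]_w (\1_D w * cst 1%R w)%:E.
  rewrite -integralD //.
  by apply: eq_integral => w _; rewrite -EFinD /cst; congr EFin; ring.
have f1 : \int[P]_w (\1_D w * k0 n n.+1 n.+1)%:E \is a fin_num by exact: integrable_fin_num.
have f2 : \int[P]_w (\1_D w * cst 1%R w)%:E \is a fin_num by exact: integrable_fin_num.
have f3 : \int[P]_w (\1_D w * err n w)%:E \is a fin_num by exact: integrable_fin_num.
rewrite -(fineK f1) -(fineK f2) -(fineK f3) -EFinM -!EFinD => -[h]; congr EFin.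
by move: h; lra.
Qed.

Lemma filter_prediction n D : <<s obs_gen Y n >> D ->
  \int[P]_(w in D) (X n.+1 w)%:E = \int[P]_(w in D) (predX n w)%:E.
Proof.
move=> sD; have mD : measurable D by exact: (sub_sigma_measurable (@OY_sub n)).
have -> : \int[P]_(w in D) (X n.+1 w)%:E =
    \int[P]_(w in D) ((predX n w)%:E + (err n w)%:E).
  by apply: eq_integral => w _; rewrite -EFinD /err; congr EFin; ring.
rewrite integralD //; last 2 first.
- exact: integrableS (integrable_predX n).
- exact: integrableS (ierr n).
by rewrite [X in _ + X]integral_indicM filter_error_mean0 // adde0.
Qed.

Lemma prediction_ae n (p : Omega -> R) :
  is_cond_exp P (natural_filtration Y n) (EFin \o X n.+1) (EFin \o p) ->
  {ae P, forall w, p w = predX n w}.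
Proof.
move=> [/measurable_wrtP mp pE].
have := @eq_sub_integral_ae _ _ _ P _ (@OY_sub n) (EFin \o p) (fun w => predX n w) mp
  (@adapted_predX n).
have H D : <<s obs_gen Y n >> D ->
    \int[P]_(w in D) (EFin \o p) w = \int[P]_(w in D) (predX n w)%:E.
  by move=> sD; rewrite pE // -filter_prediction.
move=> /(_ H) [N [mN N0 HN]]; exists N; split => // w /= Hw; apply: HN => /= Hw'.
by apply: Hw; case: Hw'.
Qed.

(** * Likelihood ratios and the martingale property *)

Section likelihood.
Variables (Z : nat -> Omega -> R) (gb : nat -> R).
Hypotheses (Z_adapted : forall n, measurable_fun setT (Z n.+1 : OY n -> R))
  (gb_ge0 : forall t, (1 <= t)%N -> (0 <= gb t)%R).

(* Ratio at [y] of the densities of [N(A t * z, 1 + A t ^+ 2 * gb t)] and [N(0, 1)]. *)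
Let ratio t (z y : R) : R := ((Num.sqrt (1 + A t ^+ 2 * gb t))^-1 *
  expR ((z * (A t * y) + (A t * y) ^+ 2 / 2 * gb t - A t ^+ 2 / 2 * z ^+ 2) /
        (1 + A t ^+ 2 * gb t)))%R.

Definition likelihood n w : R := (\prod_(1 <= t < n.+1)
  ((Num.sqrt (1 + A t ^+ 2 * gb t))^-1 *
   expR ((Z t w * (A t * Y t w) + (A t * Y t w) ^+ 2 / 2 * gb t - A t ^+ 2 / 2 * Z t w ^+ 2) /
        (1 + A t ^+ 2 * gb t))))%R.

Let likelihoodS n w : (likelihood n.+1 w = likelihood n w * ratio n.+1 (Z n.+1 w) (Y n.+1 w))%R.
Proof. by rewrite /likelihood big_nat_recr. Qed.

Lemma likelihood_ge0 n w : (0 <= likelihood n w)%R.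
Proof. by apply: prodr_ge0 => t _; rewrite mulr_ge0 ?expR_ge0 // invr_ge0. Qed.

(** The integrand turns N(0, 1) into another normal law. In [normal01_expR_sqr] the quadratic
    coefficient is [A t ^+ 2 * gb t / v], whose complement to 1 is [v^-1]. *)
Let ratio_mass t z : (1 <= t)%N -> \int[normal_prob 0 1]_y (ratio t z y)%:E = 1.
Proof.
move=> t1; set v := (1 + A t ^+ 2 * gb t)%R.
have v0 : (0 < v)%R.
  by rewrite ltr_pwDl //; apply: mulr_ge0; [exact: sqr_ge0|exact: gb_ge0].
transitivity (\int[normal_prob 0 1]_y
   (((Num.sqrt v)^-1 * expR (- (A t ^+ 2 / 2 * z ^+ 2) / v))%:E *
    (expR (A t * z / v * y + A t ^+ 2 * gb t / v / 2 * y ^+ 2))%:E)).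
  have E (p u u' : R) : (p * expR u * expR u' = p * expR (u + u'))%R by rewrite expRD mulrA.
  apply: eq_integral => y _; rewrite -EFinM E /ratio -/v.
  by congr (_ * expR _)%:E; field; exact: lt0r_neq0.
rewrite ge0_integralZl_EFin //; last first.
  apply/measurable_EFinP; apply: measurableT_comp => //; apply: measurable_funD.
    exact: measurable_funM.
  by apply: measurable_funM => //; exact: measurable_funX.
have E1 : (1 - A t ^+ 2 * gb t / v = v^-1)%R.
  by rewrite -[X in (X - _)%R](mulfV (lt0r_neq0 v0)) -mulrBl /v addrK mul1r.
rewrite normal01_expR_sqr; last by rewrite -subr_gt0 E1 invr_gt0.
rewrite E1 -EFinM sqrtrV ?(ltW v0) // invrK; congr EFin.
have E (s u u' : R) : (s != 0 -> s^-1 * expR u * (s * expR u') = expR (u + u'))%R.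
  by move=> s0; rewrite expRD; field.
rewrite E ?lt0r_neq0 ?sqrtr_gt0 // -[RHS]expR0; congr expR.
by field; exact: lt0r_neq0.
Qed.

Lemma adapted_likelihood n : measurable_fun setT (likelihood n : OY n -> R).
Proof.
elim: n => [|n IH].
  rewrite (_ : likelihood 0%N = cst 1%R) //.
  by apply/funext => w; rewrite /likelihood big_geq.
rewrite (_ : likelihood n.+1 =
    fun w => likelihood n w * ratio n.+1 (Z n.+1 w) (Y n.+1 w))%R; last first.
  by apply/funext => w; exact: likelihoodS.
have mZ := adapted_mono (leqnSn n) (@Z_adapted n).
have mYn : measurable_fun setT (Y n.+1 : OY n.+1 -> R) by apply: adapted_Y; rewrite leqnn.
apply: measurable_funM; first exact: adapted_mono (leqnSn n) IH.
have mAY : measurable_fun setT ((fun w => A n.+1 * Y n.+1 w)%R : OY n.+1 -> R).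
  exact: measurable_funM.
apply: measurable_funM => //; apply: measurableT_comp => //; apply: measurable_funM => //.
apply: measurable_funB; last by apply: measurable_funM => //; exact: measurable_funX.
apply: measurable_funD; first exact: measurable_funM.
by do 2 apply: measurable_funM => //; exact: measurable_funX.
Qed.

Let past_of_obs n (f : Omega -> R) : measurable_fun setT (f : OY n -> R) ->
  measurable_fun setT (f : g_sigma_algebraType (past_gen X eps n) -> R).
Proof.
move=> /measurable_wrtP mf; apply/measurable_wrtP.
exact: subset_trans mf (obs_past Y_def (n := n)).
Qed.

(** [Z n.+1] is known at time [n] and [Y n.+1] is standard normal after the change of measure, so
    the new factor integrates to 1 by [ratio_mass]. *)
Lemma likelihood_step n D : <<s obs_gen Y n >> D ->
  \int[P]_w (\1_D w * likelihood n.+1 w * gir n.+1 w)%:E =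
  \int[P]_w (\1_D w * likelihood n w * gir n w)%:E.
Proof.
move=> sD.
pose H := g_sigma_algebraType (past_gen X eps n).
pose Psi (z : H * measurableTypeR R) :=
  (\1_D z.1 * likelihood n z.1 * gir n z.1 * ratio n.+1 (Z n.+1 z.1) z.2)%:E.
have mz2 : measurable_fun setT (fun z : H * measurableTypeR R => z.2 : R).
  exact: measurable_snd.
have mf : measurable_fun setT ((fun w => \1_D w * likelihood n w * gir n w)%R : H -> R).
  apply: measurable_funM; last exact: past_girsanov.
  apply: past_of_obs; apply: measurable_funM; first exact: adapted_indic.
  exact: adapted_likelihood.
have mZ : measurable_fun setT (fun z : H * measurableTypeR R => Z n.+1 z.1).
  exact: (measurableT_comp (past_of_obs (@Z_adapted n)) measurable_fst).
have ratio0 t z y : (0 <= ratio t z y)%R by rewrite mulr_ge0 ?expR_ge0 // invr_ge0.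
have f0 w : (0 <= \1_D w * likelihood n w * gir n w)%R.
  by rewrite !mulr_ge0 ?likelihood_ge0 ?girsanov_ge0.
transitivity (\int[P]_w (Psi (w, Y n.+1 w) * (shift_density X eps A n.+1 w)%:E)).
  by apply: eq_integral => w _; rewrite -EFinM /= likelihoodS girsanovS; congr EFin; ring.
rewrite (girsanov_step eps_law eps_indep X_eps_indep Y_def); last 2 first.
- apply/measurable_EFinP; apply: measurable_funM.
    exact: (measurableT_comp mf measurable_fst).
  apply: measurable_funM => //; apply: measurableT_comp => //; apply: measurable_funM => //.
  have mAy : measurable_fun setT (fun z : H * measurableTypeR R => A n.+1 * z.2)%R.
    exact: measurable_funM.
  apply: measurable_funB; last by apply: measurable_funM => //; exact: measurable_funX.
  apply: measurable_funD; first exact: measurable_funM.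
  by do 2 apply: measurable_funM => //; exact: measurable_funX.
- by move=> z; rewrite lee_fin mulr_ge0.
apply: eq_integral => w _; rewrite /Psi /=; under eq_integral do rewrite EFinM.
rewrite ge0_integralZl_EFin //; first by rewrite ratio_mass // mule1.
- by move=> y _; rewrite lee_fin.
- apply/measurable_EFinP.
  apply: measurable_funM => //; apply: measurableT_comp => //; apply: measurable_funM => //.
  have mAy : measurable_fun setT (fun y : measurableTypeR R => A n.+1 * y)%R.
    exact: measurable_funM.
  apply: measurable_funB => //.
  apply: measurable_funD; first exact: measurable_funM.
  by do 2 apply: measurable_funM => //; exact: measurable_funX.
Qed.

Definition lik_ratio n w : R := (likelihood n w / mass0 n w)%R.

Lemma lik_ratio_ge0 n w : (0 <= lik_ratio n w)%R.
Proof. by rewrite divr_ge0 ?likelihood_ge0 // ltW // mass0_gt0. Qed.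

Lemma adapted_lik_ratio n : measurable_fun setT (lik_ratio n : OY n -> R).
Proof.
apply: measurable_funM; first exact: adapted_likelihood.
by apply: measurable_inv_ge0; [exact: adapted_mass0|move=> w; exact/ltW/mass0_gt0].
Qed.

(** [filter_bayes] brings in [mass0 n], which cancels the denominator of [lik_ratio n]. *)
Lemma lik_ratioE n D : <<s obs_gen Y n >> D ->
  \int[P]_(w in D) (lik_ratio n w)%:E = \int[P]_w (\1_D w * likelihood n w * gir n w)%:E.
Proof.
move=> sD; rewrite integral_indicM (@filter_bayes n).
- apply: eq_integral => w _; rewrite /lik_ratio; congr EFin.
  by field; exact: lt0r_neq0 (mass0_gt0 n w).
- by apply: measurable_funM; [exact: adapted_indic|exact: adapted_lik_ratio].
- by move=> w; rewrite mulr_ge0 // lik_ratio_ge0.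
Qed.

Lemma lik_ratio_martingale s n D : (s <= n)%N -> <<s obs_gen Y s >> D ->
  \int[P]_(w in D) (lik_ratio n w)%:E = \int[P]_(w in D) (lik_ratio s w)%:E.
Proof.
move=> + sD; elim: n => [|n IH]; first by rewrite leqn0 => /eqP ->.
rewrite leq_eqVlt => /predU1P[->//|sn]; rewrite -IH //.
have snD : <<s obs_gen Y n >> D by exact: (natural_filtration_mono (sn : (s <= n)%N)).
have snD' : <<s obs_gen Y n.+1 >> D.
  exact: (natural_filtration_mono (leqnSn n)).
by rewrite !lik_ratioE // likelihood_step.
Qed.

Lemma integrable_lik_ratio n : P.-integrable setT (EFin \o lik_ratio n).
Proof.
have mr := adapted_measurable (@adapted_lik_ratio n).
apply/integrableP; split; first exact/measurable_EFinP.
under eq_integral do rewrite /= ger0_norm ?lik_ratio_ge0 //.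
(* At time 0 both products are empty and the ratio is 1. *)
rewrite (@lik_ratio_martingale 0%N n) //; last exact: (@measurableT _ (OY 0%N)).
rewrite (_ : \int[P]_w _ = \int[P]_w (cst 1 w)); last first.
  by apply: eq_integral => w _; rewrite /lik_ratio /likelihood /cmass !big_geq // divr1.
by rewrite integral_cst //= mul1e probability_setT ltry.
Qed.

End likelihood.

End linear_filter.

(** * Representation of the conditional expectation *)

Theorem proposition2 (R : realType) (d : measure_display)
  (Omega : measurableType d) (P : probability Omega R)
  (X eps : nat -> {RV P >-> R})
  (m : nat -> R) (K : nat -> nat -> R)
  (A Q : nat -> R) (mu : R)
  (Y h Z pi nu M : nat -> Omega -> R)
  (gammabar : nat -> nat -> R) (gamma : nat -> R)
  (* the Gaussian signal, its mean and covariance *)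
  (X_gaussian : gaussian_sequence P (fun t => X t : Omega -> R))
  (X_mean : forall t, (1 <= t)%N -> ('E_P[X t] = (m t)%:E)%E)
  (X_cov : forall t s, (1 <= t)%N -> (1 <= s)%N ->
     covariance P (X t) (X s) = (K t s)%:E)
  (* the i.i.d. N(0,1) noise, independent of the signal *)
  (eps_law : forall t, (1 <= t)%N -> has_law P (eps t) (normal_prob 0 1))
  (eps_indep : mutually_independent P [set t | (1 <= t)%N]
     (fun t => eps t : Omega -> R))
  (X_eps_indep : independent_sigma P
     (gen_sigma [set t | (1 <= t)%N] (fun t => X t : Omega -> R))
     (gen_sigma [set t | (1 <= t)%N] (fun t => eps t : Omega -> R)))
  (* the observations *)
  (Y_def : forall t w, (1 <= t)%N -> Y t w = A t * X t w + eps t w)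
  (Q_ge0 : forall t, (1 <= t)%N -> 0 <= Q t)
  (C_mu : condition_C mu A Q K)
  (gammabar_sol : forall t s, (1 <= s <= t)%N -> gammabar_eq mu A Q K gammabar t s)
  (h_adapted : forall t, (1 <= t)%N ->
     measurable_wrt (natural_filtration Y t) (h t))
  (Z_def : forall t w, (1 <= t)%N ->
     Z t w = m t
       - \sum_(1 <= l < t) gammabar t l
           * (mu * Q l / (1 + S_coef mu A Q l * gammabar l l))
           * (h l w - Z l w)
       + \sum_(1 <= l < t) gammabar t l
           * (A l / (1 + S_coef mu A Q l * gammabar l l))
           * (Y l w - A l * Z l w))
  (* pi t is (any version of) the one-step prediction E(X_t / Y_{t-1}) *)
  (pi_def : forall t, (1 <= t)%N ->
     is_cond_exp P (natural_filtration Y t.-1) (EFin \o X t) (EFin \o pi t))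
  (nu_def : forall t w, (1 <= t)%N -> nu t w = Y t w - A t * pi t w)
  (gamma_def : forall t, (1 <= t)%N ->
     ('E_P[fun w => ((X t w - pi t w) ^+ 2)%R] = (gamma t)%:E)%E)
  (M_def : forall T w, (1 <= T)%N ->
     M T w = \prod_(1 <= t < T.+1)
       (((1 + A t ^+ 2 * gamma t) / (1 + A t ^+ 2 * gammabar t t)) `^ (2^-1)
        * expR (A t / (1 + A t ^+ 2 * gammabar t t)
                  * (Z t w - pi t w) * nu t w
                - 2^-1 * (A t ^+ 2 / (1 + A t ^+ 2 * gammabar t t))
                  * (Z t w - pi t w) ^+ 2
                - 2^-1 * (A t ^+ 2 * (gamma t - gammabar t t) * nu t w ^+ 2
                  / ((1 + A t ^+ 2 * gammabar t t)
                     * (1 + A t ^+ 2 * gamma t)))))) :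
  is_martingale P (natural_filtration Y) M /\
  forall T, (1 <= T)%N ->
    let isI := is_cond_exp P (natural_filtration Y T)
      (fun w => (expR (mu / 2 *
         \sum_(1 <= s < T.+1) (X s w - h s w) ^+ 2 * Q s))%:E) in
    (exists I : Omega -> \bar R, isI I) /\
    forall I : Omega -> \bar R, isI I ->
      {ae P, forall w, I w =
        ((\prod_(1 <= t < T.+1)
           (((1 + S_coef mu A Q t * gammabar t t)
             / (1 + A t ^+ 2 * gammabar t t)) `^ (- 2^-1)
            * expR (mu / 2 * Q t
                    * ((1 + A t ^+ 2 * gammabar t t)
                       / (1 + S_coef mu A Q t * gammabar t t))
                    * (h t w - (Z t w + A t * gammabar t t * Y t w)
                               / (1 + A t ^+ 2 * gammabar t t)) ^+ 2)))
         * M T w)%:E}.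
Proof.
pose Scf := S_coef mu A Q.
pose b (w : Omega) (l : nat) : R := A l * Y l w - mu * Q l * h l w.
pose gb t := gammabar t t.
pose k0 := ckern (fun l => A l ^+ 2) K.
pose mass0 n w := cmass (fun l => A l ^+ 2) K m (fun l => A l * Y l w) n.
pose predX n w := cmean (fun l => A l ^+ 2) K m (fun l => A l * Y l w) n n.+1.
have gb_pos t : (1 <= t)%N -> 0 <= gb t /\ 0 < 1 + Scf t * gb t.
  (* [gammabar] solves the equation up to [t], so uniqueness in the condition carries the sign
     conditions over to it. *)
  move=> t1; have [g [_ uniq _ pos]] := C_mu _ t1.
  have -> : gb t = g t t.
    by apply: uniq; rewrite ?t1 ?leqnn // => i j ij _; exact: gammabar_sol.
  by apply: pos; rewrite t1 leqnn.
have gbE t s : (1 <= s <= t)%N -> gammabar t s = ckern Scf K s.-1 t s.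
  move=> st; apply: (@solution_ckern _ Scf K t) => // i j ij _; exact: gammabar_sol.
have gb_ge0 t : (1 <= t)%N -> 0 <= gb t by move=> /gb_pos[].
have pos n l : (1 <= l <= n)%N -> 0 < 1 + Scf l * ckern Scf K l.-1 l l.
  by move=> /andP[l1 _]; rewrite -gbE ?l1 ?leqnn //; have [] := gb_pos _ l1.
have ZE t w : (1 <= t)%N -> Z t w = cmean Scf K m (b w) t.-1 t.
  move=> t1; apply: (@solution_cmean _ Scf K m (b w) (fun t => Z t w)) => // {}t {}t1.
  (* The two gains combine: [- mu * Q l * (h l - Z l) + A l * (Y l - A l * Z l) = b l - S l * Z
     l]. *)
  rewrite Z_def // -addrA; congr (_ + _); rewrite addrC -sumrB.
  apply: eq_big_nat => l /andP[l1 lt].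
  by rewrite -!gbE ?l1 ?leqnn ?(ltnW lt) // /b /Scf /S_coef; ring.
have mY n t : (1 <= t <= n)%N ->
    measurable_fun setT (Y t : g_sigma_algebraType (obs_gen Y n) -> R).
  by move=> tn; exact: adapted_Y.
have mh n t : (1 <= t <= n)%N ->
    measurable_fun setT (h t : g_sigma_algebraType (obs_gen Y n) -> R).
  move=> /andP[t1 tn]; apply: (adapted_mono tn); apply/measurable_wrtP; exact: h_adapted.
have mb n l : (1 <= l <= n)%N ->
    measurable_fun setT ((fun w => b w l) : g_sigma_algebraType (obs_gen Y n) -> R).
  move=> ln; apply: measurable_funB; apply: measurable_funM => //.
    exact: mY.
  exact: mh.
have mZ n : measurable_fun setT (Z n.+1 : g_sigma_algebraType (obs_gen Y n) -> R).
  rewrite (_ : Z n.+1 = fun w => cmean Scf K m (b w) n n.+1); last first.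
    by apply/funext => w; rewrite ZE.
  by apply: (@measurable_cmean _ (g_sigma_algebraType (obs_gen Y n))); exact: mb.
have mpi n : measurable_fun setT (pi n.+1 : g_sigma_algebraType (obs_gen Y n) -> R).
  have [/measurable_wrtP mp _] := pi_def _ (ltn0Sn n).
  exact/measurable_EFinP.
have OY_sub n : obs_gen Y n `<=` measurable := obs_gen_sub Y_def (n := n).
have piE : {ae P, forall w n, pi n.+1 w = predX n w}.
  apply: ae_foralln => n.
  exact: (prediction_ae X_gaussian X_mean X_cov eps_law eps_indep X_eps_indep Y_def
    (pi_def _ (ltn0Sn n))).
(* [pi] and [predX] differ only on a null set, so [gamma], being an integral, equals the filter
   variance exactly. *)
have gammaE n : gamma n.+1 = k0 n n.+1 n.+1.
  apply: EFin_inj; rewrite -gamma_def // unlock.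
  rewrite -(filter_error_variance X_gaussian X_mean X_cov eps_law eps_indep X_eps_indep Y_def).
  have mp := measurable_from_sub (@OY_sub n) (mpi n).
  have mq : measurable_fun setT (predX n).
    apply: (measurable_from_sub (@OY_sub n)).
    exact: adapted_predX.
  apply: ae_eq_integral => //.
  - apply/measurable_EFinP; apply: measurable_funX; exact: measurable_funB.
  - apply/measurable_EFinP; apply: measurable_funX; exact: measurable_funB.
  - case: piE => N [mN N0 HN]; exists N; split => // w /= Hw; apply: HN => /= Hw'.
    by apply: Hw => _; rewrite Hw'.
pose lik := likelihood A Y Z gb.
pose N := lik_ratio m K A Y Z gb.
have mass0_gt0 n w : 0 < mass0 n w by exact: (mass0_gt0 A Y X_gaussian X_mean X_cov).
have g0_ge0 n : 0 <= k0 n n.+1 n.+1 by exact: (filter_var_ge0 A X_gaussian X_mean X_cov).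
(* Where [pi] equals [predX], multiplying [M T] by [mass0 T] gives [lik T] factor by factor. *)
have MN T w : (1 <= T)%N -> (forall n, pi n.+1 w = predX n w) -> M T w = N T w.
  move=> T1 piw; rewrite /N /lik_ratio; apply: (canRL (mulfK (lt0r_neq0 (mass0_gt0 T w)))).
  rewrite M_def // /cmass /likelihood -big_split /=; apply: eq_big_nat => -[//|t] _ /=.
  rewrite nu_def // piw gammaE; apply: likelihood_term; last exact: g0_ge0.
  exact: gb_ge0.
have {}MN T : (1 <= T)%N -> {ae P, forall w, M T w = N T w}.
  move=> T1; case: piE => B [mB B0 HB]; exists B; split => // w /= Hw; apply: HB => /= Hw'.
  by apply: Hw; exact: MN.
(* [M T] agrees with [N T] only almost surely and the filtration is not completed, so measurability
   is read off the formula for [M T]. *)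
have mM T : (1 <= T)%N -> measurable_fun setT (M T : g_sigma_algebraType (obs_gen Y T) -> R).
  move=> T1; rewrite (_ : M T = fun w => M T w) //; under eq_fun do rewrite M_def //.
  apply: measurable_prod => -[|t]; rewrite mem_index_iota // => /andP[_]; rewrite ltnS => tT.
  have mpt := adapted_mono (ltnW tT) (mpi t); have mZt := adapted_mono (ltnW tT) (mZ t).
  have mYt : measurable_fun setT (Y t.+1 : g_sigma_algebraType (obs_gen Y T) -> R).
    exact: mY.
  have mnu : measurable_fun setT (nu t.+1 : g_sigma_algebraType (obs_gen Y T) -> R).
    rewrite (_ : nu t.+1 = fun w => Y t.+1 w - A t.+1 * pi t.+1 w).
      by apply: measurable_funB => //; exact: measurable_funM.
    by apply/funext => w; exact: nu_def.
  have mZp : measurable_fun setT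
      ((fun w => Z t.+1 w - pi t.+1 w) : g_sigma_algebraType (obs_gen Y T) -> R).
    exact: measurable_funB.
  apply: measurable_funM => //; apply: measurableT_comp => //; apply: measurable_funB.
    apply: measurable_funB.
      by apply: measurable_funM => //; exact: measurable_funM.
    by apply: measurable_funM => //; exact: measurable_funX.
  do 3 apply: measurable_funM => //; exact: measurable_funX.
have mNT T : measurable_fun setT (N T : g_sigma_algebraType (obs_gen Y T) -> R).
  exact: (adapted_lik_ratio A X_gaussian X_mean X_cov gb mZ).
have intMN T D : (1 <= T)%N -> measurable D ->
    (\int[P]_(w in D) (M T w)%:E = \int[P]_(w in D) (N T w)%:E)%E.
  move=> T1 mD; apply: ae_eq_integral => //.
  - by apply: measurable_funTS; apply/measurable_EFinP; exact: measurable_from_sub (mM T T1).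
  - by apply: measurable_funTS; apply/measurable_EFinP; exact: measurable_from_sub (mNT T).
  - have [B [mB B0 HB]] := MN _ T1; exists B; split => // w /= Hw; apply: HB => /= Hw'.
    by apply: Hw => _; rewrite Hw'.
split.
  split=> [t t1|t t1|s t /andP[s1 st]].
  - by apply/measurable_wrtP; exact: mM.
  - have iN := integrable_lik_ratio X_gaussian X_mean X_cov eps_law eps_indep X_eps_indep
      Y_def mZ gb_ge0 t.
    apply/integrableP; split.
      by apply/measurable_EFinP; exact: measurable_from_sub (mM t t1).
    have /integrableP[_] := iN; apply: le_lt_trans.
    rewrite le_eqVlt; apply/orP; left; apply/eqP; apply: ae_eq_integral => //.
    + apply: measurableT_comp => //; apply/measurable_EFinP.
      exact: measurable_from_sub (mM t t1).
    + apply: measurableT_comp => //; apply/measurable_EFinP.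
      exact: measurable_from_sub (mNT t).
    + have [B [mB B0 HB]] := MN _ t1; exists B; split => // w /= Hw; apply: HB => /= Hw'.
      by apply: Hw => _; rewrite /= Hw'.
  - split; first by apply/measurable_wrtP/measurable_EFinP; exact: mM.
    move=> D sD; have mD := sub_sigma_measurable (@OY_sub s) sD.
    rewrite [LHS]intMN // [RHS]intMN //; last exact: leq_trans st.
    by rewrite (lik_ratio_martingale X_gaussian X_mean X_cov eps_law eps_indep X_eps_indep
      Y_def mZ gb_ge0 st).
move=> T T1 isI.
pose phi w := \prod_(1 <= t < T.+1) expR (mu / 2 * Q t * h t w ^+ 2).
pose V w := phi w * cmass Scf K m (b w) T / mass0 T w.
have VE w : M T w = N T w -> \prod_(1 <= t < T.+1)
     (((1 + Scf t * gb t) / (1 + A t ^+ 2 * gb t)) `^ (- 2^-1)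
      * expR (mu / 2 * Q t
              * ((1 + A t ^+ 2 * gb t) / (1 + Scf t * gb t))
              * (h t w - (Z t w + A t * gb t * Y t w)
                         / (1 + A t ^+ 2 * gb t)) ^+ 2)) * M T w = V w.
  move=> ->; rewrite /N /lik_ratio /V mulrA; congr (_ / _).
  rewrite /likelihood /phi /cmass -!big_split /=; apply: eq_big_nat => t /andP[t1 _].
  rewrite -(ZE _ _ t1) -gbE ?t1 ?leqnn //; have [? ?] := gb_pos _ t1.
  exact: cost_term.
have mphi : measurable_fun setT (phi : g_sigma_algebraType (obs_gen Y T) -> R).
  apply: measurable_prod => t; rewrite mem_index_iota ltnS => tT.
  apply: measurableT_comp => //; apply: measurable_funM => //; apply: measurable_funX.
  exact: mh.
have mV : measurable_fun setT (V : g_sigma_algebraType (obs_gen Y T) -> R).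
  apply: measurable_funM; last first.
    apply: measurable_inv_ge0; last by move=> w; exact/ltW.
    exact: adapted_mass0.
  apply: measurable_funM => //.
  by apply: (@measurable_cmass _ (g_sigma_algebraType (obs_gen Y T))); exact: mb.
have V0 w : 0 <= V w.
  rewrite divr_ge0 ?(ltW (mass0_gt0 _ _)) // mulr_ge0 //.
    by apply: prodr_ge0 => t _; exact: expR_ge0.
  by apply/ltW/cmass_gt0; exact: pos.
(* At each time, [mu / 2 * Q * (X - h) ^+ 2] is [mu / 2 * Q * h ^+ 2] plus the exponent of the tilt
   by [Scf] and [b], minus the exponent of the tilt for [mu = 0]; [girsanov] is the exponential of
   minus the sum of the latter. *)
have UE w : expR (mu / 2 * \sum_(1 <= s < T.+1) (X s w - h s w) ^+ 2 * Q s) =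
  phi w * expR (tiltw Scf (b w) (fun t => X t : Omega -> R) T w) * girsanov X eps A T w.
  have := girsanov_tilt Y_def T w; set tau := tiltw _ _ _ T w => girE.
  have -> : girsanov X eps A T w = expR (- tau).
    by rewrite expRN -[RHS]mul1r; exact: (canRL (mulfK (lt0r_neq0 (expR_gt0 tau)))).
  rewrite /phi -expR_sum -!expRD; congr expR.
  rewrite /tau /tiltw mulr_sumr -sumrN -!big_split /=; apply: eq_bigr => t _.
  by rewrite /b /Scf /S_coef; field.
(* [filter_bayes] multiplies [V] by [mass0 T] and [girsanov], which removes the denominator;
   [tilted_bayes] then replaces the mass by the exponential tilt, and [UE] recognises the
   integrand. *)
have intUV D : natural_filtration Y T D ->
    (\int[P]_(w in D) (V w)%:E = \int[P]_(w in D)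
      (expR (mu / 2 * \sum_(1 <= s < T.+1) (X s w - h s w) ^+ 2 * Q s))%:E)%E.
  move=> sD; rewrite [LHS]integral_indicM [RHS]integral_indicM.
  have mD := adapted_indic sD.
  rewrite (filter_bayes X_gaussian X_mean X_cov eps_law eps_indep X_eps_indep Y_def
    (n := T) (psi := fun w => \1_D w * V w)); last 2 first.
  - exact: measurable_funM.
  - by move=> w; rewrite mulr_ge0.
  transitivity (\int[P]_w
      ((\1_D w * phi w) * cmass Scf K m (b w) T * girsanov X eps A T w)%:E)%E.
    apply: eq_integral => w _; congr EFin; rewrite -/(mass0 T w) /V.
    by field; exact: lt0r_neq0.
  rewrite -(tilted_bayes X_gaussian X_mean X_cov eps_law eps_indep X_eps_indep Y_def
    (S := Scf) (n := T) (b := b) (phi := fun w => \1_D w * phi w)); last 4 first.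
  - exact: pos.
  - exact: mb.
  - exact: measurable_funM.
  - by move=> w; rewrite mulr_ge0 // prodr_ge0 // => t _; exact: expR_ge0.
  by apply: eq_integral => w _; rewrite UE !mulrA.
split.
  exists (EFin \o V); split=> //.
  by apply/measurable_wrtP/measurable_EFinP.
move=> I [/measurable_wrtP mI IE].
have IV : {ae P, forall w, I w = (V w)%:E}.
  apply: (@eq_sub_integral_ae _ _ _ P _ (@OY_sub T)) => // D sD.
  by rewrite IE // intUV.
have : P.-negligible (~` [set w | M T w = N T w] `|` ~` [set w | I w = (V w)%:E]).
  by apply: negligibleU; [exact: MN|exact: IV].
apply: negligibleS => w /= Hw; apply: contrapT => /not_orP[/contrapT MNw /contrapT IVw].
by apply: Hw; rewrite IVw -VE.
Qed.
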